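(* Let $D\subset\mathbb C$ be a domain of class $C^4$ and let $p\in bD$. Let $F_D$ be any invariant metric on $D$, or the Bergman kernel function on the diagonal of $D$. Then for every $\eta>0$ and all sufficiently small $\nu>0$, $$F_D(z)=\frac{1}{2|z-p|}+\frac{\kappa_p}{4}+O(|z-p|)\qquad\text{for } z\in C_{\eta,\nu}(p).$$
   Context: $bD$ is the boundary of $D$. A domain of class $C^4$ is one given near each boundary point as $\{\phi<0\}$ with $\phi$ real, of class $C^4$ and $\nabla\phi\ne0$ on $bD$. $\kappa_p$ is the curvature of $bD$ at $p$: for a defining function $\phi$ near $p$ with gradient $\eta_p=\nabla\phi(p)$ and real Hessian $H_\phi(p)(v)=\sum_{i,j}\frac{\partial^2\phi}{\partial x_i\partial x_j}(p)v_iv_j$, $\kappa_p=H_\phi(p)(i\eta_p)/\|\eta_p\|^3$ (so the unit disk has $\kappa_p=1$). Pinched cone: if $e^{i\theta}$ is the outward pointing unit normal of $D$ at $p$, then for $\eta,\nu>0$ $$C_{\eta,\nu}(p)=\{z:|\mathrm{Im}(e^{-i\theta}(z-p))|<\eta\,\mathrm{Re}(e^{-i\theta}(z-p))^2,\ -\nu<\mathrm{Re}(e^{-i\theta}(z-p))<0\}.$$ Invariant metrics: $\triangle$ denotes the unit disk. For a domain $\Omega\subset\mathbb C^n$, the Kobayashi metric is $K_\Omega(z,\xi)=\inf\{\lambda>0:\exists f:\triangle\to\Omega\text{ holomorphic},f(0)=z,\lambda f'(0)=\xi\}$ and the Carathéodory metric is $C_\Omega(z,\xi)=\sup\{|df_z(\xi)|:f:\Omega\to\triangle\text{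 holomorphic},f(z)=0\}$. An invariant metric is a family $F$ of metrics $F_\Omega(z,\xi)\ge0$, defined for all domains $\Omega\subset\mathbb C^n$, with $F_\triangle=K_\triangle=C_\triangle$ and $F_{\Omega_2}(g(z),dg_z(\xi))\le F_{\Omega_1}(z,\xi)$ for every holomorphic $g:\Omega_1\to\Omega_2$. For planar domains $F_D(z)$ means $F_D(z,1)$; on the unit disk $F_\triangle(z)=\frac1{1-|z|^2}$. The Bergman kernel function on the diagonal is the function $z\mapsto B_D(z,z)$, where $B_D$ is the Bergman kernel of $D$, i.e. the reproducing kernel of the space of square integrable holomorphic functions on $D$.
   Formalization: For the Bergman case, F_D(z) is taken to be the square root of π·B_D(z,z) instead of B_D(z,z): the literal claim is false already on the unit disk, where B_D(z,z) = 1/(π(1−|z|²)²) blows up like 1/(4π|z−p|²). *)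

(* Defs.v *)
From HB Require Import structures.
From mathcomp Require Import all_boot all_order all_algebra.
From mathcomp Require Import all_classical all_reals all_analysis.
From mathcomp Require Import complex.

Set Implicit Arguments.
Unset Strict Implicit.
Unset Printing Implicit Defensive.

Import Order.TTheory GRing.Theory Num.Theory.
Import numFieldNormedType.Exports.
Import ComplexField.Normc.

Local Open Scope classical_set_scope.
Local Open Scope ring_scope.
Local Open Scope complex_scope.

(* The complex plane over [R : realType] is [R[i]], given here the normed module
   structure of the regular module [R[i]^o], as MathComp-Analysis does for its
   other number fields. [normc z : R] is the modulus; [complex.Re z] and
   [complex.Im z] are real-valued. *)
HB.instance Definition _ (R : realType) := GRing.ComAlgebra.copy R[i] R[i]^o.
HB.instance Definition _ (R : realType) := Vector.copy R[i] R[i]^o.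
HB.instance Definition _ (R : realType) := NormedModule.copy R[i] R[i]^o.

Definition is_domain (T : topologicalType) (Omega : set T) : Prop :=
  [/\ Omega !=set0, open Omega & connected Omega].

Definition boundary (T : topologicalType) (A : set T) : set T :=
  closure A `\` A°.

(* Complex differentiability, since the scalar field is [R[i]]. *)
Definition holomorphic_on (R : realType) (V W : normedModType R[i])
  (Omega : set V) (f : V -> W) : Prop :=
  forall z, Omega z -> differentiable f z.

Section InvariantMetrics.
Variable R : realType.

Definition unit_disk : set R[i] := [set z | normc z < 1].

(* A planar set as a subset of C^1. *)
Definition planar (D : set R[i]) : set 'rV[R[i]]_1 :=
  [set v | D (v ord0 ord0)].

Definition kobayashi (n : nat) (Omega : set 'rV[R[i]]_n)
    (z xi : 'rV[R[i]]_n) : R :=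
  inf [set lambda : R | 0 < lambda /\
    exists f : R[i] -> 'rV[R[i]]_n,
      [/\ holomorphic_on unit_disk f,
          (forall w, unit_disk w -> Omega (f w)),
          f 0 = z &
          lambda%:C *: 'd f 0 1 = xi]].

Definition caratheodory (n : nat) (Omega : set 'rV[R[i]]_n)
    (z xi : 'rV[R[i]]_n) : R :=
  sup [set x : R |
    exists f : 'rV[R[i]]_n -> R[i],
      [/\ holomorphic_on Omega f,
          (forall w, Omega w -> unit_disk (f w)),
          f z = 0 &
          x = normc ('d f z xi)]].

Definition metric_family :=
  forall n : nat, set 'rV[R[i]]_n -> 'rV[R[i]]_n -> 'rV[R[i]]_n -> R.

Record invariant_metric (F : metric_family) : Prop := InvariantMetric {
  invariant_metric_ge0 : forall (n : nat) (Omega : set 'rV[R[i]]_n)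
      (z xi : 'rV[R[i]]_n),
    (0 < n)%N -> is_domain Omega -> Omega z -> 0 <= F n Omega z xi;
  invariant_metric_disk : forall z xi : 'rV[R[i]]_1, planar unit_disk z ->
    F 1 (planar unit_disk) z xi = kobayashi (planar unit_disk) z xi /\
    F 1 (planar unit_disk) z xi = caratheodory (planar unit_disk) z xi;
  invariant_metric_decreasing : forall (n m : nat)
      (Omega1 : set 'rV[R[i]]_n) (Omega2 : set 'rV[R[i]]_m)
      (g : 'rV[R[i]]_n -> 'rV[R[i]]_m) (z xi : 'rV[R[i]]_n),
    (0 < n)%N -> (0 < m)%N -> is_domain Omega1 -> is_domain Omega2 ->
    holomorphic_on Omega1 g -> (forall w, Omega1 w -> Omega2 (g w)) ->
    Omega1 z ->
    F m Omega2 (g z) ('d g z xi) <= F n Omega1 z xi }.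

Definition planar_metric (F : metric_family) (D : set R[i])
    (z : R[i]) : R :=
  F 1 (planar D) (const_mx z) (const_mx 1).

End InvariantMetrics.

Section BergmanKernel.
Variable R : realType.

Local Notation mu2 := (@lebesgue_measure R \x @lebesgue_measure R)%E.

Definition real_plane (D : set R[i]) : set (R * R) :=
  [set x | D (x.1 +i* x.2)].

Definition area_integral (D : set R[i]) (f : R[i] -> R[i]) : R[i] :=
  (Rintegral mu2 (real_plane D)
     (fun x => complex.Re (f (x.1 +i* x.2)))) +i*
  (Rintegral mu2 (real_plane D)
     (fun x => complex.Im (f (x.1 +i* x.2)))).

Definition bergman_space (D : set R[i]) : set (R[i] -> R[i]) :=
  [set f | holomorphic_on D f /\
    (\int[mu2]_(x in real_plane D)
      (normc (f (x.1 +i* x.2)) ^+ 2)%:E < +oo)%E].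

Definition is_bergman_kernel (D : set R[i])
    (B : R[i] -> R[i] -> R[i]) : Prop :=
  forall z, D z ->
    bergman_space D (B ^~ z) /\
    forall f, bergman_space D f ->
      f z = area_integral D (fun w => f w * conjc (B w z)).

(* The kernel of the unit disk is [1 / (pi * (1 - |z|^2)^2)] on the diagonal;
   this normalization turns it into [1 / (1 - |z|^2)], the common value of the
   invariant metrics there. *)
Definition bergman_diag (B : R[i] -> R[i] -> R[i]) (z : R[i]) : R :=
  Num.sqrt (pi * complex.Re (B z z)).

End BergmanKernel.

Section BoundaryGeometry.
Variable R : realType.
Implicit Types (phi : R[i] -> R) (D U : set R[i]) (p z v : R[i]).

(* The real directional derivative of [phi] along [v] at [z] is the derivative
   at [0] of the restriction of [phi] to the real line [z + R v]. *)
Definition on_line phi z v : R -> R := fun t => phi (z + t%:C * v).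

Definition dx phi : R[i] -> R := fun z => derive1 (on_line phi z 1) 0.
Definition dy phi : R[i] -> R := fun z => derive1 (on_line phi z 'i%C) 0.

Fixpoint class_C (k : nat) U phi : Prop :=
  (forall z, U z -> {for z, continuous phi}) /\
  if k is k'.+1 then
    [/\ (forall z, U z -> derivable (on_line phi z 1) 0 1 /\
                          derivable (on_line phi z 'i%C) 0 1),
        class_C k' U (dx phi) & class_C k' U (dy phi)]
  else True.

Definition gradient phi p : R[i] := dx phi p +i* dy phi p.

Definition hessian phi p v : R :=
  dx (dx phi) p * complex.Re v * complex.Re v +
  dx (dy phi) p * complex.Re v * complex.Im v +
  dy (dx phi) p * complex.Im v * complex.Re v +
  dy (dy phi) p * complex.Im v * complex.Im v.

Definition local_defining (k : nat) D p phi : Prop :=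
  exists U : set R[i],
    [/\ open U, U p, class_C k U phi,
        (forall z, U z -> (D z <-> phi z < 0)) &
        (forall z, U z -> boundary D z -> gradient phi z != 0)].

Definition domain_of_class (k : nat) D : Prop :=
  is_domain D /\
  forall p, boundary D p -> exists phi, local_defining k D p phi.

Definition curvature phi p : R :=
  hessian phi p ('i%C * gradient phi p) / normc (gradient phi p) ^+ 3.

Definition outward_normal phi p : R[i] :=
  gradient phi p / (normc (gradient phi p))%:C.

(* For the unit vector [u = e^{i theta}], [conjc u] is [e^{-i theta}]. *)
Definition pinched_cone (u p : R[i]) (eta nu : R) : set R[i] :=
  [set z | let w := conjc u * (z - p) in
    `|complex.Im w| < eta * complex.Re w ^+ 2 /\ - nu < complex.Re w < 0].

End BoundaryGeometry.

(* Main.v *)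
Require Import Defs.
From HB Require Import structures.
From mathcomp Require Import all_boot all_order all_algebra.
From mathcomp Require Import all_classical all_reals all_analysis.
From mathcomp Require Import complex.
From mathcomp Require Import measurable_realfun.
From mathcomp Require Import ring lra.
Import Order.TTheory GRing.Theory Num.Theory.
Import numFieldNormedType.Exports.
Import ComplexField.Normc.
Local Open Scope classical_set_scope.
Local Open Scope ring_scope.
Local Open Scope complex_scope.

Set Implicit Arguments.
Unset Strict Implicit.
Unset Printing Implicit Defensive.

(** Write a point near [p] as [p + u / zeta], where [u] is the outer unit normal. By the fourth-order
    Taylor formula, [D] becomes near [zeta = oo] the region
    [Re zeta < - kappa_p / 2 - b Im zeta / |zeta|^2 + O(|zeta|^-2)], for some real [b]. With
    [c = L m + i b] or [c = L m - i b], [m] large and [L] larger than the remaining constants,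
    [v |-> v + A + c / v] is injective on a half-plane [Re v < - m]; one such map embeds [D] in the left
    half-plane, and another embeds a half-plane in [D]. Comparing [F_D] with the invariant metric of
    these half-planes bounds it on both sides by explicit quantities, each equal to
    [1 / (2 |z - p|) + kappa_p / 4 + O(|z - p|)] on the pinched cone. For the Bergman kernel the
    comparison is made through the reproducing property, the area mean value inequality on the unit
    disk, and the change of variables under a conformal map. *)

(** The obstacle is that [D] is described only near [p], may be unbounded or multiply connected, and
    that comparison with half-planes [Re zeta < - kappa_p / 2 - e] or [+ e] could at best give
    [kappa_p / 4] up to a multiple of [e]. The edge of the half-plane is therefore bent at infinity.
    On [Re v = - m] the real part of [L m / v] equals [- L m^2 / |v|^2]: it decays at the rate of
    the Taylor remainder and, [L] being large, dominates it. The imaginary part of [c] takes care of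
    the term with [b], which has the larger order [1 / |zeta|]. The shift by [m] serves two ends. It
    makes [c / v] small against [v], hence the map injective; and it brings the points of [D] away
    from [p], where [zeta] is bounded, close to [- m] in proportion to [m], where a margin of order
    [L] is available and no knowledge of [D] is called for. On the pinched cone
    [Re zeta = - 1 / |z - p| + O(|z - p|)]; on a cone of fixed opening the leading term would
    already be different. *)

Local Notation Re := complex.Re.
Local Notation Im := complex.Im.

(** * The complex plane and complex derivatives *)

Section Modulus.
Variable R : realType.
Implicit Types z w : R[i].

Lemma normc_ge0 z : 0 <= normc z.
Proof. by case: z => a b; exact: sqrtr_ge0. Qed.

Lemma sqr_normcE z : normc z ^+ 2 = Re z ^+ 2 + Im z ^+ 2.
Proof. by case: z => a b /=; rewrite sqr_sqrtr // addr_ge0 ?sqr_ge0. Qed.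

Lemma normc_eq0 z : (normc z == 0) = (z == 0).
Proof. by apply/eqP/eqP => [/eq0_normc //|->]; rewrite normc0. Qed.

Lemma normc_gt0 z : (0 < normc z) = (z != 0).
Proof. by rewrite lt_def normc_eq0 normc_ge0 andbT. Qed.

Lemma normcB z w : normc (z - w) = normc (w - z).
Proof. by rewrite -normcN opprB. Qed.

Lemma normcR (x : R) : normc x%:C = `|x|.
Proof. by rewrite /= expr0n addr0 sqrtr_sqr. Qed.

Lemma normc_le (z : R[i]) (x : R) : 0 <= x -> Re z ^+ 2 + Im z ^+ 2 <= x ^+ 2 -> normc z <= x.
Proof.
by move=> x0; rewrite -sqr_normcE ler_sqr // nnegrE normc_ge0.
Qed.

Lemma normc_lt (z : R[i]) (x : R) : 0 <= x -> Re z ^+ 2 + Im z ^+ 2 < x ^+ 2 -> normc z < x.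
Proof. by move=> x0; rewrite -sqr_normcE ltr_sqr // nnegrE normc_ge0. Qed.

Lemma Re_le_normc z : `|Re z| <= normc z.
Proof.
by rewrite -ler_sqr ?nnegrE ?normc_ge0 // sqr_normcE real_normK ?num_real // lerDl sqr_ge0.
Qed.

Lemma Im_le_normc z : `|Im z| <= normc z.
Proof.
by rewrite -ler_sqr ?nnegrE ?normc_ge0 // sqr_normcE real_normK ?num_real // lerDr sqr_ge0.
Qed.

Lemma normc_le_ReIm z : normc z <= `|Re z| + `|Im z|.
Proof.
apply: normc_le; first by rewrite addr_ge0.
rewrite -[Re z ^+ 2]real_normK ?num_real // -[Im z ^+ 2]real_normK ?num_real //.
have := normr_ge0 (Re z); have := normr_ge0 (Im z); nra.
Qed.

Lemma ler_normcB z w : normc z - normc w <= normc (z - w).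
Proof. by rewrite lerBlDr; apply: le_trans (le_normcD _ _); rewrite subrK. Qed.

Lemma normc_triangle z w u : normc (z - u) <= normc (z - w) + normc (w - u).
Proof. by apply: le_trans (le_normcD _ _); rewrite addrA subrK. Qed.

Lemma Re_add z w : Re (z + w) = Re z + Re w. Proof. by case: z; case: w. Qed.
Lemma Im_add z w : Im (z + w) = Im z + Im w. Proof. by case: z; case: w. Qed.
Lemma Re_opp z : Re (- z) = - Re z. Proof. by case: z. Qed.
Lemma Im_opp z : Im (- z) = - Im z. Proof. by case: z. Qed.
Lemma Re_mul z w : Re (z * w) = Re z * Re w - Im z * Im w.
Proof. by case: z; case: w. Qed.
Lemma Im_mul z w : Im (z * w) = Re z * Im w + Im z * Re w.
Proof. by case: z; case: w. Qed.
Definition ReImE := (Re_add, Im_add, Re_opp, Im_opp, Re_mul, Im_mul).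

Lemma complexP z w : Re z = Re w -> Im z = Im w -> z = w.
Proof. by case: z; case: w => a b c d /= -> ->. Qed.

Lemma normcXn z n : normc (z ^+ n) = normc z ^+ n.
Proof. by elim: n => [|n IH]; rewrite ?expr0 ?normc1 // !exprS normcM IH. Qed.

Lemma normc_conj z : normc (conjc z) = normc z.
Proof. by case: z => a b; rewrite /= sqrrN. Qed.

Lemma mulc_conj z : z * conjc z = (normc z ^+ 2)%:C.
Proof.
apply: complexP; rewrite !ReImE /=; case: z => a b /=; last by ring.
by rewrite sqr_sqrtr ?addr_ge0 ?sqr_ge0 //; ring.
Qed.

Lemma invc_eq z : z^-1 = (normc z ^- 2)%:C * conjc z.
Proof.
have [->|z0] := eqVneq z 0; first by rewrite invr0 conjc0 mulr0.
apply: (mulfI z0); rewrite divff // mulrCA mulc_conj -rmorphM /= mulVf //.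
by rewrite expf_neq0 // normc_eq0.
Qed.

Lemma normr_normc z : `|z| = (normc z)%:C.
Proof. by rewrite normc_def; case: z. Qed.

(** Balls of [R[i]] have radii in [R[i]]; a positive radius has zero imaginary part, so its real
    part can replace it. All topology of the plane is read below with real radii. *)
Lemma nbhs_normcP z (A : set R[i]) :
  nbhs z A <-> exists2 d : R, 0 < d & forall w, normc (w - z) < d -> A w.
Proof.
split=> [/nbhs_ballP[e /=]|[d d0 H]].
  rewrite ltcE /= => /andP[/eqP e1 e0] H; exists (Re e) => // w hw; apply: H.
  by rewrite /ball /= normr_normc ltcE /= e1 eqxx /= normcB.
apply/nbhs_ballP; exists d%:C; rewrite /= ?ltcR // => w.
by rewrite /ball /= normr_normc ltcR normcB; exact: H.
Qed.

Lemma open_normcP (A : set R[i]) :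
  open A <-> forall z, A z -> exists2 d : R, 0 < d & forall w, normc (w - z) < d -> A w.
Proof.
by rewrite openE; split=> H z Az; apply/nbhs_normcP; apply: H.
Qed.

Lemma cvg_normcP (T : Type) (F : set_system T) {FF : Filter F} (f : T -> R[i]) (l : R[i]) :
  f @ F --> l <-> forall e : R, 0 < e -> \forall x \near F, normc (f x - l) < e.
Proof.
split=> [H e e0|H].
  have /H : nbhs l [set y | normc (y - l) < e] by apply/nbhs_normcP; exists e.
  by [].
move=> A /nbhs_normcP[d d0 dA]; rewrite /nbhs /=.
by near=> x; apply: dA; near: x; apply: H.
Unshelve. all: by end_near. Qed.

Lemma continuous_normcP (f : R[i] -> R[i]) z :
  {for z, continuous f} <->
  forall e : R, 0 < e -> exists2 d : R, 0 < d & forall w, normc (w - z) < d -> normc (f w - f z) < e.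
Proof.
split=> [H e e0|H A /nbhs_normcP[d d0 dA]].
  have /H : nbhs (f z) [set y | normc (y - f z) < e] by apply/nbhs_normcP; exists e.
  by move=> /nbhs_normcP.
have [d1 d10 d1H] := H _ d0.
by apply/nbhs_normcP; exists d1 => // w /d1H /dA.
Qed.

End Modulus.

(** * Complex differentiability in epsilon-delta form *)

Section ComplexDerivative.
Variable R : realType.
Implicit Types (f g : R[i] -> R[i]) (z w a b : R[i]).

(** The difference quotient is cleared of its denominator, so [w = z] is no exception and the
    estimate applies directly to moduli. *)
Definition cderiv f z a := forall e : R, 0 < e -> exists2 d : R, 0 < d &
  forall w, normc (w - z) < d -> normc (f w - f z - a * (w - z)) <= e * normc (w - z).

Lemma cderivP f z a : cderiv f z a <-> is_derive z 1 f a.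
Proof.
split=> [H|[df <-] e e0].
  suff K : h^-1 *: (f (h *: 1 + z) - f z) @[h --> 0^'] --> a.
    by apply: DeriveDef; [apply/cvg_ex; exists a|apply/cvg_lim].
  apply/cvg_normcP => e e0; have [d d0 dH] := H _ (divr_gt0 e0 (ltr0n _ 2)).
  rewrite near_withinE; apply/nbhs_normcP; exists d => // w wd /= w0.
  have w1 : w + z - z = w by rewrite addrK.
  have := dH (w + z); rewrite w1 -{1}[w]subr0 => /(_ wd) {}dH.
  rewrite /GRing.scale /= mulr1.
  have -> : w^-1 * (f (w + z) - f z) - a = w^-1 * (f (w + z) - f z - a * w).
    by rewrite !mulrBr mulrCA mulVf ?mulr1.
  rewrite normcM normcV; have nw : 0 < normc w by rewrite normc_gt0.
  by rewrite mulrC ltr_pdivrMr //; apply: le_lt_trans dH _; rewrite ltr_pM2r //; lra.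
have /cvg_normcP/(_ _ e0) : h^-1 *: (f (h *: 1 + z) - f z) @[h --> 0^'] --> 'D_1 f z by [].
rewrite near_withinE => /nbhs_normcP[d d0 dH]; exists d => // w wd.
have [->|wz] := eqVneq w z; first by rewrite !subrr mulr0 subr0 normc0 mulr0.
have wz0 : w - z != 0 by rewrite subr_eq0.
have := dH (w - z); rewrite subr0 => /(_ wd wz0).
rewrite /GRing.scale /= mulr1 subrK => {}dH.
have nw : 0 < normc (w - z) by rewrite normc_gt0.
have -> : f w - f z - 'D_1 f z * (w - z) =
   (w - z) * ((w - z)^-1 * (f w - f z) - 'D_1 f z).
  rewrite [RHS]mulrBr mulrA divff // mul1r; congr (_ - _); exact: mulrC.
by rewrite normcM mulrC ler_pM2r // ltW.
Qed.

Lemma cderiv_diff f z a : cderiv f z a -> differentiable f z.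
Proof. by move=> /cderivP[df _]; apply/derivable1_diffP. Qed.

Lemma diff_cderiv f z : differentiable f z -> cderiv f z ('d f z 1).
Proof.
move=> df; apply/cderivP; apply: DeriveDef; first exact: diff_derivable.
by rewrite deriveE.
Qed.

Lemma cderiv_dE f z a h : cderiv f z a -> 'd f z h = h * a.
Proof.
move=> H; have /cderivP[_ <-] := H; have dd := cderiv_diff H.
have -> : 'd f z h = h *: 'd f z 1 by rewrite -linearZ /= /GRing.scale /= mulr1.
by rewrite deriveE.
Qed.

Lemma cderiv_unique f z a b : cderiv f z a -> cderiv f z b -> a = b.
Proof. by move=> /cderivP[_ <-] /cderivP[_ <-]. Qed.

Lemma cderiv_cont f z a : cderiv f z a -> {for z, continuous f}.
Proof. by move=> /cderiv_diff/differentiable_continuous. Qed.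

Lemma cderiv_cst z b : cderiv (fun=> b) z 0.
Proof. by apply/cderivP; exact: is_derive_cst. Qed.

Lemma cderiv_id z : cderiv id z 1.
Proof. by apply/cderivP; exact: is_derive_id. Qed.

Lemma cderivD f g z a b : cderiv f z a -> cderiv g z b ->
  cderiv (fun x => f x + g x) z (a + b).
Proof. by move=> /cderivP ? /cderivP ?; apply/cderivP; exact: is_deriveD. Qed.

Lemma cderivN f z a : cderiv f z a -> cderiv (fun x => - f x) z (- a).
Proof. by move=> /cderivP ?; apply/cderivP; exact: is_deriveN. Qed.

Lemma cderivM f g z a b : cderiv f z a -> cderiv g z b ->
  cderiv (fun x => f x * g x) z (f z * b + g z * a).
Proof. by move=> /cderivP ? /cderivP ?; apply/cderivP; exact: is_deriveM. Qed.

Lemma cderiv_inv z : z != 0 -> cderiv (fun x => x^-1) z (- z ^- 2).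
Proof.
move=> z0; apply/cderivP; have df := differentiable_Rinv z0.
apply: DeriveDef; first exact/derivable1_diffP.
by rewrite deriveE // diff_Rinv // /GRing.scale /= mulr1.
Qed.

Lemma cderiv_comp f g z a b : cderiv f z a -> cderiv g (f z) b ->
  cderiv (fun x => g (f x)) z (b * a).
Proof.
move=> fa gb e e0.
have a0 := normc_ge0 a; have b0 := normc_ge0 b.
(* [e2 <= 1] gives [|f w - f z| <= (|a| + 1) |w - z|]; then the errors of [g] and of [f] contribute
   at most [e / 2] each. *)
pose e1 := e / 2 / (normc a + 1); pose e2 := Num.min 1 (e / 2 / (normc b + 1)).
have e10 : 0 < e1 by rewrite !divr_gt0 //; lra.
have e20 : 0 < e2 by rewrite lt_min ltr01 !divr_gt0 //; lra.
have [d1 d10 H1] := gb _ e10; have [d2 d20 H2] := fa _ e20.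
pose d := Num.min d2 (d1 / (normc a + 1)).
exists d => [|w]; first by rewrite lt_min d20 divr_gt0 //; lra.
rewrite lt_min => /andP[wd2 wd1].
have h2 := H2 _ wd2; have n0 := normc_ge0 (w - z).
have e21 : e2 <= 1 by rewrite ge_min lexx.
have e2b : e2 * normc b <= e / 2.
  have h : e2 <= e / 2 / (normc b + 1) by rewrite ge_min lexx orbT.
  apply: le_trans (ler_wpM2r b0 h) _; rewrite mulrAC ler_pdivrMr; last by lra.
  by nra.
have hf : normc (f w - f z) <= (normc a + 1) * normc (w - z).
  have -> : f w - f z = (f w - f z - a * (w - z)) + a * (w - z) by rewrite subrK.
  by apply: le_trans (le_normcD _ _) _; rewrite normcM; nra.
have hd1 : normc (f w - f z) < d1.
  by apply: le_lt_trans hf _; rewrite mulrC -ltr_pdivlMr //; lra.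
have h1 := H1 _ hd1.
have -> : g (f w) - g (f z) - b * a * (w - z) =
  (g (f w) - g (f z) - b * (f w - f z)) + b * (f w - f z - a * (w - z)) by ring.
apply: le_trans (le_normcD _ _) _; rewrite normcM.
have k1 : e1 * normc (f w - f z) <= e / 2 * normc (w - z).
  apply: le_trans (ler_wpM2l (ltW e10) hf) _.
  by rewrite mulrA /e1 divfK ?lexx //; apply/eqP; lra.
nra.
Qed.

Lemma cderiv_near f g z a (d : R) : 0 < d ->
  (forall w, normc (w - z) < d -> f w = g w) -> cderiv f z a -> cderiv g z a.
Proof.
move=> d0 fg H e e0; have [d1 d10 dH] := H _ e0.
exists (Num.min d d1); first by rewrite lt_min d0.
move=> w; rewrite lt_min => /andP[wd wd1]; rewrite -!fg ?subrr ?normc0 //.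
exact: dH.
Qed.

Lemma cderivV f z a : f z != 0 -> cderiv f z a -> cderiv (fun x => (f x)^-1) z (- f z ^- 2 * a).
Proof. by move=> f0 fa; apply: (cderiv_comp fa); exact: cderiv_inv. Qed.

Lemma holomorphic_onP (D : set R[i]) f :
  holomorphic_on D f <-> forall z, D z -> exists a, cderiv f z a.
Proof.
split=> H z Dz; first by eexists; exact/diff_cderiv/H.
by have [a /cderiv_diff] := H _ Dz.
Qed.

End ComplexDerivative.

(** * Mean value property and Cauchy estimate *)

Section Bisection.
Variable R : realType.
Variables (a0 b0 s0 : R) (P : R -> R -> R -> Prop).
Hypothesis s00 : 0 < s0.
Hypothesis Psplit : forall a b s, 0 < s -> a0 <= a -> a + s <= a0 + s0 ->
  b0 <= b -> b + s <= b0 + s0 ->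
  P a b (s / 2) -> P (a + s / 2) b (s / 2) ->
  P a (b + s / 2) (s / 2) -> P (a + s / 2) (b + s / 2) (s / 2) -> P a b s.
Hypothesis Plocal : forall x y, a0 <= x <= a0 + s0 -> b0 <= y <= b0 + s0 ->
  exists2 d, 0 < d & forall a b s, 0 < s < d -> a0 <= a -> a + s <= a0 + s0 ->
    b0 <= b -> b + s <= b0 + s0 -> a <= x <= a + s -> b <= y <= b + s -> P a b s.

Let ok (t : R * R * R) := [/\ a0 <= t.1.1, t.1.1 + t.2 <= a0 + s0, b0 <= t.1.2,
  t.1.2 + t.2 <= b0 + s0 & 0 < t.2].

(** If [P] fails on a square it fails on one of its quarters, and so on; the nested bad squares
    shrink to a point, where [Plocal] is contradicted. It serves both Goursat's argument and the
    comparison of areas under a conformal map. *)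
Lemma square_bisection : P a0 b0 s0.
Proof.
apply: contrapT => nP.
(* The conditions on [t] are kept inside the existential, so that every triple has a successor and
   [choice] yields a total function. *)
have step (t : R * R * R) : exists t' : R * R * R,
    ok t -> ~ P t.1.1 t.1.2 t.2 ->
    [/\ ok t', ~ P t'.1.1 t'.1.2 t'.2, t'.2 = t.2 / 2, t.1.1 <= t'.1.1 /\
        t'.1.1 + t'.2 <= t.1.1 + t.2 & t.1.2 <= t'.1.2 /\
        t'.1.2 + t'.2 <= t.1.2 + t.2].
  case: t => [[a b] s] /=.
  have [[h1 h2 h3 h4 h5]|] := pselect (ok (a, b, s)); last by exists (a, b, s).
  move: h1 h2 h3 h4 h5 => /= h1 h2 h3 h4 h5.
  have [?|n1] := pselect (P a b s); first by exists (a, b, s).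
  have [q1|n2] := pselect (P a b (s / 2)); last first.
    by exists (a, b, s / 2) => _ _; rewrite /ok /=; split => //; split; lra.
  have [q2|n3] := pselect (P (a + s / 2) b (s / 2)); last first.
    by exists (a + s / 2, b, s / 2) => _ _; rewrite /ok /=; split => //; split; lra.
  have [q3|n4] := pselect (P a (b + s / 2) (s / 2)); last first.
    by exists (a, b + s / 2, s / 2) => _ _; rewrite /ok /=; split => //; split; lra.
  have [q4|n5] := pselect (P (a + s / 2) (b + s / 2) (s / 2)); last first.
    by exists (a + s / 2, b + s / 2, s / 2) => _ _; rewrite /ok /=; split => //; split; lra.
  by exfalso; apply: n1; apply: Psplit.
have [f fP] := choice step.
pose u n := iter n f (a0, b0, s0).
have uP n : ok (u n) /\ ~ P (u n).1.1 (u n).1.2 (u n).2.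
  elim: n => [|n [IH1 IH2]]; first by rewrite /u /ok /=; split => //; split.
  by have [] := fP _ IH1 IH2.
have uS n : [/\ (u n.+1).2 = (u n).2 / 2, (u n).1.1 <= (u n.+1).1.1 /\
        (u n.+1).1.1 + (u n.+1).2 <= (u n).1.1 + (u n).2 & (u n).1.2 <= (u n.+1).1.2 /\
        (u n.+1).1.2 + (u n.+1).2 <= (u n).1.2 + (u n).2].
  by have [IH1 IH2] := uP n; have [] := fP _ IH1 IH2.
have us n : (u n).2 = s0 / 2 ^+ n.
  elim: n => [|n IH]; first by rewrite expr0 divr1.
  by have [-> _ _] := uS n; rewrite IH exprS invfM mulrA mulrAC.
have mono n k : (u n).1.1 <= (u (n + k)%N).1.1 /\ (u n).1.2 <= (u (n + k)%N).1.2 /\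
   (u (n + k)%N).1.1 + (u (n + k)%N).2 <= (u n).1.1 + (u n).2 /\
   (u (n + k)%N).1.2 + (u (n + k)%N).2 <= (u n).1.2 + (u n).2.
  elim: k => [|k [k1 [k2 [k3 k4]]]]; first by rewrite addn0.
  rewrite addnS; have [_ [h1 h2] [h3 h4]] := uS (n + k)%N.
  by do !split; [exact: le_trans h1|exact: le_trans h3|exact: le_trans k3|exact: le_trans k4].
have cross m n : (u m).1.1 <= (u n).1.1 + (u n).2 /\ (u m).1.2 <= (u n).1.2 + (u n).2.
  have [[_ _ _ _ p1] _] := uP m; have [[_ _ _ _ p2] _] := uP n.
  have [mn|nm] := leqP m n.
    have := mono m (n - m)%N; rewrite subnKC // => -[h1 [h2 _]].
    by split; apply: ler_wpDr => //; exact: ltW.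
  have := mono n (m - n)%N; rewrite subnKC ?(ltnW nm) // => -[_ [_ [h1 h2]]].
  by split; [apply: le_trans h1|apply: le_trans h2]; rewrite lerDl ltW.
(* The lower left corners increase and stay below all upper right corners, so the suprema of their
   coordinates give a point common to all the squares. *)
pose X := [set (u n).1.1 | n in setT]; pose Y := [set (u n).1.2 | n in setT].
have Xu n : ubound X ((u n).1.1 + (u n).2) by move=> _ [m _ <-]; have [] := cross m n.
have Yu n : ubound Y ((u n).1.2 + (u n).2) by move=> _ [m _ <-]; have [] := cross m n.
have X0 : X !=set0 by exists (u 0%N).1.1; exists 0%N.
have Y0 : Y !=set0 by exists (u 0%N).1.2; exists 0%N.
have Xs : has_sup X by split => //; exists ((u 0%N).1.1 + (u 0%N).2).
have Ys : has_sup Y by split => //; exists ((u 0%N).1.2 + (u 0%N).2).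
have xP n : (u n).1.1 <= sup X <= (u n).1.1 + (u n).2.
  by rewrite ge_sup // andbT; apply: ub_le_sup; [case: Xs|exists n].
have yP n : (u n).1.2 <= sup Y <= (u n).1.2 + (u n).2.
  by rewrite ge_sup // andbT; apply: ub_le_sup; [case: Ys|exists n].
have [d d0 dP] := Plocal (xP 0%N) (yP 0%N).
pose n := Num.bound (s0 / d).
have [[? ? ? ? sn0] un] := uP n; apply: un; apply: dP => //.
apply/andP; split => //; rewrite us ltr_pdivrMr ?exprn_gt0 //.
have : s0 / d < n%:R by apply: archi_boundP; rewrite divr_ge0 // ltW.
rewrite ltr_pdivrMr // => h; apply: lt_le_trans h _.
rewrite mulrC ler_pM2l // -natrX ler_nat ltnW //; exact: ltn_expl.
Qed.

End Bisection.

Section RealSeg.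
Variable R : realType.
Implicit Types f g : R -> R.
Notation mu := (@lebesgue_measure R).

Definition seg a b f : R := \int[mu]_(x in `[a, b]) f x.

Definition continuous_on a b f := forall x, a <= x <= b -> {for x, continuous f}.

Lemma continuous_on_integrable a b f : continuous_on a b f ->
  mu.-integrable `[a, b] (EFin \o f).
Proof.
move=> cf; apply: continuous_compact_integrable; first exact: segment_compact.
by apply: continuous_in_subspaceT => x; rewrite inE /= in_itv /= => /cf.
Qed.

Lemma continuous_onB a b f g : continuous_on a b f -> continuous_on a b g ->
  continuous_on a b (fun x => f x - g x).
Proof. by move=> cf cg x xab; apply: continuousB; [exact: cf|exact: cg]. Qed.

Lemma continuous_onW a b c d f : a <= c -> d <= b -> continuous_on a b f ->
  continuous_on c d f.
Proof. by move=> ac db cf x /andP[? ?]; apply: cf; apply/andP; split; lra. Qed.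

Lemma seg_split a c b f : a <= c -> c <= b -> continuous_on a b f ->
  seg a b f = seg a c f + seg c b f.
Proof.
move=> ac cb cf; have i1 := continuous_on_integrable cf.
have := @Rintegral_itvB R f (BLeft a) (BRight b) c i1.
rewrite !bnd_simp => /(_ ac cb); rewrite Rintegral_itv_obnd_cbnd.
  by rewrite /seg => <-; rewrite addrC subrK.
by apply: integrableS i1 => //; apply: subset_itvr; rewrite bnd_simp.
Qed.

Lemma segB a b f g : continuous_on a b f -> continuous_on a b g ->
  seg a b (fun x => f x - g x) = seg a b f - seg a b g.
Proof.
by move=> cf cg; rewrite /seg RintegralB //; apply: continuous_on_integrable.
Qed.

Lemma seg_cst a b c : a <= b -> seg a b (fun=> c) = c * (b - a).
Proof.
move=> ab; rewrite /seg Rintegral_cst //; congr (_ * _).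
by rewrite /= [X in fine X]lebesgue_measure_itv /= lte_fin; case: ltgtP ab => // ->; rewrite subrr.
Qed.

Lemma seg_bound a b f c e : a <= b -> continuous_on a b f ->
  (forall x, a <= x <= b -> `|f x - c| <= e) -> `|seg a b f - c * (b - a)| <= e * (b - a).
Proof.
move=> ab cf H; rewrite ler_norml -(seg_cst c ab) -(seg_cst e ab).
have i1 := continuous_on_integrable cf.
have ic k : mu.-integrable `[a, b] (EFin \o (fun=> k : R)).
  by apply: continuous_on_integrable => x _; exact: cst_continuous.
have h x : x \in `[a, b] -> c - e <= f x <= c + e.
  by rewrite in_itv /= => /H; rewrite ler_distl.
have L : seg a b (fun=> c - e) <= seg a b f.
  by apply: le_Rintegral => // x /h /andP[].
have U : seg a b f <= seg a b (fun=> c + e).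
  by apply: le_Rintegral => // x /h /andP[].
move: L U; rewrite !seg_cst //; lra.
Qed.

Lemma eq_seg a b f g : (forall x, a <= x <= b -> f x = g x) -> seg a b f = seg a b g.
Proof.
by move=> fg; apply: eq_Rintegral => x; rewrite inE /= in_itv /= => /fg.
Qed.

End RealSeg.

Section RealEpsDelta.
Variable R : realType.
Implicit Types f : R -> R.

Lemma real_nbhsP (x : R) (A : set R) :
  nbhs x A <-> exists2 d : R, 0 < d & forall y, `|y - x| < d -> A y.
Proof.
split=> [/nbhs_ballP[e /= e0 H]|[d d0 H]].
  by exists e => // y yd; apply: H; rewrite /ball /= distrC.
by apply/nbhs_ballP; exists d => //= y; rewrite /ball /= distrC => /H.
Qed.

Lemma real_continuousP f x : {for x, continuous f} <->
  forall e, 0 < e -> exists2 d, 0 < d & forall y, `|y - x| < d -> `|f y - f x| < e.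
Proof.
split=> [H e e0|H A /real_nbhsP[d d0 dA]].
  have /H : nbhs (f x) [set y | `|y - f x| < e] by apply/real_nbhsP; exists e.
  by move=> /real_nbhsP.
have [d1 d10 d1H] := H _ d0.
by apply/real_nbhsP; exists d1 => // w /d1H /dA.
Qed.

Lemma real_deriveP f (x a : R) : is_derive x 1 f a <->
  forall e, 0 < e -> exists2 d, 0 < d & forall y, `|y - x| < d ->
    `|f y - f x - a * (y - x)| <= e * `|y - x|.
Proof.
split=> [[df <-] e e0|H].
  have K : h^-1 *: (f (h *: 1 + x) - f x) @[h --> 0^'] --> 'D_1 f x by [].
  have /K : nbhs ('D_1 f x) [set y | `|y - 'D_1 f x| < e] by apply/real_nbhsP; exists e.
  rewrite /nbhs /= => /real_nbhsP[d d0 dH]; exists d => // w wd.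
  have [->|wz] := eqVneq w x; first by rewrite !subrr mulr0 subr0 normr0 mulr0.
  have wz0 : w - x != 0 by rewrite subr_eq0.
  have := dH (w - x); rewrite subr0 => /(_ wd wz0) /=.
  rewrite /GRing.scale /= mulr1 subrK => {}dH.
  have -> : f w - f x - 'D_1 f x * (w - x) =
     (w - x) * ((w - x)^-1 * (f w - f x) - 'D_1 f x) by field.
  by rewrite normrM mulrC ler_pM2r ?normr_gt0 // ltW.
suff K : h^-1 *: (f (h *: 1 + x) - f x) @[h --> 0^'] --> a.
  by apply: DeriveDef; [apply/cvg_ex; exists a|apply/cvg_lim].
move=> A /real_nbhsP[e e0 eA]; have [d d0 dH] := H _ (divr_gt0 e0 (ltr0n _ 2)).
rewrite /nbhs /=; apply/real_nbhsP; exists d => // w wd /= w0; apply: eA.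
have := dH (w + x); rewrite addrK; rewrite subr0 in wd; move=> /(_ wd) {}dH.
rewrite /GRing.scale /= mulr1.
have -> : w^-1 * (f (w + x) - f x) - a = w^-1 * (f (w + x) - f x - a * w) by field.
rewrite normrM normfV; have nw : 0 < `|w| by rewrite normr_gt0.
by rewrite mulrC ltr_pdivrMr //; apply: le_lt_trans dH _; rewrite ltr_pM2r //; lra.
Qed.

End RealEpsDelta.

(** * Goursat's theorem for divergence-free fields on squares *)

Section Flux.
Variable R : realType.
Implicit Types P Q : R -> R -> R.

Definition first_order P x y p1 p2 := forall e, 0 < e -> exists2 d, 0 < d &
  forall x' y', `|x' - x| < d -> `|y' - y| < d ->
    `|P x' y' - P x y - p1 * (x' - x) - p2 * (y' - y)| <= e * (`|x' - x| + `|y' - y|).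

Lemma first_order_contx P x y p1 p2 : first_order P x y p1 p2 ->
  {for x, continuous (P^~ y)}.
Proof.
move=> H; apply/real_continuousP => e e0.
have [d d0 dH] := H 1 ltr01; have p0 := normr_ge0 p1.
exists (Num.min d (e / (`|p1| + 1))).
  by rewrite lt_min d0 divr_gt0 //; lra.
move=> x'; rewrite lt_min => /andP[h1]; rewrite ltr_pdivlMr; last by lra.
move=> h2; have := dH x' y h1; rewrite subrr normr0 => /(_ d0).
rewrite mulr0 subr0 addr0 mul1r => h3.
have -> : P x' y - P x y = (P x' y - P x y - p1 * (x' - x)) + p1 * (x' - x) by rewrite subrK.
apply: le_lt_trans (ler_normD _ _) _; rewrite normrM; lra.
Qed.

Lemma first_order_swap P x y p1 p2 : first_order P x y p1 p2 ->
  first_order (fun y x => P x y) y x p2 p1.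
Proof.
move=> H e e0; have [d d0 dH] := H e e0; exists d => // y' x' h1 h2.
have := dH _ _ h2 h1; rewrite [in leRHS]addrC /=.
by rewrite [P x' y' - _ - _ - _]addrAC.
Qed.

Lemma first_order_conty P x y p1 p2 : first_order P x y p1 p2 ->
  {for y, continuous (P x)}.
Proof. by move=> /first_order_swap /first_order_contx. Qed.

(** The outward flux of the field [(P, Q)] through the boundary of a square. With [P = Re g] and
    [Q = - Im g] it is the imaginary part of the contour integral of [g]. *)
Definition flux P Q a b s := seg b (b + s) (fun y => P (a + s) y - P a y) +
  seg a (a + s) (fun x => Q x (b + s) - Q x b).

Lemma flux_split P Q a b s : 0 < s ->
  (forall x, a <= x <= a + s -> continuous_on b (b + s) (P x)) ->
  (forall y, b <= y <= b + s -> continuous_on a (a + s) (Q^~ y)) ->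
  flux P Q a b s = flux P Q a b (s / 2) + flux P Q (a + s / 2) b (s / 2) +
   flux P Q a (b + s / 2) (s / 2) + flux P Q (a + s / 2) (b + s / 2) (s / 2).
Proof.
move=> s0 cP cQ.
have e1 (t : R) : t + s / 2 + s / 2 = t + s by rewrite -addrA -splitr.
have cPs x u v : a <= x <= a + s -> b <= u -> v <= b + s -> continuous_on u v (P x).
  by move=> /cP cx bu vb; apply: continuous_onW cx.
have cQs x u v : b <= x <= b + s -> a <= u -> v <= a + s -> continuous_on u v (Q^~ x).
  by move=> /cQ cx bu vb; apply: continuous_onW cx.
rewrite /flux !e1.
have ends c : [/\ c <= c <= c + s, c <= c + s <= c + s & c <= c + s / 2 <= c + s].
  by clear - s0; split; lra.
have [a1 a2 a3] := ends a; have [b1 b2 b3] := ends b.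
have /andP[a4 a5] := a3; have /andP[b4 b5] := b3.
rewrite !segB; try by (apply: cPs || apply: cQs).
rewrite (@seg_split R b (b + s / 2) (b + s) (P (a + s))) //; last exact: cP.
rewrite (@seg_split R b (b + s / 2) (b + s) (P a)) //; last exact: cP.
rewrite (@seg_split R a (a + s / 2) (a + s) (Q^~ (b + s))) //; last exact: cQ.
rewrite (@seg_split R a (a + s / 2) (a + s) (Q^~ b)) //; last exact: cQ.
clear; lra.
Qed.

Lemma ler_dist_itv (a s x y : R) : a <= x <= a + s -> a <= y <= a + s -> `|y - x| <= s.
Proof. by move=> h1 h2; rewrite ler_norml; lra. Qed.

(** The divergence vanishes at [(x, y)]: the linear parts of the two integrals, [p1 s^2] and
    [- p1 s^2], cancel and only remainders are left. *)
Lemma flux_first_order P Q x y p1 p2 q1 e :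
  first_order P x y p1 p2 -> first_order Q x y q1 (- p1) -> 0 < e ->
  exists2 d, 0 < d & forall a b s, 0 < s < d -> a <= x <= a + s -> b <= y <= b + s ->
  (forall x, a <= x <= a + s -> continuous_on b (b + s) (P x)) ->
  (forall y, b <= y <= b + s -> continuous_on a (a + s) (Q^~ y)) ->
    `|flux P Q a b s| <= e * s ^+ 2.
Proof.
(* Points of the square are at l1 distance at most [2 s] from [(x, y)]: each value has error
   [e s / 4], each difference between opposite sides [e s / 2], and the two integrals together
   [e s^2]. *)
move=> fP fQ e0; have e8 : 0 < e / 8 by lra.
have [d1 d10 H1] := fP _ e8; have [d2 d20 H2] := fQ _ e8.
exists (Num.min d1 d2); first by rewrite lt_min d10.
move=> a b s /andP[s0]; rewrite lt_min => /andP[sd1 sd2] hx hy cP cQ.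
have near_x t : a <= t <= a + s -> `|t - x| <= s by exact: ler_dist_itv.
have near_y t : b <= t <= b + s -> `|t - y| <= s by exact: ler_dist_itv.
have ends c : [/\ c <= c <= c + s, c <= c + s <= c + s & c <= c + s].
  by clear - s0; split; lra.
have [a1 a2 a3] := ends a; have [b1 b2 b3] := ends b.
have dist t u (v w : R) : `|t - v| <= s -> `|u - w| <= s ->
    e / 8 * (`|t - v| + `|u - w|) <= e / 4 * s.
  clear - e8 => ht hu; apply: (@le_trans _ _ (e / 8 * (s + s))); last by lra.
  by rewrite ler_wpM2l ?lerD // ltW.
have B1 t u : a <= t <= a + s -> b <= u <= b + s ->
    `|P t u - P x y - p1 * (t - x) - p2 * (u - y)| <= e / 4 * s.
  move=> /near_x ht /near_y hu; apply: le_trans (H1 _ _ _ _) _; last exact: dist.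
    exact: le_lt_trans ht _.
  exact: le_lt_trans hu _.
have B2 t u : a <= t <= a + s -> b <= u <= b + s ->
    `|Q t u - Q x y - q1 * (t - x) - (- p1) * (u - y)| <= e / 4 * s.
  move=> /near_x ht /near_y hu; apply: le_trans (H2 _ _ _ _) _; last exact: dist.
    exact: le_lt_trans ht _.
  exact: le_lt_trans hu _.
have K1 : `|seg b (b + s) (fun y => P (a + s) y - P a y) - p1 * s * (b + s - b)|
    <= e / 2 * s * (b + s - b).
  apply: seg_bound => // [|u hu]; first by apply: continuous_onB; exact: cP.
  have := B1 _ _ a1 hu; have := B1 _ _ a2 hu.
  clear; rewrite !ler_norml => /andP[h1 h2] /andP[h3 h4].
  by apply/andP; split; lra.
have K2 : `|seg a (a + s) (fun x => Q x (b + s) - Q x b) - (- p1) * s * (a + s - a)|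
    <= e / 2 * s * (a + s - a).
  apply: seg_bound => // [|u hu]; first by apply: continuous_onB; exact: cQ.
  have := B2 _ _ hu b1; have := B2 _ _ hu b2.
  clear; rewrite !ler_norml => /andP[h1 h2] /andP[h3 h4].
  by apply/andP; split; lra.
move: K1 K2; rewrite /flux.
set S1 := seg _ _ _; set S2 := seg _ _ _.
have -> : b + s - b = s by ring.
have -> : a + s - a = s by ring.
clear; rewrite !ler_norml => /andP[h1 h2] /andP[h3 h4]; apply/andP; split; lra.
Qed.

(* Goursat's argument: the flux of a divergence-free field is additive under
   subdivision and of order [o(s^2)] near every point. *)
Lemma flux_eq0 P Q a b s : 0 < s ->
  (forall x y, a <= x <= a + s -> b <= y <= b + s -> exists p1 p2 q1,
     first_order P x y p1 p2 /\ first_order Q x y q1 (- p1)) ->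
  flux P Q a b s = 0.
Proof.
move=> s0 H.
have cP x u v : a <= x <= a + s -> b <= u -> v <= b + s -> continuous_on u v (P x).
  move=> hx bu vb y hy; have hy' : b <= y <= b + s by lra.
  have [p1 [p2 [q1 [fP _]]]] := H x y hx hy'.
  exact: first_order_conty fP.
have cQ y u v : b <= y <= b + s -> a <= u -> v <= a + s -> continuous_on u v (Q^~ y).
  move=> hy bu vb x hx; have hx' : a <= x <= a + s by lra.
  have [p1 [p2 [q1 [_ fQ]]]] := H x y hx' hy.
  exact: first_order_contx fQ.
have main e : 0 < e -> `|flux P Q a b s| <= e * s ^+ 2.
  move=> e0; apply: (@square_bisection R a b s (fun a b s => `|flux P Q a b s| <= e * s ^+ 2)) => //.
    move=> a' b' t t0 ha1 ha2 hb1 hb2 h1 h2 h3 h4.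
    rewrite flux_split //; last 2 first.
    - by move=> x hx; apply: cP; lra.
    - by move=> x hx; apply: cQ; lra.
    have -> : e * t ^+ 2 = e * (t / 2) ^+ 2 + e * (t / 2) ^+ 2 + e * (t / 2) ^+ 2 +
       e * (t / 2) ^+ 2 by field.
    by do 3 (apply: le_trans (ler_normD _ _) _; apply: lerD => //).
  move=> x y hx hy; have [p1 [p2 [q1 [fP fQ]]]] := H x y hx hy.
  have [d d0 dH] := flux_first_order fP fQ e0.
  exists d => // a' b' t ht ha1 ha2 hb1 hb2 hx' hy'; apply: dH => //.
  - by move=> x' hx''; apply: cP; lra.
  - by move=> x' hx''; apply: cQ; lra.
apply/eqP; rewrite -normr_le0; apply/ler_addgt0Pr => e e0; rewrite add0r.
have s2 : 0 < s ^+ 2 by rewrite exprn_gt0.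
by apply: le_trans (main (e / s ^+ 2) (divr_gt0 e0 s2)) _; rewrite divfK // gt_eqF.
Qed.

End Flux.

(** * Circle means and the Cauchy estimate *)

Section CircleMean.
Variable R : realType.
Implicit Types (f : R[i] -> R[i]) (z w : R[i]).

Definition expi (t : R) : R[i] := cos t +i* sin t.

Definition expc z : R[i] := (expR (Re z))%:C * expi (Im z).

Lemma normc_expi t : normc (expi t) = 1.
Proof. by rewrite /= cos2Dsin2 sqrtr1. Qed.

Lemma normc_expc z : normc (expc z) = expR (Re z).
Proof. by rewrite normcM normc_expi mulr1 normcR gtr0_norm // expR_gt0. Qed.

Lemma expcD z w : expc (z + w) = expc z * expc w.
Proof.
apply: complexP; rewrite !ReImE /= expRD ?cosD ?sinD; ring.
Qed.

Lemma expc_deriv0 : cderiv expc 0 1.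
Proof.
move=> e e0; have e4 : 0 < e / 8 by lra.
have [d1 d10 H1] := (real_deriveP _ _ _).1 (is_derive_expR (0 : R)) _ e4.
have [d2 d20 H2] := (real_deriveP _ _ _).1 (is_derive_cos (0 : R)) _ e4.
have [d3 d30 H3] := (real_deriveP _ _ _).1 (is_derive_sin (0 : R)) _ e4.
have cexp : {for (0 : R), continuous (@expR R)} by exact: continuous_expR.
have ee : 0 < Num.min 1 (e / 8) by rewrite lt_min e4 ltr01.
have [d4 d40 H4] := (real_continuousP _ _).1 cexp _ ee.
exists (Num.min (Num.min d1 d2) (Num.min d3 d4)); first by rewrite !lt_min d10 d20 d30 d40.
move=> w; rewrite !lt_min !subr0 => /andP[/andP[w1 w2] /andP[w3 w4]].
have := Re_le_normc w; have := Im_le_normc w; have n0 := normc_ge0 w.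
set a := Re w; set b := Im w => hb ha.
have := H1 a; rewrite subr0 expR0 mul1r => /(_ (le_lt_trans ha w1)) {}H1.
have := H2 b; rewrite subr0 cos0 sin0 oppr0 mul0r subr0 => /(_ (le_lt_trans hb w2)) {}H2.
have := H3 b; rewrite subr0 cos0 sin0 mul1r subr0 => /(_ (le_lt_trans hb w3)) {}H3.
have := H4 a; rewrite subr0 expR0 => /(_ (le_lt_trans ha w4)); rewrite lt_min => /andP[H41 H42].
apply: le_trans (normc_le_ReIm _) _.
have -> : Re (expc w - expc 0 - 1 * w) = (expR a - 1 - a) + expR a * (cos b - 1).
  by rewrite /expc !ReImE /= expR0 cos0 sin0 /a /b; ring.
have -> : Im (expc w - expc 0 - 1 * w) = expR a * (sin b - b) + (expR a - 1) * b.
  by rewrite /expc !ReImE /= expR0 cos0 sin0 /a /b; ring.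
have E0 := expR_gt0 a; have E2 : expR a <= 2 by move: H41; rewrite ltr_norml => /andP[]; lra.
have k1 : `|(expR a - 1 - a) + expR a * (cos b - 1)| <= e / 8 * `|a| + 2 * (e / 8 * `|b|).
  apply: le_trans (ler_normD _ _) _; rewrite normrM gtr0_norm //; apply: lerD => //.
  by apply: ler_pM => //; exact: ltW.
have k2 : `|expR a * (sin b - b) + (expR a - 1) * b| <= 2 * (e / 8 * `|b|) + e / 8 * `|b|.
  apply: le_trans (ler_normD _ _) _; rewrite !normrM (gtr0_norm E0); apply: lerD.
    by apply: ler_pM => //; exact: ltW.
  by apply: ler_wpM2r => //; exact: ltW.
nra.
Qed.

Lemma cderiv_expc z : cderiv expc z (expc z).
Proof.
move=> e e0; have nz : 0 < normc (expc z) by rewrite normc_expc expR_gt0.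
have [d d0 H] := expc_deriv0 (divr_gt0 e0 nz).
exists d => // w wd.
have := H (w - z); rewrite subr0 => /(_ wd) {}H.
have E0 : expc 0 = 1 by apply: complexP; rewrite !ReImE /= expR0 cos0 sin0; ring.
have -> : expc w - expc z - expc z * (w - z) = expc z * (expc (w - z) - expc 0 - 1 * (w - z)).
  rewrite E0 !mulrBr -expcD mulr1 mul1r [z + _]addrC subrK; ring.
rewrite normcM; apply: le_trans (ler_wpM2l (ltW nz) H) _.
by rewrite mulrA [_ * (e / _)]mulrC divfK // gt_eqF.
Qed.

(** The Cauchy-Riemann equations in the shape that [flux_eq0] asks for: the [x]-derivative [Re c] of
    the first function and the [y]-derivative [- Re c] of the second add up to zero. *)
Lemma first_order_cderiv (g : R[i] -> R[i]) (x y : R) (c : R[i]) : cderiv g (x +i* y) c ->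
  first_order (fun x y => Re (g (x +i* y))) x y (Re c) (- Im c) /\
  first_order (fun x y => - Im (g (x +i* y))) x y (- Im c) (- Re c).
Proof.
move=> H.
have K e : 0 < e -> exists2 d, 0 < d & forall x' y', `|x' - x| < d -> `|y' - y| < d ->
    normc (g (x' +i* y') - g (x +i* y) - c * ((x' - x) +i* (y' - y))) <= e * (`|x' - x| + `|y' - y|).
  move=> e0; have [d d0 dH] := H e e0; exists (d / 2); first by rewrite divr_gt0.
  move=> x' y' hx hy; have k := normc_le_ReIm ((x' - x) +i* (y' - y)).
  have kd : normc ((x' +i* y') - (x +i* y)) < d by apply: le_lt_trans k _ => /=; lra.
  by apply: le_trans (dH _ kd) _; rewrite ler_pM2l.
split=> e /K[d d0 dH]; exists d => // x' y' hx hy; apply: le_trans (dH _ _ hx hy).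
  apply: le_trans (Re_le_normc _); rewrite !ReImE /= le_eqVlt; apply/orP; left.
  by apply/eqP; congr `|_|; ring.
apply: le_trans (Im_le_normc _); rewrite !ReImE /= -[leRHS]normrN le_eqVlt.
by apply/orP; left; apply/eqP; congr `|_|; ring.
Qed.

Definition circle_integral (f : R[i] -> R[i]) (r : R) := seg 0 (pi *+ 2) (fun t => Re (f (r%:C * expi t))).

Lemma expi_2pi : expi (pi *+ 2) = expi 0.
Proof. by rewrite /expi cos2pi sin2pi cos0 sin0. Qed.

Lemma expcE (x y : R) : expc (x +i* y) = (expR x)%:C * expi y.
Proof. by []. Qed.

Lemma twopi_gt0 : 0 < pi *+ 2 :> R.
Proof. by rewrite mulrn_wgt0 // pi_gt0. Qed.

(** In the coordinate [log w] the annulus becomes a rectangle whose vertical sides are the two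
    circles, and the horizontal sides cancel by periodicity. As the flux is taken over squares, the
    logarithmic width is [2 pi] too; hence the ratio [e^(2 pi)] of the radii. *)
Lemma circle_integral_shift f (x : R) :
  (forall w, w != 0 -> normc w <= expR (x + pi *+ 2) -> exists a, cderiv f w a) ->
  circle_integral f (expR (x + pi *+ 2)) = circle_integral f (expR x).
Proof.
move=> H; have p0 := twopi_gt0.
pose g z := f (expc z).
have fl : flux (fun x y => Re (g (x +i* y))) (fun x y => - Im (g (x +i* y))) x 0 (pi *+ 2) = 0.
  apply: flux_eq0 => // t y ht hy.
  have [||a ha] := H (expc (t +i* y)).
  - by rewrite -normc_gt0 normc_expc expR_gt0.
  - by rewrite normc_expc ler_expR /=; lra.
  have hg := cderiv_comp (cderiv_expc _) ha.
  have [h1 h2] := first_order_cderiv hg.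
  by do 3 eexists; split; [exact: h1|exact: h2].
move: fl; rewrite /flux add0r.
rewrite [X in _ + X](_ : _ = 0); last first.
  transitivity (seg x (x + pi *+ 2) (fun=> 0 : R)); last by rewrite seg_cst ?mul0r //; lra.
  by apply: eq_seg => t _; rewrite /g !expcE expi_2pi subrr.
rewrite addr0 segB; last 2 first.
- move=> y hy; have [||a ha] := H (expc ((x + pi *+ 2) +i* y)).
  + by rewrite -normc_gt0 normc_expc expR_gt0.
  + by rewrite normc_expc.
  have [h1 _] := first_order_cderiv (cderiv_comp (cderiv_expc _) ha).
  exact: first_order_conty h1.
- move=> y hy; have [||a ha] := H (expc (x +i* y)).
  + by rewrite -normc_gt0 normc_expc expR_gt0.
  + by rewrite normc_expc ler_expR /=; lra.
  have [h1 _] := first_order_cderiv (cderiv_comp (cderiv_expc _) ha).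
  exact: first_order_conty h1.
by move=> /eqP; rewrite subr_eq0 => /eqP.
Qed.

Lemma normc_circle (r t : R) : 0 <= r -> normc (r%:C * expi t) = r.
Proof. by move=> r0; rewrite normcM normc_expi mulr1 normcR ger0_norm. Qed.

Lemma expi_cont (r : R) f t : 0 < r -> {for r%:C * expi t, continuous f} ->
  {for t, continuous (fun t => Re (f (r%:C * expi t)))}.
Proof.
move=> r0 /continuous_normcP H; apply/real_continuousP => e e0.
have [d d0 dH] := H e e0; pose d' := d / (2 * r).
have d'0 : 0 < d' by rewrite divr_gt0 // mulr_gt0.
have [d1 d10 H1] := (real_continuousP _ _).1 (@continuous_cos R t) _ d'0.
have [d2 d20 H2] := (real_continuousP _ _).1 (@continuous_sin R t) _ d'0.
exists (Num.min d1 d2); first by rewrite lt_min d10.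
move=> s; rewrite lt_min => /andP[/H1 h1 /H2 h2].
have /dH : normc (r%:C * expi s - r%:C * expi t) < d.
  rewrite -mulrBr normcM normcR gtr0_norm // mulrC -ltr_pdivlMr //.
  apply: le_lt_trans (normc_le_ReIm _) _; rewrite /= (_ : d / r = d' + d') ?ltrD //.
  by rewrite /d'; field; rewrite gt_eqF.
by apply: le_lt_trans; rewrite -Re_opp -Re_add; exact: Re_le_normc.
Qed.

Lemma circle_mean f (r : R) : 0 < r -> {for 0, continuous f} ->
  (forall w, w != 0 -> normc w <= r -> exists a, cderiv f w a) ->
  circle_integral f r = pi *+ 2 * Re (f 0).
Proof.
move=> r0 /continuous_normcP c0 H; have p0 := twopi_gt0.
have lr : expR (ln r) = r by rewrite lnK.
have it n : circle_integral f r = circle_integral f (expR (ln r - n%:R * (pi *+ 2))).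
  elim: n => [|n ->]; first by rewrite mul0r subr0 lr.
  rewrite -(@circle_integral_shift f (ln r - n.+1%:R * (pi *+ 2))).
    by congr (circle_integral _ (expR _)); rewrite -[n.+1%:R]natr1; ring.
  move=> w w0 hw; apply: H => //; apply: le_trans hw _.
  rewrite -[leRHS]lr ler_expR -[n.+1%:R]natr1.
  have : 0 <= n%:R * (pi *+ 2) :> R by rewrite mulr_ge0 // ltW.
  nra.
apply/eqP; rewrite -subr_eq0 -normr_le0; apply/ler_addgt0Pr => e e0; rewrite add0r.
have [d d0 dH] := c0 _ (divr_gt0 e0 p0).
pose n := Num.bound ((ln r - ln d) / (pi *+ 2)).
have hn : ln r - n%:R * (pi *+ 2) < ln d.
  have : (ln r - ln d) / (pi *+ 2) < n%:R.
    have [h|h] := leP 0 ((ln r - ln d) / (pi *+ 2)); first exact: archi_boundP.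
    exact: lt_le_trans h _.
  by rewrite ltr_pdivrMr //; lra.
rewrite (it n); set t := expR _.
have t0 : 0 < t by exact: expR_gt0.
have td : t < d by rewrite /t -[ltRHS]lnK // ltr_expR.
have tr : t <= r.
  rewrite /t -[leRHS]lr ler_expR.
  have : 0 <= n%:R * (pi *+ 2) :> R by rewrite mulr_ge0 // ltW.
  lra.
have := @seg_bound R 0 (pi *+ 2) (fun s => Re (f (t%:C * expi s))) (Re (f 0)) (e / (pi *+ 2)) (ltW p0).
rewrite !subr0 divfK ?gt_eqF // [X in circle_integral _ _ - X]mulrC; apply.
  move=> s _; apply: expi_cont => //.
  have [||a ha] := H (t%:C * expi s).
  - by rewrite -normc_gt0 normc_circle // ltW.
  - by rewrite normc_circle // ltW.
  exact: cderiv_cont ha.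
move=> s _; rewrite -Re_opp -Re_add; apply: le_trans (Re_le_normc _) (ltW _).
by apply: dH; rewrite subr0 normc_circle // ltW.
Qed.

(* Mean value property of the difference quotient [f(w) / w] on a small circle. *)
Lemma cauchy_bound f (a : R[i]) (M r : R) : 0 < r -> f 0 = 0 -> cderiv f 0 a ->
  (forall w, normc w <= r -> exists a, cderiv f w a) ->
  (forall w, normc w <= r -> normc (f w) <= M) -> normc a <= 2 * M / r.
Proof.
move=> r0 f0 fa fd fM.
have M0 : 0 <= M by apply: le_trans (fM 0 _); rewrite ?normc_ge0 ?normc0 ?ltW.
have [->|a0] := eqVneq a 0.
  by rewrite normc0; apply: divr_ge0; [apply: mulr_ge0|exact: ltW].
pose g w := if w == 0 then a else f w / w.
(* [circle_integral] sees real parts only; [c = 1] and [c = - i] recover both parts of [a], at the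
   price of the factor 2. *)
have key (c : R[i]) : normc c = 1 -> `|Re (c * a)| <= M / r.
  move=> c1; have p0 := twopi_gt0.
  have mv : circle_integral (fun w => c * g w) r = pi *+ 2 * Re (c * a).
    have -> : c * a = (fun w => c * g w) 0 by rewrite /g eqxx.
    apply: circle_mean => // [|w w0 wr].
      apply/continuous_normcP => e e0; have [d d0 dH] := fa _ (divr_gt0 e0 (ltr0n R 2)).
      exists d => // w wd; rewrite -mulrBr normcM c1 mul1r /g eqxx.
      have [_|w0] := eqVneq w 0; first by rewrite subrr normc0.
      have n0 : 0 < normc w by rewrite normc_gt0.
      have := dH w wd; rewrite subr0 f0 subr0 => h.
      have -> : f w / w - a = (f w - a * w) / w by rewrite mulrBl mulfK.
      by rewrite normcM normcV ltr_pdivrMr //; apply: le_lt_trans h _; rewrite ltr_pM2r //; lra.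
    have [b hb] := fd w wr.
    have nw : 0 < normc w by rewrite normc_gt0.
    exists (c * (f w * (- w ^- 2) + w^-1 * b) + (f w * w^-1) * 0).
    apply: (@cderiv_near R (fun w => c * (f w / w)) _ w _ (normc w) nw) => [v vw|].
      rewrite /g; case: eqP vw => // ->; by rewrite sub0r normcN ltxx.
    apply: (cderivM (cderiv_cst _ _)); apply: (cderivM hb); exact: cderiv_inv.
  suff : `|circle_integral (fun w => c * g w) r - 0 * (pi *+ 2 - 0)| <= M / r * (pi *+ 2 - 0).
    by rewrite mul0r !subr0 mv normrM gtr0_norm // mulrC ler_pM2r.
  apply: seg_bound; first exact: ltW.
    move=> s _; apply: (@expi_cont r (fun w => c * g w)) => //.
    set w := _ * _; have wr : normc w = r by rewrite /w normc_circle // ltW.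
    have nw : 0 < normc w by rewrite wr.
    have [|b hb] := fd w; first by rewrite wr.
    apply: (@cderiv_cont _ _ _ (c * (f w * (- w ^- 2) + w^-1 * b) + (f w * w^-1) * 0)).
    apply: (@cderiv_near R (fun w => c * (f w / w)) _ w _ (normc w) nw) => [v vw|].
      rewrite /g; case: eqP vw => // ->; by rewrite sub0r normcN ltxx.
    apply: (cderivM (cderiv_cst _ _)); apply: (cderivM hb); apply: cderiv_inv.
    by rewrite -normc_gt0.
  move=> s _; rewrite subr0; apply: le_trans (Re_le_normc _) _; rewrite normcM c1 mul1r.
  set w := _ * _; have wr : normc w = r by rewrite /w normc_circle // ltW.
  have w0 : w != 0 by rewrite -normc_gt0 wr.
  by rewrite /g (negbTE w0) normcM normcV wr ler_pM2r ?invr_gt0 //; apply: fM; rewrite wr.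
have k1 := key 1 (normc1 _); rewrite mul1r in k1.
have k2 : `|Re ((-'i%C) * a)| <= M / r.
  by apply: key; rewrite normcN /= expr0n expr1n add0r sqrtr1.
apply: le_trans (normc_le_ReIm a) _.
have -> : 2 * M / r = M / r + M / r by lra.
by apply: lerD => //; move: k2; rewrite !ReImE /= !(mul0r, mul1r, oppr0, sub0r, mulN1r, opprK).
Qed.

End CircleMean.

(** * Planar Lebesgue measure and conformal maps *)

Section AffineMeasure.
Variable R : realType.
Notation mu := (@lebesgue_measure R).
Notation mu2 := (mu \x mu)%E.
Local Notation RR := (measurableTypeR R).

Lemma measurable_affine (m t : R) : measurable_fun (setT : set RR) (fun x : RR => m * x + t : RR).
Proof.
by apply: measurable_funD => //; apply: measurable_funM.
Qed.

(** The push-forward of Lebesgue measure under [x |-> m x + t], multiplied by [m], gives half-open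
    intervals their length, so uniqueness identifies it with Lebesgue measure. *)
Lemma lebesgue_measure_affine_gt0 (m t : R) (E : set RR) : 0 < m -> measurable E ->
  mu [set x | E (m * x + t)] = ((m^-1)%:E * mu E)%E.
Proof.
move=> m0 mE.
pose f : RR -> RR := fun x => m * x + t.
pose m' : {nonneg R} := NngNum (ltW m0).
pose nu : {measure set RR -> \bar R} := mscale m' (pushforward mu f).
suff : mu E = nu (measurable_affine m t) E.
  rewrite /nu /= /mscale /= => ->.
  by rewrite muleA -EFinM mulVf ?gt_eqF // mul1e.
apply: lebesgue_measure_unique => // _ [[a b] _ <-] /=.
pose I : set RR := `] ((a - t) / m), ((b - t) / m) ]%classic.
transitivity (m%:E * mu I)%E; rewrite /I; last first.
  rewrite /nu /mscale /pushforward /=; congr (_ * mu _)%E.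
  apply/seteqP; split => x /=; rewrite !in_itv /= /f ltr_pdivrMr // ler_pdivlMr // [x * m]mulrC; lra.
rewrite !lebesgue_measure_itv /= !lte_fin ltr_pM2r ?invr_gt0 // ltrD2r.
case: ifP => _; last by rewrite mule0.
by rewrite -!EFinB -EFinM; congr (_%:E); field; rewrite gt_eqF.
Qed.

Lemma lebesgue_measure_affine (m t : R) (E : set RR) : m != 0 -> measurable E ->
  mu [set x | E (m * x + t)] = (`|m|^-1%:E * mu E)%E.
Proof.
move=> m0 mE; case: (ltrgtP m 0) m0 => // mlt _; last first.
  by rewrite lebesgue_measure_affine_gt0 // gtr0_norm.
rewrite ltr0_norm // -(@lebesgue_measure_affine_gt0 _ t) ?oppr_gt0 //.
have mE' : measurable [set x : RR | E (m * x + t)].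
  by rewrite -[X in measurable X]setTI; exact: (measurable_affine m t measurableT mE).
rewrite -(lebesgue_measureN mE') /pushforward /=; congr mu.
by apply/seteqP; split => x /=; rewrite mulrN mulNr.
Qed.

(** [mu2] integrates the measures of x-sections, whereas a shear of the first coordinate acts inside
    y-sections; this equality gives access to the latter. *)
Lemma product_lebesgueE (E : set (RR * RR)) : measurable E -> mu2 E = (mu \x^ mu)%E E.
Proof.
move=> mE; apply: (@product_measure_unique _ _ _ _ _ mu mu (mu \x^ mu)%E) => // A B mA mB.
exact: product_measure2E.
Qed.

Lemma measurable_shear1 (m a t : R) (E : set (RR * RR)) : measurable E ->
  measurable [set x : RR * RR | E (m * x.1 + a * x.2 + t, x.2)].
Proof.
move=> mE; rewrite -[X in measurable X]setTI.
have mf : measurable_fun setT (fun x : RR * RR => (m * x.1 + a * x.2 + t : RR, x.2)).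
  apply: measurable_fun_pair; last exact: measurable_snd.
  apply: measurable_funD => //; apply: measurable_funD; apply: measurable_funM => //.
exact: (mf measurableT _ mE).
Qed.

Lemma measurable_shear2 (m a t : R) (E : set (RR * RR)) : measurable E ->
  measurable [set x : RR * RR | E (x.1, m * x.2 + a * x.1 + t)].
Proof.
move=> mE; rewrite -[X in measurable X]setTI.
have mf : measurable_fun setT (fun x : RR * RR => (x.1, m * x.2 + a * x.1 + t : RR)).
  apply: measurable_fun_pair; first exact: measurable_fst.
  apply: measurable_funD => //; apply: measurable_funD; apply: measurable_funM => //.
exact: (mf measurableT _ mE).
Qed.

Lemma lebesgue_measure_shear1 (m a t : R) (E : set (RR * RR)) : m != 0 -> measurable E ->
  mu2 [set x | E (m * x.1 + a * x.2 + t, x.2)] = (`|m|^-1%:E * mu2 E)%E.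
Proof.
move=> m0 mE; rewrite !product_lebesgueE //; last exact: measurable_shear1.
rewrite /product_measure2 -ge0_integralZl //=; last exact: measurable_fun_ysection.
apply: eq_integral => y _; rewrite /= -(@lebesgue_measure_affine m (a * y + t)) //; last first.
  exact: measurable_ysection.
congr mu; apply/seteqP; split => x /=; rewrite /ysection /= !inE /=; first by rewrite addrA.
  by rewrite addrA.
Qed.

Lemma lebesgue_measure_shear2 (m a t : R) (E : set (RR * RR)) : m != 0 -> measurable E ->
  mu2 [set x | E (x.1, m * x.2 + a * x.1 + t)] = (`|m|^-1%:E * mu2 E)%E.
Proof.
move=> m0 mE; rewrite /product_measure1 -ge0_integralZl //=; last exact: measurable_fun_xsection.
apply: eq_integral => y _; rewrite /= -(@lebesgue_measure_affine m (a * y + t)) //; last first.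
  exact: measurable_xsection.
congr mu; apply/seteqP; split => x /=; rewrite /xsection /= !inE /=; first by rewrite addrA.
  by rewrite addrA.
Qed.

(** Half-open, so that the four quarters partition the square. *)
Definition sq (a b s : R) : set (RR * RR) := `[a, (a + s)[ `*` `[b, (b + s)[.

Lemma measurable_sq a b s : measurable (sq a b s).
Proof. by apply: measurableX; exact: measurable_itv. Qed.

Lemma mu2_sq a b s : 0 < s -> mu2 (sq a b s) = (s ^+ 2)%:E.
Proof.
move=> s0; rewrite /sq product_measure1E //=.
rewrite !lebesgue_measure_itv /= !lte_fin !ltrDl s0 -!EFinB -EFinM expr2.
by congr (_ * _)%:E; ring.
Qed.

(* The linear map with matrix [[p, -q], [q, p]] is a composite of two shears. *)
Lemma mu2_conformal_preimage (p q t1 t2 a b s : R) : p ^+ 2 + q ^+ 2 != 0 -> 0 < s ->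
  mu2 [set x | sq a b s (p * x.1 - q * x.2 + t1, q * x.1 + p * x.2 + t2)] =
   (s ^+ 2 / (p ^+ 2 + q ^+ 2))%:E.
Proof.
move=> pq s0; have mE := measurable_sq a b s.
(* A scaled quarter turn exchanges the coordinates, so the preimage is a product of intervals; the
   shears used otherwise divide by [p]. *)
have [p0|p0] := eqVneq p 0.
  have q0 : q != 0 by apply: contraNneq pq => ->; rewrite p0 expr0n addr0.
  pose B1 : set RR := [set x | `[a, (a + s)[%classic (- q * x + t1)].
  pose B2 : set RR := [set x | `[b, (b + s)[%classic (q * x + t2)].
  have mB (m t u : R) : measurable [set x : RR | `[u, (u + s)[%classic (m * x + t)].
    rewrite -[X in measurable X]setTI; apply: (measurable_affine m t measurableT).
    exact: measurable_itv.
  transitivity (mu2 (B2 `*` B1)).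
    congr mu2; apply/seteqP; split => x; rewrite /sq /B1 /B2 /= p0 !mul0r sub0r addr0 mulNr;
      by case.
  rewrite product_measure1E; try exact: mB.
  rewrite /= /B1 /B2 !lebesgue_measure_affine ?oppr_eq0 //.
  rewrite !lebesgue_measure_itv /= !lte_fin !ltrDl s0 -!EFinB -!EFinM normrN p0 expr0n add0r.
  rewrite -[q ^+ 2]real_normK ?num_real //.
  by congr (_ %:E); field; rewrite normr_eq0.
(* The first shear has determinant [p], so the second must have [(p^2 + q^2) / p]; its coefficient
   [q / p] acts on the already transformed first coordinate. *)
pose d := (p ^+ 2 + q ^+ 2) / p.
have d0 : d != 0 by rewrite mulf_neq0 // invr_eq0.
pose E1 : set (RR * RR) := [set z | sq a b s (z.1, d * z.2 + q / p * z.1 + (t2 - q / p * t1))].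
have mE1 : measurable E1 by exact: measurable_shear2.
transitivity (mu2 [set x | E1 (p * x.1 + - q * x.2 + t1, x.2)]).
  congr mu2; apply/seteqP; split => x; rewrite /E1 /=;
  have -> : d * x.2 + q / p * (p * x.1 + - q * x.2 + t1) + (t2 - q / p * t1) =
     q * x.1 + p * x.2 + t2 by rewrite /d; field.
  by rewrite mulNr.
  by rewrite mulNr.
rewrite lebesgue_measure_shear1 // lebesgue_measure_shear2 // mu2_sq // -!EFinM; congr (_%:E).
have pd : p * d = p ^+ 2 + q ^+ 2 by rewrite /d; field.
rewrite mulrA -invfM -normrM pd ger0_norm ?addr_ge0 ?sqr_ge0 //.
by rewrite mulrC.
Qed.

End AffineMeasure.

(** * Exhaustion of open sets by dyadic squares *)

Section Exhaustion.
Variable R : realType.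
Notation mu := (@lebesgue_measure R).
Notation mu2 := (mu \x mu)%E.
Local Notation RR := (measurableTypeR R).
Implicit Type W : set R[i].

Definition closed_sq (a b s : R) : set R[i] :=
  [set z | a <= Re z <= a + s /\ b <= Im z <= b + s].

(** The closed square is tested and the half-open one collected: the first lets local hypotheses on
    [W] be used at every limit point of the square, the second makes the collected squares
    disjoint. *)
Fixpoint dyadic W n (a b s : R) : set (RR * RR) :=
  if `[< closed_sq a b s `<=` W >] then sq a b s else
  if n is n'.+1 then
    dyadic W n' a b (s / 2) `|` (dyadic W n' (a + s / 2) b (s / 2) `|`
      (dyadic W n' a (b + s / 2) (s / 2) `|` dyadic W n' (a + s / 2) (b + s / 2) (s / 2)))
  else set0.

Lemma sqP a b s (x : RR * RR) : sq a b s x <-> a <= x.1 < a + s /\ b <= x.2 < b + s.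
Proof. by rewrite /sq /= !in_itv. Qed.

Lemma dyadic_sub_sq W n a b s : 0 < s -> dyadic W n a b s `<=` sq a b s.
Proof.
elim: n a b s => [|n IH] a b s s0 /=; case: ifP => _ x //.
have s2 : 0 < s / 2 by lra.
have k a' b' : dyadic W n a' b' (s / 2) x -> sq a' b' (s / 2) x := fun h => IH _ _ _ s2 x h.
by case=> [/k/sqP[? ?]|[/k/sqP[? ?]|[/k/sqP[? ?]|/k/sqP[? ?]]]]; apply/sqP; split; lra.
Qed.

Lemma dyadic_sub W n a b s : 0 < s -> dyadic W n a b s `<=` real_plane W.
Proof.
have base a' b' s' : closed_sq a' b' s' `<=` W -> sq a' b' s' `<=` real_plane W.
  move=> H x /sqP[/andP[h1 h2] /andP[h3 h4]]; apply: H; rewrite /closed_sq /=.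
  by rewrite h1 h3 !ltW.
elim: n a b s => [|n IH] a b s s0 /=; case: ifP => [/asboolP/base //|_] x //.
have s2 : 0 < s / 2 by lra.
have k a' b' : dyadic W n a' b' (s / 2) x -> real_plane W x := fun h => IH _ _ _ s2 x h.
by case=> [/k //|[/k //|[/k //|/k //]]].
Qed.

Lemma dyadicS W n a b s : dyadic W n.+1 a b s = if `[< closed_sq a b s `<=` W >] then sq a b s else
    dyadic W n a b (s / 2) `|` (dyadic W n (a + s / 2) b (s / 2) `|`
      (dyadic W n a (b + s / 2) (s / 2) `|` dyadic W n (a + s / 2) (b + s / 2) (s / 2))).
Proof. by []. Qed.

Lemma dyadic_mono W n a b s : 0 < s -> dyadic W n a b s `<=` dyadic W n.+1 a b s.
Proof.
elim: n a b s => [|n IH] a b s s0.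
  by rewrite /=; case: ifP => // _ x.
have s2 : 0 < s / 2 by lra.
rewrite (dyadicS W n) (dyadicS W n.+1).
case: ifP => _; first exact: subset_refl.
do 3 (apply: setUSS; first exact: IH); exact: IH.
Qed.

Lemma measurable_dyadic W n a b s : measurable (dyadic W n a b s).
Proof.
elim: n a b s => [|n IH] a b s /=; case: ifP => _ //; try exact: measurable_sq.
by do 3 (apply: measurableU => //).
Qed.

Lemma sq_quarters a b s (x : RR * RR) : 0 < s -> sq a b s x ->
  [\/ sq a b (s / 2) x, sq (a + s / 2) b (s / 2) x,
      sq a (b + s / 2) (s / 2) x | sq (a + s / 2) (b + s / 2) (s / 2) x].
Proof.
move=> s0 /sqP[h1 h2].
have [p1|p1] := ltP x.1 (a + s / 2); have [p2|p2] := ltP x.2 (b + s / 2).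
- by apply: Or41; apply/sqP; split; lra.
- by apply: Or43; apply/sqP; split; lra.
- by apply: Or42; apply/sqP; split; lra.
- by apply: Or44; apply/sqP; split; lra.
Qed.

(** Once its diameter is below [d], a square containing the point lies in the [d]-neighbourhood and
    hence in [W]; the recursion stops on it at depth [n] at the latest. *)
Lemma dyadic_cover W n a b s d (x : RR * RR) : 0 < s -> sq a b s x ->
  (forall w, normc (w - (x.1 +i* x.2)) < d -> W w) -> 2 * s / 2 ^+ n < d ->
  dyadic W n a b s x.
Proof.
move=> + + H; have base a' b' s' : 0 < s' -> sq a' b' s' x -> 2 * s' < d -> closed_sq a' b' s' `<=` W.
  move=> s'0 /sqP[h1 h2] sd z [z1 z2]; apply: H; apply: le_lt_trans (normc_le_ReIm _) _.
  rewrite !ReImE /=; apply: le_lt_trans sd.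
  have k1 : `|Re z - x.1| <= s' by rewrite ler_norml; lra.
  have k2 : `|Im z - x.2| <= s' by rewrite ler_norml; lra.
  lra.
elim: n a b s => [|n IH] a b s s0 xs sd /=.
  case: ifP => // /asboolP []; apply: base xs _ => //.
  by move: sd; rewrite expr0 divr1.
case: ifP => // _; have s2 : 0 < s / 2 by lra.
have sd2 : 2 * (s / 2) / 2 ^+ n < d.
  apply: le_lt_trans sd; rewrite exprS le_eqVlt; apply/orP; left; apply/eqP.
  by field; rewrite expf_neq0.
case: (sq_quarters s0 xs) => {}xs.
- by left; apply: IH.
- by right; left; apply: IH.
- by right; right; left; apply: IH.
- by right; right; right; apply: IH.
Qed.

(** Together with [measurable_dyadic], this turns openness in [R[i]] into measurability for the
    product sigma-algebra. *)
Lemma real_planeE W : open W ->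
  real_plane W = \bigcup_(N : nat) \bigcup_n dyadic W n (- N.+1%:R) (- N.+1%:R) (2 * N.+1%:R).
Proof.
move=> /open_normcP oW; apply/seteqP; split=> [x Wx|x [N _ [n _]]]; last first.
  by apply: dyadic_sub; rewrite mulr_gt0 // ltr0Sn.
have [d d0 dH] := oW _ Wx.
pose N := Num.bound (`|x.1| + `|x.2|).
have hN : `|x.1| + `|x.2| < N.+1%:R.
  apply: lt_le_trans (archi_boundP _) _; first by rewrite addr_ge0.
  by rewrite ler_nat.
pose n := Num.bound (2 * (2 * N.+1%:R) / d).
exists N => //; exists n => //; apply: dyadic_cover dH _.
- by rewrite mulr_gt0 // ltr0Sn.
- have := normr_ge0 x.1; have := normr_ge0 x.2 => h1 h2.
  have : `|x.1| < N.+1%:R by lra.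
  have : `|x.2| < N.+1%:R by lra.
  by rewrite !ltr_norml => /andP[? ?] /andP[? ?]; apply/sqP; split; lra.
have : 2 * (2 * N.+1%:R) / d < n%:R.
  by apply: archi_boundP; rewrite divr_ge0 // ?ltW // !mulr_ge0.
rewrite ltr_pdivrMr // ltr_pdivrMr ?exprn_gt0 // => h; apply: lt_le_trans h _.
rewrite mulrC ler_pM2l // -natrX ler_nat ltnW //; exact: ltn_expl.
Qed.

Lemma measurable_open W : open W -> measurable (real_plane W : set (RR * RR)).
Proof.
move=> oW; rewrite real_planeE //; do 2 (apply: bigcup_measurable => ? _).
exact: measurable_dyadic.
Qed.

Definition rcont (f : R[i] -> R) z := forall e : R, 0 < e -> exists2 d : R, 0 < d &
  forall w, normc (w - z) < d -> `|f w - f z| < e.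

Lemma measurable_continuous W (f : R[i] -> R) : open W ->
  (forall z, W z -> rcont f z) ->
  measurable_fun (real_plane W : set (RR * RR)) (fun x => f (x.1 +i* x.2)).
Proof.
move=> oW cf mD; apply: (measurability _ (RGenOInfty.measurableE R)) => //.
move=> /= _ [_ [c ->] <-].
rewrite [X in measurable X](_ : _ = real_plane [set z | W z /\ c < f z]); last first.
  by apply/seteqP; split => x; rewrite /real_plane /= in_itv /= andbT.
apply: measurable_open; apply/open_normcP => z [Wz cz].
have [d1 d10 H1] := (open_normcP _).1 oW _ Wz.
have [|d2 d20 H2] := cf z Wz (f z - c); first by rewrite subr_gt0.
exists (Num.min d1 d2); first by rewrite lt_min d10.
move=> w; rewrite lt_min => /andP[/H1 ? /H2]; rewrite ltr_norml => /andP[h1 h2].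
by split => //; lra.
Qed.

Section Density.
Variables (D : set (RR * RR)) (g : RR * RR -> RR * RR) (f : RR * RR -> \bar R).
Hypothesis mg : forall E, measurable E -> measurable (D `&` g @^-1` E).
Hypothesis mD : measurable D.
Hypothesis mf : measurable_fun D f.
Hypothesis f0 : forall x, D x -> (0 <= f x)%E.

(** The image under [g] of the measure on [D] with density [f], as a bare set function: the
    comparison rests on its value at the empty set, additivity and continuity along increasing
    unions. *)
Definition density (E : set (RR * RR)) : \bar R := (\int[mu2]_(x in D `&` g @^-1` E) f x)%E.

Lemma density0 : density set0 = 0%E.
Proof. by rewrite /density preimage_set0 setI0 integral_set0. Qed.

Lemma densityU (A B : set (RR * RR)) : measurable A -> measurable B -> A `&` B = set0 ->
  density (A `|` B) = (density A + density B)%E.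
Proof.
move=> mA mB AB; rewrite /density preimage_setU setIUr ge0_integral_setU //.
- exact: mg.
- exact: mg.
- apply: measurable_funS mf => //; rewrite -setIUr; exact: subIsetl.
- by move=> x [] [Dx _]; exact: f0.
- apply/disj_setPS => x [[_ Ax] [_ Bx]]; have : (A `&` B) (g x) by [].
  by rewrite AB.
Qed.

Lemma density_cvg (F : nat -> set (RR * RR)) : (forall n, measurable (F n)) ->
  (forall n, F n `<=` F n.+1) -> density (F n) @[n --> \oo] --> density (\bigcup_n F n).
Proof.
move=> mF ndF; rewrite /density preimage_bigcup setI_bigcupr.
apply: ge0_nondecreasing_set_cvg_integral.
- apply/nondecreasing_seqP => n; apply/subsetPset => x [Dx Fx]; split => //.
  exact: ndF.
- by move=> n; exact: mg.
- by move=> n; apply: measurable_funS mf => //; exact: subIsetl.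
- by move=> n x [/f0].
Qed.

End Density.

Lemma sq_absurd (a b s a' b' s' : R) x : sq a b s x -> sq a' b' s' x ->
  (a + s <= a') \/ (b + s <= b') -> False.
Proof. by move=> /sqP[? ?] /sqP[? ?] [?|?]; lra. Qed.

Lemma dyadic_le W (nu1 nu2 : set (RR * RR) -> \bar R) n a b s : 0 < s ->
  nu1 set0 = 0%E -> nu2 set0 = 0%E ->
  (forall A B, measurable A -> measurable B -> A `&` B = set0 -> nu1 (A `|` B) = (nu1 A + nu1 B)%E) ->
  (forall A B, measurable A -> measurable B -> A `&` B = set0 -> nu2 (A `|` B) = (nu2 A + nu2 B)%E) ->
  (forall a b s, 0 < s -> closed_sq a b s `<=` W -> (nu1 (sq a b s) <= nu2 (sq a b s))%E) ->
  (nu1 (dyadic W n a b s) <= nu2 (dyadic W n a b s))%E.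
Proof.
move=> + z1 z2 U1 U2 H; elim: n a b s => [|n IH] a b s s0 /=.
  by case: ifP => [/asboolP/H|_]; [apply|rewrite z1 z2].
case: ifP => [/asboolP/H|_]; first by apply.
have s2 : 0 < s / 2 by lra.
set Q1 := dyadic W n a b _; set Q2 := dyadic W n _ b _; set Q3 := dyadic W n a _ _; set Q4 := dyadic W n _ _ _.
have h1 : Q1 `<=` sq a b (s / 2) by exact: dyadic_sub_sq.
have h2 : Q2 `<=` sq (a + s / 2) b (s / 2) by exact: dyadic_sub_sq.
have h3 : Q3 `<=` sq a (b + s / 2) (s / 2) by exact: dyadic_sub_sq.
have h4 : Q4 `<=` sq (a + s / 2) (b + s / 2) (s / 2) by exact: dyadic_sub_sq.
have d34 : Q3 `&` Q4 = set0.
  by rewrite -subset0 => x [/h3 k3 /h4 k4]; apply: (sq_absurd k3 k4); left.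
have d2 : Q2 `&` (Q3 `|` Q4) = set0.
  by rewrite -subset0 => x [/h2 k2 [/h3 k3|/h4 k4]];
    [apply: (sq_absurd k2 k3)|apply: (sq_absurd k2 k4)]; right.
have d1 : Q1 `&` (Q2 `|` (Q3 `|` Q4)) = set0.
  by rewrite -subset0 => x [/h1 k1 [/h2 k2|[/h3 k3|/h4 k4]]];
    [apply: (sq_absurd k1 k2); left|apply: (sq_absurd k1 k3); right|apply: (sq_absurd k1 k4); left].
have m1 : measurable Q1 by exact: measurable_dyadic.
have m2 : measurable Q2 by exact: measurable_dyadic.
have m3 : measurable Q3 by exact: measurable_dyadic.
have m4 : measurable Q4 by exact: measurable_dyadic.
rewrite !(U1, U2) //; try by do ?apply: measurableU.
by rewrite !leeD ?IH.
Qed.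

(* An open set is exhausted by unions of disjoint dyadic squares, so it suffices to compare squares. *)
Lemma measure_le_open W (nu1 nu2 : set (RR * RR) -> \bar R) : open W ->
  nu1 set0 = 0%E -> nu2 set0 = 0%E ->
  (forall A B, measurable A -> measurable B -> A `&` B = set0 -> nu1 (A `|` B) = (nu1 A + nu1 B)%E) ->
  (forall A B, measurable A -> measurable B -> A `&` B = set0 -> nu2 (A `|` B) = (nu2 A + nu2 B)%E) ->
  (forall F : nat -> set (RR * RR), (forall n, measurable (F n)) -> (forall n, F n `<=` F n.+1) ->
     nu1 (F n) @[n --> \oo] --> nu1 (\bigcup_n F n)) ->
  (forall F : nat -> set (RR * RR), (forall n, measurable (F n)) -> (forall n, F n `<=` F n.+1) ->
     nu2 (F n) @[n --> \oo] --> nu2 (\bigcup_n F n)) ->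
  (forall a b s, 0 < s -> closed_sq a b s `<=` W -> (nu1 (sq a b s) <= nu2 (sq a b s))%E) ->
  (nu1 (real_plane W) <= nu2 (real_plane W))%E.
Proof.
move=> oW z1 z2 U1 U2 C1 C2 H; rewrite real_planeE //.
pose A N n := dyadic W n (- N.+1%:R) (- N.+1%:R) (2 * N.+1%:R).
have s0 N : 0 < 2 * N.+1%:R :> R by rewrite mulr_gt0 // ltr0Sn.
have AE N : \bigcup_n A N n = real_plane W `&` sq (- N.+1%:R) (- N.+1%:R) (2 * N.+1%:R).
  apply/seteqP; split => [x [n _ Ax]|x [Wx sx]].
    by split; [exact: dyadic_sub Ax|exact: dyadic_sub_sq Ax].
  have [d d0 dH] := (open_normcP _).1 oW _ Wx.
  pose n := Num.bound (2 * (2 * N.+1%:R) / d).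
  exists n => //; apply: dyadic_cover dH _ => //.
  have : 2 * (2 * N.+1%:R) / d < n%:R.
    by apply: archi_boundP; rewrite divr_ge0 // ?ltW // !mulr_ge0.
  rewrite ltr_pdivrMr // ltr_pdivrMr ?exprn_gt0 // => h; apply: lt_le_trans h _.
  rewrite mulrC ler_pM2l // -natrX ler_nat ltnW //; exact: ltn_expl.
have mA N : measurable (\bigcup_n A N n).
  by apply: bigcup_measurable => n _; exact: measurable_dyadic.
have leN N : (nu1 (\bigcup_n A N n) <= nu2 (\bigcup_n A N n))%E.
  have c1 := C1 (A N) (fun n => measurable_dyadic _ _ _ _ _) (fun n => dyadic_mono (s0 N)).
  have c2 := C2 (A N) (fun n => measurable_dyadic _ _ _ _ _) (fun n => dyadic_mono (s0 N)).
  rewrite -(cvg_lim _ c1) // -(cvg_lim _ c2) //; apply: lee_lim.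
  - by apply/cvg_ex; eexists; exact: c1.
  - by apply/cvg_ex; eexists; exact: c2.
  - by apply: nearW => n; apply: dyadic_le.
have ndN N : \bigcup_n A N n `<=` \bigcup_n A N.+1 n.
  rewrite !AE => x [Wx /sqP[h1 h2]]; split => //; apply/sqP.
  by rewrite -[N.+2%:R]natr1; split; lra.
have c1 := C1 _ mA ndN; have c2 := C2 _ mA ndN.
rewrite -(cvg_lim _ c1) // -(cvg_lim _ c2) //; apply: lee_lim.
- by apply/cvg_ex; eexists; exact: c1.
- by apply/cvg_ex; eexists; exact: c2.
- exact: nearW.
Qed.

End Exhaustion.

(** * Conformal maps with explicit inverses *)

Section Conformal.
Variable R : realType.
Implicit Types (U W X : set R[i]) (F G dG : R[i] -> R[i]).

(* [F] inverts [G] and [dG] is the derivative of [G]; its holomorphy is a field so that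
   no theorem on derivatives of holomorphic functions is needed. *)
Record conformal U W G F dG : Prop := Conformal {
  conf_openU : open U;
  conf_openW : open W;
  conf_maps : forall x, U x -> W (G x);
  conf_K : forall x, U x -> F (G x) = x;
  conf_inv : forall y, W y -> U (F y);
  conf_KV : forall y, W y -> G (F y) = y;
  conf_deriv : forall x, U x -> cderiv G x (dG x);
  conf_deriv_holo : forall x, U x -> exists a, cderiv dG x a;
  conf_inv_holo : forall y, W y -> exists b, cderiv F y b }.

(** The chain rule for [G (F w) = w], an identity that holds near [y] because [W] is open. *)
Lemma conf_inv_deriv U W G F dG y : conformal U W G F dG -> W y ->
  dG (F y) != 0 /\ cderiv F y (dG (F y))^-1.
Proof.
move=> c Wy; have [b Fb] := conf_inv_holo c Wy.
have h := cderiv_comp Fb (conf_deriv c (conf_inv c Wy)).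
have [d d0 dW] := (open_normcP _).1 (conf_openW c) _ Wy.
have h1 : dG (F y) * b = 1.
  apply: cderiv_unique h _; apply: (@cderiv_near _ id _ y _ d) => // [w /dW Ww|].
    by rewrite (conf_KV c).
  exact: cderiv_id.
have n0 : dG (F y) != 0.
  by apply/eqP => e; move/eqP: h1; rewrite e mul0r eq_sym oner_eq0.
split => //; rewrite -[_^-1]mulr1 -h1 mulKf //.
Qed.

Lemma conformal_comp U W X G F dG G2 F2 dG2 : conformal U W G F dG ->
  conformal W X G2 F2 dG2 ->
  conformal U X (fun x => G2 (G x)) (fun y => F (F2 y)) (fun x => dG2 (G x) * dG x).
Proof.
move=> c1 c2; split.
- exact: conf_openU c1.
- exact: conf_openW c2.
- by move=> x Ux; apply: (conf_maps c2); apply: (conf_maps c1).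
- by move=> x Ux; rewrite (conf_K c2) ?(conf_K c1) //; apply: (conf_maps c1).
- by move=> y Xy; apply: (conf_inv c1); apply: (conf_inv c2).
- by move=> y Xy; rewrite (conf_KV c1) ?(conf_KV c2) //; apply: (conf_inv c2).
- move=> x Ux; apply: cderiv_comp; first exact: (conf_deriv c1).
  by apply: (conf_deriv c2); apply: (conf_maps c1).
- move=> x Ux; have [a ha] := conf_deriv_holo c1 Ux.
  have [b hb] := conf_deriv_holo c2 (conf_maps c1 Ux).
  by eexists; apply: cderivM ha; apply: cderiv_comp hb; apply: (conf_deriv c1).
- move=> y Xy; have [b hb] := conf_inv_holo c2 Xy.
  have [a ha] := conf_inv_holo c1 (conf_inv c2 Xy).
  by eexists; exact: cderiv_comp hb ha.
Qed.

Lemma conformal_sub U W G F dG U' : conformal U W G F dG -> open U' -> U' `<=` U ->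
  conformal U' (W `&` F @^-1` U') G F dG.
Proof.
move=> c oU' UU; split => //.
- apply/open_normcP => y [Wy Uy].
  have [d d0 dW] := (open_normcP _).1 (conf_openW c) _ Wy.
  have [d1 d10 dU] := (open_normcP _).1 oU' _ Uy.
  have [b /cderiv_cont /continuous_normcP cF] := conf_inv_holo c Wy.
  have [d2 d20 dF] := cF _ d10.
  exists (Num.min d d2); first by rewrite lt_min d0.
  by move=> w; rewrite lt_min => /andP[/dW ? /dF /dU].
- move=> x Ux; split; first by apply: (conf_maps c); exact: UU.
  by rewrite /preimage /= (conf_K c) //; exact: UU.
- by move=> x Ux; apply: (conf_K c); exact: UU.
- by move=> y [].
- by move=> y [Wy _]; apply: (conf_KV c).
- by move=> x Ux; apply: (conf_deriv c); exact: UU.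
- by move=> x Ux; apply: (conf_deriv_holo c); exact: UU.
- by move=> y [Wy _]; apply: (conf_inv_holo c).
Qed.

Lemma rcontP (f : R[i] -> R) z : rcont f z <-> {for z, continuous f}.
Proof.
split=> [H A /real_nbhsP[e e0 eA]|H e e0].
  have [d d0 dH] := H _ e0.
  by apply/nbhs_normcP; exists d => // w /dH /eA.
have /H : nbhs (f z) [set y | `|y - f z| < e] by apply/real_nbhsP; exists e.
by move=> /nbhs_normcP.
Qed.

Lemma rcontM (f g : R[i] -> R) z : rcont f z -> rcont g z -> rcont (fun x => f x * g x) z.
Proof. by move=> /rcontP ? /rcontP ?; apply/rcontP; apply: continuousM. Qed.

Lemma rcont_normc G z a : cderiv G z a -> rcont (fun x => normc (G x)) z.
Proof.
move=> /cderiv_cont /continuous_normcP H e e0; have [d d0 dH] := H _ e0.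
exists d => // w /dH; apply: le_lt_trans; rewrite ler_norml.
have := ler_normcB (G w) (G z); have := ler_normcB (G z) (G w); rewrite [normc (G z - _)]normcB.
lra.
Qed.

Lemma rcont_Re G z a : cderiv G z a -> rcont (fun x => Re (G x)) z.
Proof.
move=> /cderiv_cont /continuous_normcP H e e0; have [d d0 dH] := H _ e0.
by exists d => // w /dH; apply: le_lt_trans; rewrite -Re_opp -Re_add; exact: Re_le_normc.
Qed.

Lemma rcont_Im G z a : cderiv G z a -> rcont (fun x => Im (G x)) z.
Proof.
move=> /cderiv_cont /continuous_normcP H e e0; have [d d0 dH] := H _ e0.
by exists d => // w /dH; apply: le_lt_trans; rewrite -Im_opp -Im_add; exact: Im_le_normc.
Qed.

End Conformal.

(** * Change of variables under a conformal map *)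

Section ChangeOfVariables.
Variable R : realType.

Lemma perturbed_itv (a s t x q : R) : 0 < t -> a <= x < a + s -> `|q| <= t ->
  a - t <= x + q < a - t + (s + 3 * t).
Proof. by move=> t0 h1; rewrite ler_norml; lra. Qed.

(** In [local_le], [k + e / 16] bounds the density and [1 + t] is the ratio of the enlarged side to
    the original one; both losses together fit into [e / 2], and the other [e / 2] pays for the
    lower bound of [nu2]. *)
Lemma area_ratio_bound (k e t : R) : 0 <= k -> 0 < e -> 0 < t -> t <= 1 ->
  t * (12 * (k + 1)) <= e -> (k + e / 16) * (1 + t) ^+ 2 <= k - e / 2 + e.
Proof.
move=> k0 e0 t0 t1 te; apply: (@le_trans _ _ ((k + e / 16) * (1 + 3 * t))); last by nra.
by apply: ler_wpM2l; [lra|nra].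
Qed.

Notation mu := (@lebesgue_measure R).
Notation mu2 := (mu \x mu)%E.
Local Notation RR := (measurableTypeR R).
Variables (U W : set R[i]) (G F dG : R[i] -> R[i]) (k : R[i] -> R).
Hypothesis cG : conformal U W G F dG.
Hypothesis k0 : forall y, W y -> 0 <= k y.
Hypothesis ck : forall y, W y -> rcont k y.

Let g (x : RR * RR) : RR * RR := (Re (G (x.1 +i* x.2)), Im (G (x.1 +i* x.2))).
Let h (x : RR * RR) : \bar R := (k (G (x.1 +i* x.2)) * normc (dG (x.1 +i* x.2)) ^+ 2)%:E.
Let kE (x : RR * RR) : \bar R := (k (x.1 +i* x.2))%:E.
Let nu1 := density (real_plane U) g h.
Let nu2 := density (real_plane W) id kE.

Let mU : measurable (real_plane U : set (RR * RR)).
Proof. exact: (measurable_open (conf_openU cG)). Qed.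

Let mW : measurable (real_plane W : set (RR * RR)).
Proof. exact: (measurable_open (conf_openW cG)). Qed.

Let gC x : (g x).1 +i* (g x).2 = G (x.1 +i* x.2).
Proof. by rewrite /g /=; case: (G _). Qed.

Let mg E : measurable E -> measurable (real_plane U `&` g @^-1` E).
Proof.
move=> mE.
pose g' (x : RR * RR) : RR * RR :=
  (((fun x => (g x).1) \_ (real_plane U)) x, ((fun x => (g x).2) \_ (real_plane U)) x).
have mg' : measurable_fun setT g'.
  apply: measurable_fun_pair; apply/(measurable_restrictT _ _).1 => //.
    apply: (@measurable_continuous _ _ (fun z => Re (G z))); first exact: conf_openU cG.
    by move=> z Uz; exact: rcont_Re (conf_deriv cG Uz).
  apply: (@measurable_continuous _ _ (fun z => Im (G z))); first exact: conf_openU cG.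
  by move=> z Uz; exact: rcont_Im (conf_deriv cG Uz).
rewrite [X in measurable X](_ : _ = real_plane U `&` g' @^-1` E); last first.
  by apply/seteqP; split => x [Ux]; split => //; move: b; rewrite /preimage /= /g' !patchE !mem_set.
by apply: measurableI => //; rewrite -[X in measurable X]setTI; exact: (mg' measurableT).
Qed.

Let mid E : measurable E -> measurable (real_plane W `&` id @^-1` E).
Proof. by move=> mE; exact: measurableI. Qed.

Let mh : measurable_fun (real_plane U) h.
Proof.
apply/measurable_EFinP; apply: (@measurable_continuous _ _ (fun z => k (G z) * normc (dG z) ^+ 2)).
  exact: conf_openU cG.
move=> z Uz; have [a ha] := conf_deriv_holo cG Uz.
have hn := rcont_normc ha.
apply: rcontM; last exact: rcontM.
move=> e e0; have [d d0 dH] := ck (conf_maps cG Uz) e0.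
have /cderiv_cont/continuous_normcP/(_ _ d0)[d1 d10 H1] := conf_deriv cG Uz.
by exists d1 => // w /H1 /dH.
Qed.

Let mk : measurable_fun (real_plane W) kE.
Proof.
apply/measurable_EFinP; apply: measurable_continuous => //; exact: conf_openW cG.
Qed.

Let h0 x : real_plane U x -> (0 <= h x)%E.
Proof.
by move=> Ux; rewrite lee_fin mulr_ge0 ?sqr_ge0 // k0 //; exact: (conf_maps cG).
Qed.

Let kE0 x : real_plane W x -> (0 <= kE x)%E.
Proof. by move=> Wx; rewrite lee_fin k0. Qed.

(** Near [y0] the inverse [F] is affine up to a small relative error, so the points that [G] sends
    into a small square lie in the preimage [L] of a slightly larger square under the affine map
    tangent to [G] at [x0]. The area of [L] is known exactly, and the densities are nearly constant
    at this scale. *)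
Let local_le (y0 : R[i]) (e : R) : W y0 -> 0 < e -> exists2 d, 0 < d & forall a b s,
  0 < s < d -> closed_sq a b s `<=` W -> a <= Re y0 <= a + s -> b <= Im y0 <= b + s ->
  (nu1 (sq a b s) <= nu2 (sq a b s) + (e * s ^+ 2)%:E)%E.
Proof.
move=> Wy e0; have [n0 dF] := conf_inv_deriv cG Wy.
set x0 := F y0 in n0 dF *; set c := dG x0 in n0 dF *; set rho := normc c.
have r0 : 0 < rho by rewrite normc_gt0.
have [b hb] := conf_deriv_holo cG (conf_inv cG Wy).
have cPhi : rcont (fun y => k y * normc (dG (F y)) ^+ 2) y0.
  apply: rcontM; first exact: ck.
  have hn := rcont_normc (cderiv_comp dF hb).
  exact: rcontM.
have k00 := k0 Wy.
(* The area of [L] carries a division by [rho^2], which turns this into the [e / 16] of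
   [area_ratio_bound]. *)
pose e2 := e * rho ^+ 2 / 16.
have e20 : 0 < e2 by rewrite divr_gt0 // mulr_gt0 // exprn_gt0.
pose tau := Num.min 1 (e / (12 * (k y0 + 1))).
have tau0 : 0 < tau by rewrite lt_min ltr01 divr_gt0 // mulr_gt0 //; lra.
(* As [|y - y0| <= 2 s], the affine error [rho * e1 * 2 s] is [eta = tau s / 3], and the enlarged
   side [s + 3 eta] is [(1 + tau) s]. *)
pose e1 := tau / (6 * rho).
have e10 : 0 < e1 by rewrite divr_gt0 // mulr_gt0.
have e4 : 0 < e / 2 by lra.
have [d1 d10 H1] := dF _ e10; have [d2 d20 H2] := cPhi _ e20; have [d3 d30 H3] := ck Wy e4.
exists (Num.min (Num.min d1 d2) d3 / 2); first by rewrite divr_gt0 // !lt_min d10 d20 d30.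
move=> a b' s /andP[s0 sd] sW ha hb'.
have sd' : 2 * s < Num.min (Num.min d1 d2) d3 by rewrite mulrC -ltr_pdivlMr.
move: sd'; rewrite !lt_min => /andP[/andP[sd1 sd2] sd3].
have near_sq (y : RR * RR) : sq a b' s y -> W (y.1 +i* y.2) /\ normc ((y.1 +i* y.2) - y0) <= 2 * s.
  move=> /sqP[/andP[p1 p2] /andP[p3 p4]]; split; first by apply: sW; rewrite /closed_sq /= p1 p3 !ltW.
  apply: le_trans (normc_le_ReIm _) _; rewrite !ReImE /=.
  rewrite mulr_natl mulr2n; apply: lerD.
    by apply: (ler_dist_itv ha); rewrite p1 ltW.
  by apply: (ler_dist_itv hb'); rewrite p3 ltW.
pose eta := tau / 3 * s.
have eta0 : 0 < eta by rewrite mulr_gt0 // divr_gt0.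
pose S := s + 3 * eta.
have S0 : 0 < S by rewrite addr_gt0 // mulr_gt0.
pose t := y0 - c * x0.
pose L := [set x : RR * RR | sq (a - eta) (b' - eta) S
   (Re c * x.1 - Im c * x.2 + Re t, Im c * x.1 + Re c * x.2 + Im t)].
have cn : Re c ^+ 2 + Im c ^+ 2 = rho ^+ 2 by rewrite -sqr_normcE.
have cn0 : Re c ^+ 2 + Im c ^+ 2 != 0 by rewrite cn expf_neq0 // gt_eqF.
have muL : mu2 L = (S ^+ 2 / rho ^+ 2)%:E by rewrite /L mu2_conformal_preimage // cn.
have subL : real_plane U `&` g @^-1` sq a b' s `<=` L.
  move=> x [Ux gx]; have [Wg ng] := near_sq _ gx.
  move: (gx) => /sqP [p1 p2].
  rewrite gC in Wg ng; set z := x.1 +i* x.2 in Ux Wg ng.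
  have Fz : F (G z) = z by rewrite (conf_K cG).
  have := H1 (G z) (le_lt_trans ng sd1); rewrite Fz -/x0.
  set r := z - x0 - _ => hr.
  have rr : normc (c * r) <= eta.
    rewrite normcM -/rho; apply: le_trans (ler_wpM2l (ltW r0) hr) _.
    apply: le_trans (ler_wpM2l (ltW r0) (ler_wpM2l (ltW e10) ng)) _.
    by rewrite le_eqVlt; apply/orP; left; apply/eqP; rewrite /e1 /eta; field; rewrite gt_eqF.
  have Ez : c * z + t = G z + c * r.
    by rewrite /t /r; field.
  have E1 : Re c * x.1 - Im c * x.2 + Re t = (g x).1 + Re (c * r).
    have E9 := congr1 (@complex.Re R) Ez.
    by rewrite (Re_add (c * z)) (Re_add (G z)) (Re_mul c z) in E9; exact: E9.
  have E2 : Im c * x.1 + Re c * x.2 + Im t = (g x).2 + Im (c * r).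
    have E9 := congr1 (@complex.Im R) Ez.
    rewrite (Im_add (c * z)) (Im_add (G z)) (Im_mul c z) [Re c * _ + _]addrC in E9; exact: E9.
  have := le_trans (Re_le_normc _) rr; have := le_trans (Im_le_normc _) rr.
  move=> q1 q2; apply/sqP; rewrite /= E1 E2 /S.
  by split; exact: perturbed_itv.
have mL : measurable L.
  pose f (x : RR * RR) : RR * RR := (Re c * x.1 - Im c * x.2 + Re t, Im c * x.1 + Re c * x.2 + Im t).
  have mf : measurable_fun setT f.
    apply: measurable_fun_pair; (apply: measurable_funD => //);
      [apply: measurable_funB|apply: measurable_funD]; exact: measurable_funM.
  rewrite -[X in measurable X]setTI; apply: (mf measurableT); exact: measurable_sq.
have upper : (nu1 (sq a b' s) <= ((k y0 * rho ^+ 2 + e2) * (S ^+ 2 / rho ^+ 2))%:E)%E.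
  have H0 : 0 <= k y0 * rho ^+ 2 + e2 by rewrite addr_ge0 ?mulr_ge0 ?sqr_ge0 // ltW.
  have mS : measurable (real_plane U `&` g @^-1` sq a b' s) by exact: (mg (measurable_sq _ _ _)).
  apply: (@le_trans _ _ (\int[mu2]_(x in real_plane U `&` g @^-1` sq a b' s) (k y0 * rho ^+ 2 + e2)%:E)%E).
    apply: ge0_le_integral => //.
    - by move=> x [/h0].
    - by apply: measurable_funS mh => //; exact: subIsetl.
    - move=> x [Ux gx]; have [Wg ng] := near_sq _ gx; rewrite gC in Wg ng.
      have := H2 _ (le_lt_trans ng sd2); rewrite (conf_K cG) // -/x0 -/c -/rho.
      by rewrite lee_fin ltr_norml => /andP[_]; rewrite ltrBlDl => /ltW.
  rewrite integral_cst //= EFinM -muL; apply: lee_wpmul2l; first by rewrite lee_fin.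
  by apply: le_measure => //; rewrite inE.
have lower : (((k y0 - e / 2) * s ^+ 2)%:E <= nu2 (sq a b' s))%E.
  have sqW : sq a b' s `<=` real_plane W by move=> y /near_sq[].
  rewrite /nu2 /density preimage_id setIC setIidl //.
  (* The maximum keeps the constant integrand nonnegative when [k y0 < e / 2]. *)
  have m0 : 0 <= Num.max 0 (k y0 - e / 2) by rewrite le_max lexx.
  apply: (@le_trans _ _ (\int[mu2]_(x in sq a b' s) (Num.max 0 (k y0 - e / 2))%:E)%E).
    rewrite integral_cst /=; last exact: measurable_sq.
    by have -> := mu2_sq a b' s0; rewrite -EFinM lee_fin ler_wpM2r ?sqr_ge0 // le_max lexx orbT.
  apply: ge0_le_integral => //.
  - exact: measurable_sq.
  - by apply: measurable_funS mk => //.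
  - move=> y sy; have [Wy' ny] := near_sq _ sy; rewrite lee_fin ge_max k0 //=.
    rewrite lerBlDl -lerBlDr ltW //; have := H3 _ (le_lt_trans ny sd3).
    by rewrite distrC => /(le_lt_trans (ler_norm _)).
apply: le_trans upper _.
apply: (@le_trans _ _ (((k y0 - e / 2) * s ^+ 2)%:E + (e * s ^+ 2)%:E)%E); last exact: leeD.
rewrite -EFinD lee_fin -mulrDl.
have -> : (k y0 * rho ^+ 2 + e2) * (S ^+ 2 / rho ^+ 2) = (k y0 + e / 16) * (1 + tau) ^+ 2 * s ^+ 2.
  by rewrite /e2 /S /eta; field; rewrite gt_eqF.
rewrite ler_pM2r ?exprn_gt0 //.
have t1 : tau <= 1 by rewrite ge_min lexx.
have t2 : tau * (12 * (k y0 + 1)) <= e.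
  by rewrite -ler_pdivlMr; [rewrite ge_min lexx orbT|rewrite mulr_gt0 //; lra].
exact: area_ratio_bound.
Qed.

Let sq_split a b s : 0 < s -> sq a b s = sq a b (s / 2) `|` (sq (a + s / 2) b (s / 2) `|`
      (sq a (b + s / 2) (s / 2) `|` sq (a + s / 2) (b + s / 2) (s / 2))) :> set (RR * RR).
Proof.
move=> s0; apply/seteqP; split => x.
  move=> /(sq_quarters s0)[?|?|?|?]; by [left|right; left|right; right; left|right; right; right].
by case=> [/sqP[? ?]|[/sqP[? ?]|[/sqP[? ?]|/sqP[? ?]]]]; apply/sqP; split; lra.
Qed.

Let nuU D' g' f' a b s : 0 < s ->
  (forall A B, measurable A -> measurable B -> A `&` B = set0 ->
     density D' g' f' (A `|` B) = (density D' g' f' A + density D' g' f' B)%E :> \bar R) ->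
  density D' g' f' (sq a b s) =
  (density D' g' f' (sq a b (s / 2)) + (density D' g' f' (sq (a + s / 2) b (s / 2)) +
   (density D' g' f' (sq a (b + s / 2) (s / 2)) + density D' g' f' (sq (a + s / 2) (b + s / 2) (s / 2)))))%E.
Proof.
move=> s0 dU; rewrite sq_split //.
have m (a' b' s' : R) : measurable (sq a' b' s') by exact: measurable_sq.
rewrite !dU //; try by do ?apply: measurableU.
- by rewrite -subset0 => x [k3 k4]; apply: (sq_absurd k3 k4); left.
- by rewrite -subset0 => x [k2 [k3|k4]];
    [apply: (sq_absurd k2 k3)|apply: (sq_absurd k2 k4)]; right.
- by rewrite -subset0 => x [k1 [k2|[k3|k4]]];
    [apply: (sq_absurd k1 k2); left|apply: (sq_absurd k1 k3); right|apply: (sq_absurd k1 k4); left].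
Qed.

(** The error [e s^2] is additive under quartering, so [square_bisection] globalizes [local_le];
    then [e] tends to [0]. *)
Let sq_le a b s : 0 < s -> closed_sq a b s `<=` W -> (nu1 (sq a b s) <= nu2 (sq a b s))%E.
Proof.
move=> s0 sW.
have main e : 0 < e -> (nu1 (sq a b s) <= nu2 (sq a b s) + (e * s ^+ 2)%:E)%E.
  move=> e0; apply: (@square_bisection R a b s (fun a b s =>
     (nu1 (sq a b s) <= nu2 (sq a b s) + (e * s ^+ 2)%:E)%E)) => //.
    move=> a' b' t t0 _ _ _ _ h1 h2 h3 h4.
    have S1 := nuU a' b' t0 (densityU mg mU mh h0); have S2 := nuU a' b' t0 (densityU mid mW mk kE0).
    rewrite /nu1 /nu2 S1 S2.
    have -> : ((e * t ^+ 2)%:E = (e * (t / 2) ^+ 2)%:E + ((e * (t / 2) ^+ 2)%:E +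
      ((e * (t / 2) ^+ 2)%:E + (e * (t / 2) ^+ 2)%:E)) :> \bar R)%E.
      by rewrite -!EFinD; congr (_%:E); field.
    apply: le_trans (leeD h1 (leeD h2 (leeD h3 h4))) _.
    rewrite le_eqVlt; apply/orP; left; apply/eqP.
    by rewrite [RHS]addeACA; congr (_ + _)%E; rewrite [RHS]addeACA; congr (_ + _)%E; rewrite [RHS]addeACA.
  move=> x y hx hy.
  have Wxy : W (x +i* y) by apply: sW.
  have [d d0 dH] := local_le Wxy e0.
  exists d => // a' b' t ht ha1 ha2 hb1 hb2 hx' hy'; apply: dH => //.
  by move=> z [z1 z2]; apply: sW; split; lra.
have s2 : 0 < s ^+ 2 by rewrite exprn_gt0.
apply/lee_addgt0Pr => e e0; apply: le_trans (main (e / s ^+ 2) (divr_gt0 e0 s2)) _.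
by rewrite divfK // gt_eqF.
Qed.

Lemma change_of_variables_le :
  (\int[mu2]_(x in real_plane U) (k (G (x.1 +i* x.2)) * normc (dG (x.1 +i* x.2)) ^+ 2)%:E
   <= \int[mu2]_(x in real_plane W) (k (x.1 +i* x.2))%:E)%E.
Proof.
have -> : (\int[mu2]_(x in real_plane W) (k (x.1 +i* x.2))%:E = nu2 (real_plane W))%E.
  by rewrite /nu2 /density preimage_id setIid.
have -> : (\int[mu2]_(x in real_plane U) (k (G (x.1 +i* x.2)) * normc (dG (x.1 +i* x.2)) ^+ 2)%:E
   = nu1 (real_plane W))%E.
  rewrite /nu1 /density; congr (integral _ _ _); rewrite setIidl // => x Ux.
  by rewrite /preimage /real_plane /=; case E : (G _) (conf_maps cG Ux).
apply: measure_le_open.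
- exact: conf_openW cG.
- exact: density0.
- exact: density0.
- exact: (densityU mg mU mh h0).
- exact: (densityU mid mW mk kE0).
- exact: (density_cvg mg mU mh h0).
- exact: (density_cvg mid mW mk kE0).
- exact: sq_le.
Qed.

End ChangeOfVariables.

(** * Area of the disk and the area mean value inequality *)

Section DiskArea.
Variable R : realType.
Notation mu := (@lebesgue_measure R).
Notation mu2 := (mu \x mu)%E.
Local Notation RR := (measurableTypeR R).
Local Notation disk := (@unit_disk R).

Lemma open_unit_disk : open disk.
Proof.
apply/open_normcP => z zd; exists (1 - normc z); first by rewrite subr_gt0.
by move=> w h; rewrite /unit_disk /=; have := normc_triangle w z 0; rewrite !subr0; lra.
Qed.

Lemma unit_disk_sq (x y : R) : unit_disk (x +i* y) <-> x ^+ 2 + y ^+ 2 < 1.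
Proof.
rewrite /unit_disk /=; split => h; last by rewrite -sqrtr1 ltr_sqrt.
have := sqr_sqrtr (addr_ge0 (sqr_ge0 x) (sqr_ge0 y)) => <-.
by rewrite expr_lt1 // sqrtr_ge0.
Qed.

(** The substitution [x = sin t] produces [2 cos(t)^2], with primitive [t + sin t cos t]. *)
Lemma integral_half_circle :
  (\int[mu]_(x in `[(-1)%R, 1%R]) (2 * Num.sqrt (1 - x ^+ 2))%:E = (pi : R)%:E)%E.
Proof.
have p0 := pi_gt0 R; have p2 : - (pi / 2) < pi / 2 :> R by lra.
have e1 : -1 = sin (- (pi / 2)) :> R by rewrite sinN sin_pihalf.
have e2 : 1 = sin (pi / 2) :> R by rewrite sin_pihalf.
have dsin : (sin : R -> R)^`()%classic = cos.
  by apply/funext => x; rewrite derive1E; apply: derive_val.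
transitivity (\int[mu]_(x in `[sin (- (pi / 2))%R, sin (pi / 2)%R]) (2 * Num.sqrt (1 - x ^+ 2))%:E)%E.
  by rewrite -e1 -e2.
rewrite (@integration_by_substitution_increasing R sin (fun x => 2 * Num.sqrt (1 - x ^+ 2))).
- rewrite dsin.
  transitivity (\int[mu]_(x in `[(- (pi / 2))%R, (pi / 2)%R]) (2 * cos x ^+ 2)%:E)%E.
    apply: eq_integral => x; rewrite inE /= in_itv /= => hx; congr (_%:E) => /=.
    rewrite [LHS](_ : _ = 2 * Num.sqrt (1 - sin x ^+ 2) * cos x) // -cos2sin2 sqrtr_sqr
      ger0_norm ?cos_ge0_pihalf // -mulrA -expr2 //.
  have dF x : is_derive x (1:R) (fun t : R => t + sin t * cos t) (2 * cos x ^+ 2).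
    apply: is_derive_eq; rewrite /GRing.scale /=; have := cos2Dsin2 x; nra.
  rewrite (@continuous_FTC2 R (fun x => 2 * cos x ^+ 2) (fun t => t + sin t * cos t)) //.
  + by rewrite -EFinB cosN cos_pihalf !mulr0 !addr0 opprK -splitr.
  + apply: continuous_in_subspaceT => x _.
    have cc : {for x, continuous (fun x : R => 2 * (cos x * cos x))}.
      by apply: cvgM; [exact: cvg_cst|apply: cvgM; exact: continuous_cos].
    exact: cc.
  + have cF x : {for x, continuous (fun t : R => t + sin t * cos t)}.
      by apply: differentiable_continuous; apply/derivable1_diffP; case: (dF x).
    split => [x _||]; first by case: (dF x).
      by apply: cvg_at_right_filter; exact: cF.
    by apply: cvg_at_left_filter; exact: cF.
  + by move=> x _; rewrite derive1E; have := dF x => -[].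
- exact: ltW.
- by move=> x y hx hy xy; rewrite ltr_sin.
- by rewrite dsin => x _; exact: continuous_cos.
- rewrite dsin; apply/cvg_ex; eexists; apply: cvg_at_right_filter; exact: continuous_cos.
- rewrite dsin; apply/cvg_ex; eexists; apply: cvg_at_left_filter; exact: continuous_cos.
- split => [x _||]; first exact: ex_derive.
    by apply: cvg_at_right_filter; exact: continuous_sin.
  by apply: cvg_at_left_filter; exact: continuous_sin.
- apply: continuous_in_subspaceT => x _.
  suff cc : {for x, continuous (fun x : R => 2 * Num.sqrt (1 - x ^+ 2))} by exact: cc.
  apply: cvgM; first exact: cvg_cst.
  apply: (@continuous_comp _ _ _ (fun x : R => 1 - x ^+ 2) Num.sqrt); last exact: sqrt_continuous.
  by apply: continuousB; [exact: cst_continuous|exact: exprn_continuous].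
Qed.

Lemma mu2_disk : mu2 (real_plane disk) = (pi : R)%:E.
Proof.
rewrite /product_measure1 -integral_half_circle [RHS]integral_mkcond.
apply: eq_integral => x _; rewrite patchE /=.
have secE : xsection (real_plane disk) x = [set y : R | x ^+ 2 + y ^+ 2 < 1].
  by apply/seteqP; split => y; rewrite /xsection /= inE /real_plane /= unit_disk_sq.
rewrite secE; case: ifPn => [|]; rewrite ?inE ?notin_setE /= in_itv /=.
  move=> /andP[x1 x2]; pose r := Num.sqrt (1 - x ^+ 2).
  have r0 : 0 <= r by exact: sqrtr_ge0.
  have r2 : r ^+ 2 = 1 - x ^+ 2 by rewrite sqr_sqrtr // subr_ge0; nra.
  have -> : [set y : R | x ^+ 2 + y ^+ 2 < 1] = `] (- r), r [%classic.
    apply/seteqP; split => y /=; rewrite in_itv /= -ltr_norml => h.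
      rewrite -ltr_sqr ?nnegrE // r2 real_normK ?num_real //; lra.
    by move: h; rewrite -ltr_sqr ?nnegrE // r2 real_normK ?num_real //; lra.
  (* At [x = 1] and [x = - 1] the slice is empty and [r = 0]. *)
  rewrite lebesgue_measure_itv /= lte_fin; case: ltP => h.
    by rewrite -EFinB opprK; congr (_%:E); rewrite /r; ring.
  have r00 : r = 0 by lra.
  by rewrite -/r r00 mulr0.
move=> h; have -> : [set y : R | x ^+ 2 + y ^+ 2 < 1] = set0; last by rewrite measure0.
apply/seteqP; split => y //= h2; apply: h; have := sqr_ge0 y; nra.
Qed.

End DiskArea.

(** * Area mean value inequality for [|h|^2] *)

Section AreaMean.
Variable R : realType.
Notation mu := (@lebesgue_measure R).
Notation mu2 := (mu \x mu)%E.
Local Notation RR := (measurableTypeR R).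
Local Notation disk := (@unit_disk R).
Implicit Type h : R[i] -> R[i].

Lemma cderiv_scale (c w : R[i]) : cderiv (fun v => c * v) w c.
Proof.
have := cderivM (cderiv_cst w c) (cderiv_id w).
by rewrite mulr1 mulr0 addr0.
Qed.

Lemma cderiv_scaler (c w : R[i]) : cderiv (fun v => v * c) w c.
Proof.
have := cderivM (cderiv_id w) (cderiv_cst w c).
by rewrite mulr1 mulr0 add0r.
Qed.

Lemma expi_mulN (t : R) : expi (- t) * expi t = 1.
Proof.
apply: complexP; rewrite !ReImE /= cosN sinN; last by ring.
by have := cos2Dsin2 t; rewrite !expr2 => <-; ring.
Qed.

Lemma conformal_rotation (t : R) :
  conformal disk disk (fun z => expi t * z) (fun z => expi (- t) * z) (fun=> expi t).
Proof.
have od := @open_unit_disk R.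
split => // x xd.
- by rewrite /unit_disk /= normcM normc_expi mul1r.
- by rewrite mulrA expi_mulN mul1r.
- by rewrite /unit_disk /= normcM normc_expi mul1r.
- by rewrite mulrA [expi t * _]mulrC expi_mulN mul1r.
- exact: cderiv_scale.
- by eexists; exact: cderiv_cst.
- by eexists; exact: cderiv_scale.
Qed.

Lemma rotation_continuous h (w : R[i]) : (forall z, disk z -> exists a, cderiv h z a) -> disk w ->
  forall t, {for t, continuous (fun t => normc (h (expi t * w)) ^+ 2)}.
Proof.
move=> hh wd t.
have wt : disk (expi t * w) by rewrite /unit_disk /= normcM normc_expi mul1r.
have [a ha] := hh _ wt.
have hn := rcont_normc (cderiv_comp (cderiv_scaler w (expi t)) ha).
have : rcont (fun v => normc (h (v * w)) ^+ 2) (expi t) by exact: rcontM.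
move=> H; apply/real_continuousP => e e0.
have [d d0 dH] := H _ e0.
have [d1 d10 H1] := (real_continuousP _ _).1 (@continuous_cos R t) _ (divr_gt0 d0 (ltr0n _ 2)).
have [d2 d20 H2] := (real_continuousP _ _).1 (@continuous_sin R t) _ (divr_gt0 d0 (ltr0n _ 2)).
exists (Num.min d1 d2); first by rewrite lt_min d10.
move=> s; rewrite lt_min => /andP[/H1 h1 /H2 h2]; apply: dH.
by apply: le_lt_trans (normc_le_ReIm _) _; rewrite /=; lra.
Qed.

(** The mean value property is applied to [f v], the product of [h (v w)] with the conjugate of
    [h 0]. Its real part is at most [(|h 0|^2 + |h (v w)|^2) / 2], and the first half is absorbed on
    the left. *)
Lemma circle_mean_sqr h (w : R[i]) : (forall z, disk z -> exists a, cderiv h z a) -> disk w ->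
  pi *+ 2 * normc (h 0) ^+ 2 <= seg 0 (pi *+ 2) (fun t => normc (h (expi t * w)) ^+ 2).
Proof.
move=> hh wd; have p0 := twopi_gt0 R.
have vw v : normc v <= 1 -> disk (v * w).
  move=> v1; rewrite /unit_disk /= normcM; apply: le_lt_trans wd.
  by rewrite ler_piMl ?normc_ge0.
pose f v := conjc (h 0) * h (v * w).
have df v : normc v <= 1 -> exists a, cderiv f v a.
  move=> /vw /hh[a ha]; eexists; apply: (cderivM (cderiv_cst _ _)).
  apply: (cderiv_comp (cderiv_scaler w v)); exact: ha.
have := @circle_mean R f 1 ltr01.
have f00 : f 0 = (normc (h 0) ^+ 2)%:C by rewrite /f mul0r mulrC mulc_conj.
have c0 : {for 0, continuous f}.
  by have [|a ha] := df 0; [rewrite normc0|exact: cderiv_cont ha].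
rewrite f00 /= => /(_ c0 (fun v _ => df v)) cm.
have cn := rotation_continuous hh wd.
have cn2 t : {for t, continuous (fun t => - (normc (h (expi t * w)) ^+ 2 / 2))}.
  by apply: cvgN; apply: cvgM; [exact: cn|exact: cvg_cst].
set n0 := normc (h 0).
have : seg 0 (pi *+ 2) (fun t => Re (f (1%:C * expi t))) <=
   seg 0 (pi *+ 2) (fun t => (n0 ^+ 2 / 2 - - (normc (h (expi t * w)) ^+ 2 / 2))).
  apply: le_Rintegral => //.
  - apply: (@continuous_on_integrable _ _ _ (fun t => Re (f (1%:C * expi t)))) => t _.
    have [|a ha] := df (1%:C * expi t); first by rewrite mul1r normc_expi.
    exact: (@expi_cont R 1 f t ltr01 (cderiv_cont ha)).
  - apply: (@continuous_on_integrable _ _ _ (fun t => n0 ^+ 2 / 2 - - (normc (h (expi t * w)) ^+ 2 / 2))).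
    by apply: continuous_onB => t _; [exact: cst_continuous|exact: cn2].
  move=> t _; rewrite mul1r opprK; apply: le_trans (ler_norm _) _.
  apply: le_trans (Re_le_normc _) _; rewrite /f normcM normc_conj -/n0.
  have := sqr_ge0 (n0 - normc (h (expi t * w))); nra.
rewrite -/(circle_integral f 1) cm.
have -> : seg 0 (pi *+ 2) (fun t => (n0 ^+ 2 / 2 - - (normc (h (expi t * w)) ^+ 2 / 2))) =
   n0 ^+ 2 / 2 * (pi *+ 2) + 2^-1 * seg 0 (pi *+ 2) (fun t => normc (h (expi t * w)) ^+ 2).
  rewrite segB; last 2 first.
  - by move=> t _; exact: cst_continuous.
  - by move=> t _; exact: cn2.
  rewrite seg_cst ?subr0 ?ltW //; congr (_ + _); rewrite /seg.
  have -> : (fun x => - (normc (h (expi x * w)) ^+ 2 / 2)) =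
    (fun x => (- 2^-1) * (normc (h (expi x * w)) ^+ 2)).
    by apply/funext => x; ring.
  rewrite RintegralZl //; first by rewrite mulNr opprK.
  by apply: (@continuous_on_integrable _ _ _ (fun t => normc (h (expi t * w)) ^+ 2)) => t _; exact: cn.
rewrite -/n0; lra.
Qed.

Lemma unit_disk_rotation (t : R) z : disk (expi t * z) = disk z.
Proof. by rewrite /unit_disk /= normcM normc_expi mul1r. Qed.

Lemma mu2_sigma_finite : sigma_finite (setT : set (RR * RR)) mu2.
Proof.
exists (fun n : nat => `[(- n%:R), n%:R] `*` `[(- n%:R), n%:R]).
  apply/esym/seteqP; split => // x _; pose n := Num.bound (`|x.1| + `|x.2|).
  have h : `|x.1| + `|x.2| < n%:R by apply: archi_boundP; rewrite addr_ge0.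
  have := normr_ge0 x.1; have := normr_ge0 x.2 => h1 h2.
  have : `|x.1| < n%:R by lra.
  have : `|x.2| < n%:R by lra.
  by rewrite !ltr_norml => ? ?; exists n => //; split; rewrite /= in_itv /=; lra.
move=> n; split; first by apply: measurableX; exact: measurable_itv.
rewrite product_measure1E //= !lebesgue_measure_itv /=.
by case: ifP => _; [rewrite -EFinB -EFinM ltry|rewrite mul0e ltry].
Qed.

(** Tonelli's theorem is applied to the plane times the angles, so the planar measure enters as a
    sigma-finite factor. *)
Definition plane_measure : {sigma_finite_measure set (RR * RR)%type -> \bar R} :=
  HB.pack mu2 (Measure_isSigmaFinite.Build _ _ _ mu2 mu2_sigma_finite).

(** Instead of polar coordinates, [|h|^2] is averaged over the rotations of the disk. For each point
    the integral over the angles is at least [2 pi |h 0|^2], and the disk has area [pi]; for each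
    angle the integral over the disk is at most [I], by the change of variables. Tonelli compares
    the two. *)
Lemma area_mean (h : R[i] -> R[i]) : (forall z, disk z -> exists a, cderiv h z a) ->
  ((pi * normc (h 0) ^+ 2)%:E <=
    \int[mu2]_(x in real_plane disk) (normc (h (x.1 +i* x.2)) ^+ 2)%:E)%E.
Proof.
move=> hh; have p0 := twopi_gt0 R.
have mD : measurable (real_plane disk : set (RR * RR)) by exact: measurable_open (@open_unit_disk R).
set I := (\int[mu2]_(x in _) _)%E.
have chh z : disk z -> rcont (fun z => normc (h z) ^+ 2) z.
  by move=> /hh[a ha]; have hn := rcont_normc ha; exact: rcontM.
have mh : measurable_fun (real_plane disk : set (RR * RR)) (fun x => normc (h (x.1 +i* x.2)) ^+ 2).
  by apply: (@measurable_continuous _ _ (fun z => normc (h z) ^+ 2)) => //; exact: open_unit_disk.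
(* Extended by [0] outside the disk, so that its composite with [rot] is measurable on the whole
   product. *)
pose N : RR * RR -> R := (fun x => normc (h (x.1 +i* x.2)) ^+ 2) \_ (real_plane disk).
have mN : measurable_fun setT N by apply/(measurable_restrictT _ _).1.
have N0 x : 0 <= N x by rewrite /N patchE; case: ifP => // _; exact: sqr_ge0.
pose rot (p : (RR * RR) * RR) : RR * RR :=
  (cos p.2 * p.1.1 - sin p.2 * p.1.2, cos p.2 * p.1.2 + sin p.2 * p.1.1).
have rotE x t : (rot (x, t)).1 +i* (rot (x, t)).2 = expi t * (x.1 +i* x.2) by [].
have mcos : measurable_fun setT (cos : RR -> RR) by apply: continuous_measurable_fun; exact: continuous_cos.
have msin : measurable_fun setT (sin : RR -> RR) by apply: continuous_measurable_fun; exact: continuous_sin.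
have m2 : measurable_fun setT (fun p : (RR * RR) * RR => p.2) by exact: measurable_snd.
have m11 : measurable_fun setT (fun p : (RR * RR) * RR => p.1.1).
  exact: (measurableT_comp measurable_fst measurable_fst).
have m12 : measurable_fun setT (fun p : (RR * RR) * RR => p.1.2).
  exact: (measurableT_comp measurable_snd measurable_fst).
have mrot : measurable_fun setT rot.
  have mc := measurableT_comp mcos m2; have ms := measurableT_comp msin m2.
  apply: measurable_fun_pair.
    by apply: measurable_funB; exact: measurable_funM.
  by apply: measurable_funD; exact: measurable_funM.
pose J : set RR := `[0%R, (pi *+ 2)%R]%classic.
have mJ : measurable J by exact: measurable_itv.
pose Fn (p : (RR * RR) * RR) : \bar R := (N (rot p) * \1_J p.2)%:E.
have mF : measurable_fun setT Fn.
  apply/measurable_EFinP; apply: measurable_funM; first exact: measurableT_comp mN mrot.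
  apply: (measurableT_comp _ m2); exact: measurable_indic.
have F0 p : (0 <= Fn p)%E by rewrite lee_fin mulr_ge0.
have muJ : mu J = (pi *+ 2)%:E by rewrite lebesgue_measure_itv /= lte_fin p0 -EFinB subr0.
have tonelli := @fubini_tonelli _ _ _ _ _ plane_measure mu Fn mF F0.
have inner x : (\int[mu]_t Fn (x, t) = \int[mu]_(t in J) (N (rot (x, t)))%:E)%E.
  rewrite [RHS]integral_mkcond; apply: eq_integral => t _; rewrite patchE /Fn indicE.
  by case: (t \in J); rewrite ?mulr1 ?mulr0.
have inner2 x : real_plane disk x ->
    ((pi *+ 2 * normc (h 0) ^+ 2)%:E <= \int[mu]_(t in J) (N (rot (x, t)))%:E)%E.
  move=> xd; have dt t : disk (expi t * (x.1 +i* x.2)).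
    by rewrite unit_disk_rotation.
  have NE t : N (rot (x, t)) = normc (h (expi t * (x.1 +i* x.2))) ^+ 2.
    by rewrite /N patchE mem_set; [rewrite rotE|exact: dt].
  have cn := rotation_continuous hh xd.
  have E : (\int[mu]_(t in J) (N (rot (x, t)))%:E =
     (seg 0 (pi *+ 2) (fun t => normc (h (expi t * (x.1 +i* x.2))) ^+ 2))%:E)%E.
    rewrite /seg /Rintegral fineK; first by apply: eq_integral => t _; rewrite NE.
    apply: integrable_fin_num => //; apply: (@continuous_on_integrable _ _ _
      (fun t => normc (h (expi t * (x.1 +i* x.2))) ^+ 2)) => t _; exact: cn.
  by rewrite E lee_fin; exact: circle_mean_sqr.
have LHS : (((pi *+ 2 * normc (h 0) ^+ 2) * pi)%:E <= \int[mu2]_x \int[mu]_t Fn (x, t))%E.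
  apply: (@le_trans _ _ (\int[mu2]_(x in real_plane disk) (pi *+ 2 * normc (h 0) ^+ 2)%:E)%E).
    by rewrite integral_cst //= mu2_disk EFinM.
  rewrite integral_mkcond; apply: ge0_le_integral => //.
  - move=> x _; rewrite patchE; case: ifP => // _.
    by rewrite lee_fin mulr_ge0 ?sqr_ge0 // ltW.
  - by apply/(measurable_restrictT _ _).1.
  - exact: (@measurable_fun_fubini_tonelli_F _ _ _ _ _ mu Fn mF F0).
  - move=> x _; rewrite patchE; case: ifPn => [|_]; last by apply: integral_ge0.
    by rewrite inE => xd; rewrite inner; exact: inner2.
have rotI t : (\int[mu2]_x (N (rot (x, t)))%:E <= I)%E.
  have := change_of_variables_le (conformal_rotation t) (fun z _ => sqr_ge0 (normc (h z))) chh.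
  rewrite -/I; apply: le_trans.
  rewrite [leRHS]integral_mkcond le_eqVlt; apply/orP; left; apply/eqP.
  apply: eq_integral => x _; rewrite patchE /N patchE.
  have -> : (rot (x, t) \in real_plane disk) = (x \in real_plane disk).
    apply/idP/idP; rewrite !inE /real_plane /= => xd.
      by rewrite -(unit_disk_rotation t).
    have : disk (expi t * (x.1 +i* x.2)) by rewrite unit_disk_rotation.
    by [].
  by case: ifP => // _; rewrite normc_expi expr1n mulr1.
have RHS : (\int[mu]_t \int[mu2]_x Fn (x, t) <= I * (pi *+ 2)%:E)%E.
  rewrite -muJ -integral_cst // [leRHS]integral_mkcond; apply: ge0_le_integral => //.
  - by move=> t _; apply: integral_ge0.
  - exact: (@measurable_fun_fubini_tonelli_G _ _ _ _ _ plane_measure Fn mF F0).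
  - by apply/(measurable_restrictT _ _).1.
  - move=> t _; rewrite patchE.
    have Fe x : Fn (x, t) = (N (rot (x, t)) * (t \in J)%:R)%:E by rewrite /Fn indicE.
    under eq_integral do rewrite Fe; case: (t \in J).
      by under eq_integral do rewrite mulr1; exact: rotI.
    by under eq_integral do rewrite mulr0; rewrite integral0.
have I0 : (0 <= I)%E by apply: integral_ge0 => x _; rewrite lee_fin sqr_ge0.
have L2 : (((pi *+ 2 * normc (h 0) ^+ 2) * pi)%:E <= \int[mu]_t \int[plane_measure]_x Fn (x, t))%E.
  by rewrite -tonelli; exact: LHS.
have := le_trans L2 RHS.
clear RHS rotI; clearbody I; case: I I0 => [r _|_ _|] //; last by rewrite leey.
rewrite -EFinM !lee_fin => H.
rewrite -(ler_pM2l p0); lra.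
Qed.

End AreaMean.

(** * Comparison under conformal maps *)

Section InvariantMetricBounds.
Variable R : realType.
Local Notation C := R[i].
Local Notation disk := (@unit_disk R).
Local Notation V1 := 'rV[R[i]]_1.
Implicit Types (D : set R[i]) (z w a : R[i]).

Definition coord1 (v : V1) : R[i] := v ord0 ord0.
Definition lift1 (z : R[i]) : V1 := const_mx z.

Lemma coord1K z : coord1 (lift1 z) = z. Proof. by rewrite /coord1 mxE. Qed.
Lemma lift1K v : lift1 (coord1 v) = v.
Proof. by apply/rowP => j; rewrite mxE ord1. Qed.

Lemma lift1_scale z : lift1 z = z *: lift1 1.
Proof. by apply/rowP => j; rewrite !mxE mulr1. Qed.

Lemma lift1_diff z : differentiable lift1 z.
Proof.
have -> : lift1 = *:%R^~ (lift1 1) by apply/funext => x; exact: lift1_scale.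
exact: ex_diff.
Qed.

Lemma lift1_dE z h : 'd lift1 z h = lift1 h.
Proof.
have E : lift1 = *:%R^~ (lift1 1) by apply/funext => x; exact: lift1_scale.
rewrite {1}E [RHS]lift1_scale.
by have -> : 'd ( *:%R^~ (lift1 1)) z = *:%R^~ (lift1 1) :> (_ -> _) by exact: diff_val.
Qed.

Lemma coord1_diff v : differentiable coord1 v.
Proof. exact: differentiable_coord. Qed.

Lemma coord1_dE v h : 'd coord1 v h = coord1 h.
Proof.
have @f : {linear V1 -> R[i]}.
  by exists (fun N : V1 => N ord0 ord0); do 2![eexists]; do ?[constructor];
     rewrite ?mxE// => ? *; rewrite ?mxE//; move=> ?; rewrite !mxE.
have E : coord1 = f by [].
rewrite E.
by have -> : 'd f v = f :> (_ -> _) by apply: diff_lin; exact: coord_continuous.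
Qed.

Lemma coord1_cont : continuous coord1.
Proof. by move=> v; exact: differentiable_continuous (coord1_diff v). Qed.

Lemma lift1_cont : continuous lift1.
Proof. by move=> v; exact: differentiable_continuous (lift1_diff v). Qed.

Lemma diff_comp_app (U V W : normedModType R[i]) (f : U -> V) (g : V -> W) x h :
  differentiable f x -> differentiable g (f x) ->
  'd (g \o f) x h = 'd g (f x) ('d f x h).
Proof. by move=> df dg; exact: (congr1 (fun k => k h) (diff_comp df dg)). Qed.

Lemma planar_domain D : is_domain D -> is_domain (planar D).
Proof.
move=> [[z Dz] oD cD]; split.
- by exists (lift1 z); rewrite /planar /= mxE.
- by apply: (open_comp _ oD) => v _; exact: coord1_cont.
- have -> : planar D = lift1 @` D.
    apply/seteqP; split => [v Dv|_ [w Dw <-]]; last by rewrite /planar /= mxE.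
    by exists (coord1 v) => //; exact: lift1K.
  by apply: connected_continuous_connected => //; apply: continuous_subspaceT; exact: lift1_cont.
Qed.

(** The disk is the union of its radii, which share [0]. *)
Lemma unit_disk_connected : connected disk.
Proof.
have -> : disk = \bigcup_(z in disk) ((fun t : R => t%:C * z) @` `[0, 1]).
  apply/seteqP; split => [z zd|_ [z zd] [t + <-]].
    by exists z => //; exists 1; rewrite /= ?in_itv /= ?ler01 ?lexx // mul1r.
  rewrite /= in_itv /= => /andP[t0 t1]; rewrite /unit_disk /= normcM normcR ger0_norm //.
  by apply: le_lt_trans zd; rewrite ler_piMl ?normc_ge0.
apply: bigcup_connected.
  exists 0 => z zd; exists 0; rewrite /= ?in_itv /= ?ler01 ?lexx // mul0r //.
move=> z zd; apply: connected_continuous_connected; first exact: segment_connected.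
apply: continuous_subspaceT => t A /nbhs_normcP[d d0 dA].
apply/real_nbhsP; exists (d / (normc z + 1)).
  by rewrite divr_gt0 // ltr_wpDl ?normc_ge0.
have n0 := normc_ge0 z; move=> s; rewrite ltr_pdivlMr ?ltr_wpDl // => h.
apply: dA; rewrite -mulrBl -rmorphB /= normcM normcR; have := normr_ge0 (s - t); nra.
Qed.

Lemma unit_disk_domain : is_domain disk.
Proof.
split; [exists 0|exact: open_unit_disk|exact: unit_disk_connected].
by rewrite /unit_disk /= expr0n addr0 sqrtr0.
Qed.

Lemma unit_disk0 : disk 0.
Proof. by rewrite /unit_disk /= expr0n addr0 sqrtr0. Qed.

Definition lift_fun (g : R[i] -> R[i]) : V1 -> V1 := lift1 \o (g \o coord1).

Lemma lift_fun_diff g v a : cderiv g (coord1 v) a ->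
  differentiable (lift_fun g) v /\ forall h, 'd (lift_fun g) v h = lift1 (coord1 h * a).
Proof.
move=> ga; have dg := cderiv_diff ga; have dc := coord1_diff v.
have dgc : differentiable (g \o coord1) v := differentiable_comp dc dg.
have dl := lift1_diff ((g \o coord1) v).
split; first exact: differentiable_comp.
move=> h; have -> : 'd (lift_fun g) v h = 'd lift1 _ ('d (g \o coord1) v h) := diff_comp_app h dgc dl.
rewrite lift1_dE; congr lift1.
have -> : 'd (g \o coord1) v h = 'd g _ ('d coord1 v h) := diff_comp_app h dc dg.
by rewrite coord1_dE (cderiv_dE _ ga).
Qed.

Lemma kobayashi_disk_le (x : R[i]) : x != 0 ->
  kobayashi (planar disk) (lift1 0) (lift1 x) <= normc x.
Proof.
move=> x0; have n0 : 0 < normc x by rewrite normc_gt0.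
apply: ge_inf; first by exists 0 => y [/ltW].
split => //; pose c := x / (normc x)%:C.
have nc : normc c = 1.
  by rewrite /c normcM normcV normcR ger0_norm ?divff ?gt_eqF // ltW.
have nx : (normc x)%:C != 0 by rewrite -normc_eq0 normcR normr_eq0 gt_eqF.
have hc w : cderiv (fun w => w * c) w c.
  by have := cderivM (cderiv_id w) (cderiv_cst w c); rewrite mulr1 mulr0 add0r.
have df w : differentiable (lift1 \o (fun w => w * c)) w.
  by apply: differentiable_comp; [exact: cderiv_diff (hc w)|exact: lift1_diff].
exists (lift1 \o (fun w => w * c)); split.
- by move=> w _; exact: df.
- by move=> w wd; rewrite /planar /= mxE /unit_disk /= normcM nc mulr1.
- by rewrite /= mul0r.
- rewrite diff_comp_app; [|exact: cderiv_diff (hc 0)|exact: lift1_diff].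
  rewrite lift1_dE (cderiv_dE _ (hc 0)) mul1r.
  by rewrite [in RHS]lift1_scale lift1_scale scalerA /c mulrC divfK.
Qed.

(** The competitor is the coordinate itself; the content is that the supremum is taken over a
    bounded set. *)
Lemma caratheodory_disk_ge (x : R[i]) :
  normc x <= caratheodory (planar disk) (lift1 0) (lift1 x).
Proof.
apply: ub_le_sup; last first.
  exists coord1; split.
  - by move=> v _; exact: coord1_diff.
  - by move=> v.
  - exact: coord1K.
  - by rewrite coord1_dE coord1K.
(* [cauchy_bound] on the radius [1 / 2] with [M = 1] bounds the derivative by 4; any finite bound
   serves here. *)
exists (4 * normc x) => _ [f [hf fd f0 ->]].
have df w : disk w -> differentiable f (lift1 w).
  by move=> wd; apply: hf; rewrite /planar /= mxE.
have hfl w : disk w -> cderiv (f \o lift1) w ('d (f \o lift1) w 1).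
  move=> wd; apply: diff_cderiv; apply: differentiable_comp; [exact: lift1_diff|exact: df].
have d12 w : normc w <= 2^-1 -> disk w.
  by move=> h; apply: le_lt_trans h _; lra.
have h2 : 0 < 2^-1 :> R by lra.
have := @cauchy_bound R (f \o lift1) _ 1 2^-1 h2 f0 (hfl 0 unit_disk0).
have D1 : 'd f (lift1 0) (lift1 x) = x * 'd (f \o lift1) 0 1.
  rewrite (diff_comp_app _ (lift1_diff 0) (df _ unit_disk0)).
  by rewrite lift1_dE (lift1_scale x) linearZ.
move=> H; rewrite D1 normcM mulrC; apply: ler_wpM2r; first exact: normc_ge0.
apply: le_trans (H _ _) _; last by lra.
- by move=> w /d12 wd; eexists; exact: (hfl w wd).
- by move=> w /d12 wd; apply: ltW; apply: fd; rewrite /planar /= mxE.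
Qed.

(** The differential of [G] at the centre sends the vector [1 / a] to [1]; monotonicity then reduces
    the claim to the Kobayashi metric of the disk at its centre. *)
Lemma metric_upper (F : metric_family R) D (G : R[i] -> R[i]) a : invariant_metric F ->
  is_domain D -> (forall w, disk w -> exists b, cderiv G w b) ->
  (forall w, disk w -> D (G w)) -> cderiv G 0 a -> a != 0 ->
  planar_metric F D (G 0) <= (normc a)^-1.
Proof.
move=> iF dD hG GD Ga a0.
have pd := planar_domain unit_disk_domain; have pD := planar_domain dD.
have lz : planar disk (lift1 0) by rewrite /planar /= mxE; exact: unit_disk0.
have := @invariant_metric_decreasing R F iF 1 1 (planar disk) (planar D) (lift_fun G) (lift1 0)
  (lift1 a^-1) isT isT pd pD.
have Ga' : cderiv G (coord1 (lift1 0)) a by rewrite coord1K.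
have [_ ->] := lift_fun_diff Ga'; rewrite coord1K mulVf //.
have -> : lift_fun G (lift1 0) = lift1 (G 0) by rewrite /lift_fun /= coord1K.
move=> H; apply: le_trans (H _ _ lz) _.
- move=> v vd; have [b hb] := hG _ vd.
  by have [] := lift_fun_diff hb.
- by move=> v vd; rewrite /planar /= mxE; exact: GD.
have [-> _] := invariant_metric_disk iF (lift1 a^-1) lz.
by rewrite -normcV; apply: kobayashi_disk_le; rewrite invr_eq0.
Qed.

Lemma metric_lower (F : metric_family R) D (H : R[i] -> R[i]) z a : invariant_metric F ->
  is_domain D -> (forall w, D w -> exists b, cderiv H w b) ->
  (forall w, D w -> disk (H w)) -> D z -> H z = 0 -> cderiv H z a ->
  normc a <= planar_metric F D z.
Proof.
move=> iF dD hH HD Dz Hz Ha.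
have pd := planar_domain unit_disk_domain; have pD := planar_domain dD.
have lz : planar D (lift1 z) by rewrite /planar /= mxE.
have := @invariant_metric_decreasing R F iF 1 1 (planar D) (planar disk) (lift_fun H) (lift1 z)
  (lift1 1) isT isT pD pd.
have Ha' : cderiv H (coord1 (lift1 z)) a by rewrite coord1K.
have [_ ->] := lift_fun_diff Ha'; rewrite coord1K mul1r.
have -> : lift_fun H (lift1 z) = lift1 0 by rewrite /lift_fun /= coord1K Hz.
move=> K; apply: le_trans (K _ _ lz).
- have l0 : planar disk (lift1 0) by rewrite /planar /= mxE; exact: unit_disk0.
  have [_ ->] := invariant_metric_disk iF (lift1 a) l0.
  exact: caratheodory_disk_ge.
- move=> v vd; have [b hb] := hH _ vd.
  by have [] := lift_fun_diff hb.
- by move=> v vd; rewrite /planar /= mxE; exact: HD.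
Qed.

End InvariantMetricBounds.

(** * The same two bounds for the Bergman kernel *)

Section BergmanBounds.
Variable R : realType.
Notation mu := (@lebesgue_measure R).
Notation mu2 := (mu \x mu)%E.
Local Notation RR := (measurableTypeR R).
Local Notation disk := (@unit_disk R).
Implicit Types (D W : set R[i]) (f : R[i] -> R[i]).

Definition sqr_mass D f : \bar R :=
  (\int[mu2]_(x in real_plane D) (normc (f (x.1 +i* x.2)) ^+ 2)%:E)%E.

Lemma sqr_mass_ge0 D f : (0 <= sqr_mass D f)%E.
Proof. by apply: integral_ge0 => x _; rewrite lee_fin sqr_ge0. Qed.

Lemma holomorphic_rcont_sqr D f z : holomorphic_on D f -> D z ->
  rcont (fun w => normc (f w) ^+ 2) z.
Proof.
move=> /holomorphic_onP hf /hf[a /rcont_normc h]; exact: rcontM.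
Qed.

Lemma measurable_sqr D f : open D -> holomorphic_on D f ->
  measurable_fun (real_plane D : set (RR * RR)) (fun x => normc (f (x.1 +i* x.2)) ^+ 2).
Proof.
move=> oD hf; apply: (@measurable_continuous _ _ (fun z => normc (f z) ^+ 2)) => // z Dz.
exact: holomorphic_rcont_sqr hf Dz.
Qed.

Lemma integrable_sqr D f : open D -> bergman_space D f ->
  mu2.-integrable (real_plane D) (fun x => (normc (f (x.1 +i* x.2)) ^+ 2)%:E).
Proof.
move=> oD [hf fin]; apply/integrableP; split; first by apply/measurable_EFinP; exact: measurable_sqr.
apply: le_lt_trans fin; rewrite le_eqVlt; apply/orP; left; apply/eqP.
by apply: eq_integral => x _; rewrite gee0_abs // lee_fin sqr_ge0.
Qed.

(** The kernel reproduces itself: at [B ^~ z] the formula says that [B z z] is the integral of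
    [|B w z|^2] over [w]. *)
Lemma bergman_diagE D B z : open D -> is_bergman_kernel D B -> D z ->
  B z z = (Re (B z z))%:C /\ sqr_mass D (B ^~ z) = (Re (B z z))%:E.
Proof.
move=> oD hB Dz; have [kA rep] := hB _ Dz.
have E := rep _ kA.
have cE w : B w z * conjc (B w z) = (normc (B w z) ^+ 2)%:C by exact: mulc_conj.
have mE : (fine (sqr_mass D (B ^~ z)))%:C = B z z.
  rewrite E /area_integral /sqr_mass; apply: complexP => /=.
    by rewrite /Rintegral; congr fine; apply: eq_integral => x _; rewrite cE.
  rewrite (_ : (fun x => _) = (fun=> 0)); last by apply/funext => x; rewrite cE.
  by rewrite Rintegral_cst ?mul0r //; exact: measurable_open.
have fin : sqr_mass D (B ^~ z) \is a fin_num.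
  by rewrite ge0_fin_numE ?sqr_mass_ge0 //; case: kA.
by rewrite -mE /=; split => //; rewrite fineK.
Qed.

(** With [h w = B (G w) z * dG w], the mean value inequality and the change of variables bound
    [pi |h 0|^2] by the mass of [B ^~ z] on [W], hence by [B z z]. Since [h 0 = B z z * dG 0], one
    factor [B z z] cancels. *)
Lemma bergman_upper D B W G F dG : open D -> is_bergman_kernel D B ->
  conformal disk W G F dG -> W `<=` D ->
  bergman_diag B (G 0) <= (normc (dG 0))^-1.
Proof.
move=> oD hB cG WD.
have d0 : disk 0 by rewrite /unit_disk /= expr0n addr0 sqrtr0.
have Dz : D (G 0) by apply: WD; exact: (conf_maps cG).
have [kA _] := hB _ Dz; have [Bz mB] := bergman_diagE oD hB Dz.
set z := G 0 in Dz kA Bz mB *; set beta := Re (B z z) in Bz mB *.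
have [hk _] := kA; have hkP := (holomorphic_onP _ _).1 hk.
pose h w := B (G w) z * dG w.
have hh w : disk w -> exists a, cderiv h w a.
  move=> wd; have [a ha] := hkP _ (WD _ (conf_maps cG wd)).
  have [b hb] := conf_deriv_holo cG wd.
  by eexists; exact: (cderivM (cderiv_comp (conf_deriv cG wd) ha) hb).
have A1 := area_mean hh.
have A2 := change_of_variables_le cG (fun z _ => sqr_ge0 (normc (B z (G 0))))
  (fun y Wy => holomorphic_rcont_sqr hk (WD _ Wy)).
have A3 : (\int[mu2]_(x in real_plane W) (normc (B (x.1 +i* x.2) (G 0)) ^+ 2)%:E <= beta%:E)%E.
  rewrite -mB; apply: ge0_subset_integral.
  - by apply: measurable_open; exact: conf_openW cG.
  - exact: measurable_open.
  - by apply/measurable_EFinP; exact: (measurable_sqr oD hk).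
  - by move=> x _; rewrite lee_fin sqr_ge0.
  - by move=> x Wx; exact: WD.
have : ((pi * normc (h 0) ^+ 2)%:E <= beta%:E)%E.
  apply: le_trans A1 (le_trans _ (le_trans A2 A3)).
  rewrite le_eqVlt; apply/orP; left; apply/eqP; apply: eq_integral => x _.
  by rewrite /h normcM exprMn.
rewrite lee_fin /h -/z Bz normcM normcR exprMn real_normK ?num_real // => K.
have [n0 _] := conf_inv_deriv cG (conf_maps cG d0).
rewrite (conf_K cG d0) in n0.
have a0 : 0 < normc (dG 0) by rewrite normc_gt0.
set a := normc (dG 0) in a0 K *.
have p0 := pi_gt0 R.
have b0 : 0 <= beta by rewrite -lee_fin -mB sqr_mass_ge0.
rewrite /bergman_diag -/beta.
have ai : 0 <= a^-1 by rewrite invr_ge0 ltW.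
rewrite -(ger0_norm ai) -sqrtr_sqr ler_wsqrtr //.
have [->|bn0] := eqVneq beta 0; first by rewrite mulr0 sqr_ge0.
have bp : 0 < beta by rewrite lt_def bn0.
rewrite exprVn -[leRHS]mul1r ler_pdivlMr ?exprn_gt0 //.
by rewrite -(ler_pM2r bp) mul1r; apply: le_trans K; rewrite le_eqVlt; apply/orP; left; apply/eqP; ring.
Qed.

(** The test function [dH / dH z] equals [1] at [z] and has squared norm at most [pi / |dH z|^2],
    because the image of [H] lies in the disk. Pairing it with the kernel bounds [B z z] from
    below. *)
Lemma bergman_lower D B W H F dH z : open D -> is_bergman_kernel D B ->
  conformal D W H F dH -> W `<=` disk -> D z ->
  normc (dH z) <= bergman_diag B z.
Proof.
move=> oD hB cH Wd Dz; have [kA rep] := hB _ Dz.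
have [Bz mB] := bergman_diagE oD hB Dz; set beta := Re (B z z) in Bz mB *.
have [n0 _] := conf_inv_deriv cH (conf_maps cH Dz); rewrite (conf_K cH Dz) in n0.
have a0 : 0 < normc (dH z) by rewrite normc_gt0.
set a := normc (dH z) in a0 *; have p0 := pi_gt0 R.
pose f w := dH w / dH z.
have hdH : holomorphic_on D dH by apply/holomorphic_onP => w Dw; exact: (conf_deriv_holo cH).
have hf : holomorphic_on D f.
  apply/holomorphic_onP => w Dw; have [b hb] := conf_deriv_holo cH Dw.
  by eexists; apply: (cderivM hb); exact: cderiv_cst.
have mD : measurable (real_plane D : set (RR * RR)) by exact: measurable_open.
have mdH : (sqr_mass D dH <= (pi : R)%:E)%E.
  have ck y : W y -> rcont (fun=> 1) y by move=> _ e e0; exists 1 => // w _; rewrite subrr normr0.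
  have A := change_of_variables_le cH (fun y _ => ler01) ck.
  apply: le_trans (le_trans A _).
    by rewrite /sqr_mass le_eqVlt; apply/orP; left; apply/eqP; apply: eq_integral => x _; rewrite mul1r.
  have mW : measurable (real_plane W : set (RR * RR)) by apply: measurable_open; exact: conf_openW cH.
  have mdisk : measurable (real_plane disk : set (RR * RR)) by apply: measurable_open; exact: open_unit_disk.
  rewrite integral_cst // mul1e -mu2_disk; apply: le_measure; rewrite ?inE //.
  by move=> x Wx; exact: Wd.
have fE x : (normc (f x) ^+ 2)%:E = ((a ^- 2)%:E * (normc (dH x) ^+ 2)%:E)%E.
  by rewrite -EFinM /f normcM normcV -/a exprMn mulrC exprVn.
have mdHf : measurable_fun (real_plane D : set (RR * RR)) (fun x => (normc (dH (x.1 +i* x.2)) ^+ 2)%:E).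
  by apply/measurable_EFinP; exact: measurable_sqr.
have mf : (sqr_mass D f <= (pi / a ^+ 2)%:E)%E.
  rewrite /sqr_mass; under eq_integral do rewrite fE.
  rewrite ge0_integralZl //; last 2 first.
  - by move=> x _; rewrite lee_fin sqr_ge0.
  - by rewrite lee_fin invr_ge0 sqr_ge0.
  rewrite mulrC EFinM; apply: lee_wpmul2l => //.
  by rewrite lee_fin invr_ge0 sqr_ge0.
have fA : bergman_space D f.
  by split => //; apply: le_lt_trans mf _; exact: ltry.
have := rep _ fA; have -> : f z = 1 by rewrite /f divff.
move=> /(congr1 (@complex.Re R)) /= E1.
(* In place of Cauchy-Schwarz, [s t <= s^2 / (2 N) + N t^2 / 2] holds pointwise. With [N] the bound
   on the squared norm of [f], integration gives [1 <= 1 / 2 + N beta / 2]. *)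
pose N := pi / a ^+ 2; have N0 : 0 < N by rewrite divr_gt0 // exprn_gt0.
pose r (x : R * R) := Re (f (x.1 +i* x.2) * conjc (B (x.1 +i* x.2) z)).
pose u (x : R * R) := N^-1 / 2 * normc (f (x.1 +i* x.2)) ^+ 2 + N / 2 * normc (B (x.1 +i* x.2) z) ^+ 2.
have [kh _] := kA.
have rle x : `|r x| <= u x.
  apply: le_trans (Re_le_normc _) _; rewrite normcM normc_conj /u.
  set s := normc (f _); set t := normc (B _ _).
  have -> : N^-1 / 2 * s ^+ 2 + N / 2 * t ^+ 2 = s * t + N^-1 / 2 * (s - N * t) ^+ 2.
    by field; rewrite gt_eqF.
  by rewrite lerDl mulr_ge0 ?sqr_ge0 // divr_ge0 // invr_ge0 ltW.
have i1 := integrable_sqr oD fA; have i2 := integrable_sqr oD kA.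
have iu : mu2.-integrable (real_plane D) (EFin \o u).
  have j1 := integrableZl mD (N^-1 / 2) i1; have j2 := integrableZl mD (N / 2) i2.
  have := integrableD mD j1 j2; apply: eq_integrable => //.
have ir : mu2.-integrable (real_plane D) (EFin \o r).
  apply: (le_integrable mD _ _ iu).
    apply/measurable_EFinP; apply: (@measurable_continuous _ _ (fun w => Re (f w * conjc (B w z)))) => // w Dw.
    have [b hb] := (holomorphic_onP _ _).1 hf _ Dw.
    have [c hc] := (holomorphic_onP _ _).1 kh _ Dw.
    have R1 := rcontM (rcont_Re hb) (rcont_Re hc).
    have R2 := rcontM (rcont_Im hb) (rcont_Im hc).
    move=> e e0; have e2 : 0 < e / 2 by lra.
    have [d1 d10 H1] := R1 _ e2; have [d2 d20 H2] := R2 _ e2.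
    exists (Num.min d1 d2); first by rewrite lt_min d10.
    move=> v; rewrite lt_min => /andP[/H1 + /H2].
    have cRe (p q : R[i]) : Re (p * conjc q) = Re p * Re q + Im p * Im q.
      by rewrite Re_mul; case: q => q1 q2 /=; ring.
    rewrite !cRe !ltr_norml; lra.
  by move=> x _ /=; rewrite lee_fin (ger0_norm (le_trans (normr_ge0 _) (rle x))).
have L : 1 <= \int[mu2]_(x in real_plane D) u x.
  rewrite E1; apply: le_Rintegral => // x _.
  exact: le_trans (ler_norm _) (rle x).
have U : ((\int[mu2]_(x in real_plane D) u x)%:E <= (2^-1 + N / 2 * beta)%:E)%E.
  rewrite /Rintegral fineK; last exact: integrable_fin_num.
  have -> : (\int[mu2]_(x in real_plane D) (u x)%:E = \int[mu2]_(x in real_plane D)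
     ((N^-1 / 2)%:E * (normc (f (x.1 +i* x.2)) ^+ 2)%:E +
      (N / 2)%:E * (normc (B (x.1 +i* x.2) z) ^+ 2)%:E))%E.
    by apply: eq_integral => x _; rewrite -!EFinM -EFinD.
  have c1 : (0 <= (N^-1 / 2)%:E :> \bar R)%E by rewrite lee_fin divr_ge0 // invr_ge0 ltW.
  have c2 : (0 <= (N / 2)%:E :> \bar R)%E by rewrite lee_fin divr_ge0 // ltW.
  have m1 : measurable_fun (real_plane D : set (RR * RR)) (fun x => (normc (f (x.1 +i* x.2)) ^+ 2)%:E).
    by apply/measurable_EFinP; exact: measurable_sqr.
  have m2 : measurable_fun (real_plane D : set (RR * RR)) (fun x => (normc (B (x.1 +i* x.2) z) ^+ 2)%:E).
    by apply/measurable_EFinP; exact: (measurable_sqr oD kh).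
  have q1 (x : R * R) : (0 <= (normc (f (x.1 +i* x.2)) ^+ 2)%:E)%E by rewrite lee_fin sqr_ge0.
  have q2 (x : R * R) : (0 <= (normc (B (x.1 +i* x.2) z) ^+ 2)%:E)%E by rewrite lee_fin sqr_ge0.
  rewrite ge0_integralD //; last 4 first.
  - by move=> x _; exact: mule_ge0.
  - exact: measurable_funeM.
  - by move=> x _; exact: mule_ge0.
  - exact: measurable_funeM.
  rewrite !ge0_integralZl // -/(sqr_mass D f) -/(sqr_mass D (B ^~ z)) mB EFinD EFinM.
  apply: leeD => //; apply: le_trans (lee_wpmul2l c1 mf) _.
  rewrite -EFinM lee_fin -/N le_eqVlt; apply/orP; left; apply/eqP; field.
  by rewrite gt_eqF.
have K : 1 <= N * beta.
  rewrite lee_fin in U; have K0 := le_trans L U; clear -K0; lra.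
have K2 : a ^+ 2 <= pi * beta.
  by move: K; rewrite /N mulrAC ler_pdivlMr ?exprn_gt0 // mul1r.
rewrite /bergman_diag -/beta -(ger0_norm (ltW a0)) -sqrtr_sqr.
exact: ler_wsqrtr.
Qed.

End BergmanBounds.

(** * Affine, Joukowski and Moebius maps *)

Section ExplicitMaps.
Variable R : realType.
Local Notation disk := (@unit_disk R).
Implicit Types (U W D : set R[i]) (z w v c t A : R[i]).

Definition left_half (m : R) : set R[i] := [set w | Re w < - m].

Lemma left_half_open m : open (left_half m).
Proof.
apply/open_normcP => z zm; exists (- m - Re z); first by rewrite subr_gt0.
move=> w h; rewrite /left_half /=.
have := le_lt_trans (Re_le_normc _) h; rewrite Re_add Re_opp ltr_norml; lra.
Qed.

Lemma open_preimage U (f : R[i] -> R[i]) W : open U -> open W ->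
  (forall z, U z -> exists a, cderiv f z a) -> open [set z | U z /\ W (f z)].
Proof.
move=> /open_normcP oU /open_normcP oW hf; apply/open_normcP => z [Uz Wz].
have [d d0 dU] := oU _ Uz; have [e e0 eW] := oW _ Wz.
have [a /cderiv_cont/continuous_normcP/(_ _ e0)[d1 d10 dF]] := hf _ Uz.
exists (Num.min d d1); first by rewrite lt_min d0.
by move=> w; rewrite lt_min => /andP[/dU ? /dF /eW].
Qed.

Lemma conformal_affine U c t : open U -> c != 0 ->
  conformal U [set y | U (c^-1 * (y - t))] (fun z => c * z + t) (fun y => c^-1 * (y - t)) (fun=> c).
Proof.
move=> oU c0.
have d1 z : cderiv (fun z => c * z + t) z c.
  by have := cderivD (cderivM (cderiv_cst z c) (cderiv_id z)) (cderiv_cst z t); rewrite mulr1 mulr0 !addr0.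
have d2 y : cderiv (fun y => c^-1 * (y - t)) y c^-1.
  have := cderivM (cderiv_cst y c^-1) (cderivD (cderiv_id y) (cderiv_cst y (- t))).
  by rewrite addr0 mulr1 mulr0 addr0.
split => //.
- rewrite (_ : [set y | _] = [set y | setT y /\ U (c^-1 * (y - t))]); last first.
    by apply/seteqP; split => y /=; [|case].
  by apply: open_preimage (@openT R[i]) oU _ => z _; eexists; exact: d2.
- by move=> x Ux /=; rewrite addrK mulKf.
- by move=> x _; rewrite addrK mulKf.
- by move=> y _; rewrite mulVKf // subrK.
- by move=> x _; eexists; exact: cderiv_cst.
- by move=> y _; eexists; exact: d2.
Qed.

Lemma cderiv_invn2 z : z != 0 -> exists a, cderiv (fun z => - z ^- 2) z a.
Proof.
move=> z0; eexists; apply: cderivN; apply: (@cderivV _ (fun z => z ^+ 2)).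
  by rewrite expf_neq0.
exact: (cderivM (cderiv_id z) (cderiv_id z)).
Qed.

Lemma conformal_inv U : open U -> (forall z, U z -> z != 0) ->
  conformal U [set y | y != 0 /\ U y^-1] (fun z => z^-1) (fun y => y^-1) (fun z => - z ^- 2).
Proof.
move=> oU U0.
have o0 : open [set y : R[i] | y != 0].
  apply/open_normcP => y y0; exists (normc y); first by rewrite normc_gt0.
  by move=> w; apply: contraTneq => ->; rewrite sub0r normcN ltxx.
split => //.
- apply: (open_preimage o0 oU) => z z0; eexists; exact: cderiv_inv.
- by move=> x Ux /=; rewrite invr_eq0 invrK; split; [exact: U0|].
- by move=> x _; rewrite invrK.
- by move=> y [].
- by move=> y _; rewrite invrK.
- by move=> x Ux; apply: cderiv_inv; exact: U0.
- by move=> x Ux; apply: cderiv_invn2; exact: U0.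
- by move=> y [y0 _]; eexists; exact: cderiv_inv.
Qed.

(** * The map [v + A + c / v] on a half-plane *)

Section Joukowski.
Variables (U : set R[i]) (m : R) (A c : R[i]).
Hypothesis m0 : 0 < m.
Hypothesis oU : open U.
Hypothesis UH : U `<=` left_half m.
Hypothesis cm : normc c <= m ^+ 2 / 2.

Definition joukowski v := v + A + c / v.
Definition joukowski_deriv v := 1 - c / v ^+ 2.

Lemma left_half_normc v : left_half m v -> m < normc v.
Proof.
rewrite /left_half /= => h; have mp := m0; have h1 : Re v < 0 by lra.
have h2 : m < - Re v by lra.
apply: lt_le_trans (Re_le_normc v).
by rewrite ltr0_norm.
Qed.

Lemma left_half_neq0 v : left_half m v -> v != 0.
Proof. by move=> /left_half_normc h; rewrite -normc_gt0; exact: lt_trans m0 h. Qed.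

Lemma quot_le_half (a b : R[i]) : left_half m a -> left_half m b -> normc (c / (a * b)) <= 2^-1.
Proof.
move=> /left_half_normc ha /left_half_normc hb; have mp := m0; have cm' := cm.
have ab : 0 < normc a * normc b by rewrite mulr_gt0 //; lra.
rewrite normcM normcV normcM ler_pdivrMr //; nra.
Qed.

Lemma joukowskiB (a b : R[i]) : a != 0 -> b != 0 -> joukowski a - joukowski b = (a - b) * (1 - c / (a * b)).
Proof. by move=> a0 b0; rewrite /joukowski; field; rewrite a0 b0. Qed.

(** The difference is [(a - b) (1 - c / (a b))], and [|c / (a b)| <= 1 / 2] since [|a|] and [|b|]
    exceed [m]. Injectivity and the differentiability of the inverse both rest on this. *)
Lemma joukowski_expand (a b : R[i]) : left_half m a -> left_half m b ->
  normc (a - b) <= 2 * normc (joukowski a - joukowski b).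
Proof.
move=> ha hb; rewrite joukowskiB ?left_half_neq0 // normcM.
have := ler_normcB 1 (c / (a * b)); have := quot_le_half ha hb; rewrite normc1.
have := normc_ge0 (a - b); nra.
Qed.

Lemma joukowski_deriv_neq0 v : left_half m v -> joukowski_deriv v != 0.
Proof.
move=> hv; rewrite -normc_gt0 /joukowski_deriv expr2.
have := ler_normcB 1 (c / (v * v)); have := quot_le_half hv hv; rewrite normc1; lra.
Qed.

Lemma cderiv_joukowski v : v != 0 -> cderiv joukowski v (joukowski_deriv v).
Proof.
move=> v0; have := cderivD (cderivD (cderiv_id v) (cderiv_cst v A))
   (cderivM (cderiv_cst v c) (cderiv_inv v0)).
by rewrite addr0 mulr0 addr0 mulrN.
Qed.

Lemma joukowski_root v y : v != 0 -> v ^+ 2 - (y - A) * v + c = 0 -> joukowski v = y.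
Proof.
move=> v0 h; have E : c = (y - A) * v - v ^+ 2.
  by apply/eqP; rewrite -subr_eq0 -h; apply/eqP; ring.
by rewrite /joukowski E; field.
Qed.

Lemma quadratic_roots y : exists v1 v2, [/\ v1 + v2 = y - A, v1 * v2 = c,
  v1 ^+ 2 - (y - A) * v1 + c = 0 & v2 ^+ 2 - (y - A) * v2 + c = 0].
Proof.
pose s := sqrtc ((y - A) ^+ 2 - 4 * c).
have s2 : s ^+ 2 = (y - A) ^+ 2 - 4 * c by exact: sqr_sqrtc.
have E : (y - A + s) / 2 * ((y - A - s) / 2) = c.
  have -> : (y - A + s) / 2 * ((y - A - s) / 2) = ((y - A) ^+ 2 - s ^+ 2) / 4 by field.
  by rewrite s2; field.
exists ((y - A + s) / 2), ((y - A - s) / 2); split => //.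
- by field.
- by rewrite -[X in _ + X]E; field.
- by rewrite -[X in _ + X]E; field.
Qed.

(** The two preimages of [y] satisfy [(u - v1) (u - v2) = u (joukowski u - y)]. If [y] is within
    [d^2 / (|u| + 1)] of [joukowski u], one of them is within [d] of [u]. *)
Lemma joukowski_open : open (joukowski @` U).
Proof.
apply/open_normcP => _ [u Uu <-].
have [d d0 dU] := (open_normcP _).1 oU _ Uu.
have nu := normc_ge0 u.
exists (d ^+ 2 / (normc u + 1)); first by rewrite divr_gt0 ?exprn_gt0 //; lra.
move=> y; rewrite ltr_pdivlMr; last by lra.
move=> hy; have u0 : u != 0 by exact: left_half_neq0 (UH Uu).
have [v1 [v2 [sm pr r1 r2]]] := quadratic_roots y.
have K : (u - v1) * (u - v2) = u * (joukowski u - y).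
  have -> : (u - v1) * (u - v2) = u ^+ 2 - (v1 + v2) * u + v1 * v2 by ring.
  by rewrite sm pr /joukowski; field.
have n1 := normc_ge0 (u - v1); have n2 := normc_ge0 (u - v2).
have n3 := normc_ge0 (y - joukowski u).
have NK : normc (u - v1) * normc (u - v2) = normc u * normc (y - joukowski u).
  by rewrite -normcM K normcM [normc (joukowski u - _)]normcB.
have fin v : normc (u - v) < d -> v ^+ 2 - (y - A) * v + c = 0 -> (joukowski @` U) y.
  rewrite normcB => /dU Uv h; exists v => //; apply: joukowski_root => //.
  exact: left_half_neq0 (UH Uv).
have [h1|h1] := ltP (normc (u - v1)) d; first exact: fin h1 r1.
have [h2|h2] := ltP (normc (u - v2)) d; first exact: fin h2 r2.
by exfalso; nra.
Qed.

Definition joukowski_inv y : R[i] := xget 0 [set v | U v /\ joukowski v = y].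

Lemma joukowski_invP y : (joukowski @` U) y -> U (joukowski_inv y) /\ joukowski (joukowski_inv y) = y.
Proof. by move=> [v Uv vy]; apply: (@xgetPex _ 0 [set v | U v /\ joukowski v = y]); exists v. Qed.

Lemma joukowski_inj (a b : R[i]) : U a -> U b -> joukowski a = joukowski b -> a = b.
Proof.
move=> /UH ha /UH hb ab; have := joukowski_expand ha hb.
rewrite ab subrr normc0 mulr0 => h; apply/eqP; rewrite -subr_eq0 -normc_eq0.
by rewrite eq_le h normc_ge0.
Qed.

Lemma conformal_joukowski : conformal U (joukowski @` U) joukowski joukowski_inv joukowski_deriv.
Proof.
split => //.
- exact: joukowski_open.
- move=> x Ux; have Wx : (joukowski @` U) (joukowski x) by exists x.
  by have [h1 h2] := joukowski_invP Wx; exact: (joukowski_inj h1 Ux h2).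
- by move=> y Wy; have [] := joukowski_invP Wy.
- by move=> y Wy; have [] := joukowski_invP Wy.
- by move=> x /UH /left_half_neq0; exact: cderiv_joukowski.
- move=> x /UH /left_half_neq0 x0; eexists.
  apply: (cderivD (cderiv_cst x 1)); apply: cderivN; apply: (cderivM (cderiv_cst x c)).
  apply: (@cderivV _ (fun x => x ^+ 2)); first by rewrite expf_neq0.
  exact: (cderivM (cderiv_id x) (cderiv_id x)).
- move=> y Wy; have [Uv vy] := joukowski_invP Wy; set v := joukowski_inv y in Uv vy *.
  (* The error of [joukowski] at the preimage [v'] of [w] is relative to [|v' - v|], which is at
     most [2 |w - y|]; this is the origin of both divisions by 2 below. *)
  exists (joukowski_deriv v)^-1 => e e0.
  have n0 : 0 < normc (joukowski_deriv v) by rewrite normc_gt0 joukowski_deriv_neq0 //; exact: UH.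
  have e20 : 0 < e * normc (joukowski_deriv v) / 2 by rewrite divr_gt0 // mulr_gt0.
  have [d d0 dH] := cderiv_joukowski (left_half_neq0 (UH Uv)) e20.
  have [d1 d10 dW] := (open_normcP _).1 joukowski_open _ Wy.
  exists (Num.min (d / 2) d1); first by rewrite lt_min d10 divr_gt0.
  move=> w; rewrite lt_min => /andP[wd /dW Ww].
  have [Uw wE] := joukowski_invP Ww; rewrite -/v; set v' := joukowski_inv w in Uw wE *.
  have ex := joukowski_expand (UH Uw) (UH Uv); rewrite wE vy in ex.
  have := dH v'; rewrite wE vy => h.
  have {}h : normc (w - y - joukowski_deriv v * (v' - v)) <=
      e * normc (joukowski_deriv v) / 2 * normc (v' - v) by apply: h; lra.
  have -> : v' - v - (joukowski_deriv v)^-1 * (w - y) =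
    - ((joukowski_deriv v)^-1 * (w - y - joukowski_deriv v * (v' - v))).
    by field; rewrite -normc_gt0.
  rewrite normcN normcM normcV mulrC ler_pdivrMr //; apply: le_trans h _.
  have n1 := normc_ge0 (w - y); nra.
Qed.

End Joukowski.

(** * Moebius maps between the left half-plane and the disk *)

Section Moebius.
Variable w0 : R[i].
Hypothesis w0H : Re w0 < 0.

(** The pole [- conjc w0] is the reflection of the zero [w0] in the imaginary axis, so the edge of
    the half-plane goes to the unit circle. *)
Definition moebius w := (w - w0) / (w + conjc w0).
Definition moebius_deriv w := (w0 + conjc w0) / (w + conjc w0) ^+ 2.
Definition moebius_inv y := (w0 + conjc w0 * y) / (1 - y).
Definition moebius_inv_deriv y := (w0 + conjc w0) / (1 - y) ^+ 2.

Lemma Re_conjc z : Re (conjc z) = Re z. Proof. by case: z. Qed.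
Lemma Im_conjc z : Im (conjc z) = - Im z. Proof. by case: z. Qed.

Lemma moebius_den w : Re w < 0 -> w + conjc w0 != 0.
Proof.
move=> h; have h0 := w0H; apply/eqP => /(congr1 (@complex.Re R)); rewrite Re_add Re_conjc /=; lra.
Qed.

Lemma disk_den y : disk y -> 1 - y != 0.
Proof.
by rewrite /unit_disk /= subr_eq0; apply: contraTneq => <-; rewrite normc1 ltxx.
Qed.

Lemma Re_div (a b : R[i]) : b != 0 -> Re (a / b) = Re (a * conjc b) / normc b ^+ 2.
Proof.
move=> b0; have n0 : normc b != 0 by rewrite normc_eq0.
rewrite invc_eq mulrA mulrAC; rewrite [LHS]Re_mul /= mulr0 subr0 mulrC; congr (_ * _).
Qed.

(** Both directions are packaged: lower bounds map [D] into the disk, upper bounds map the disk into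
    [D]. *)
Lemma conformal_moebius : conformal (left_half 0) disk moebius moebius_inv moebius_deriv /\
   conformal disk (left_half 0) moebius_inv moebius moebius_inv_deriv.
Proof.
have w0n := w0H; have H0 w : left_half 0 w -> Re w < 0 by rewrite /left_half /= oppr0.
have s0 : w0 + conjc w0 != 0 by exact: moebius_den.
have m1 w : left_half 0 w -> disk (moebius w).
  move=> /H0 h; have d0 := moebius_den h.
  rewrite /unit_disk /= /moebius normcM normcV ltr_pdivrMr ?normc_gt0 // mul1r.
  apply: normc_lt; first exact: normc_ge0.
  by rewrite sqr_normcE !(ReImE, Re_conjc, Im_conjc); nra.
have m2 w : left_half 0 w -> moebius_inv (moebius w) = w.
  move=> /H0 h; have d0 := moebius_den h; rewrite /moebius_inv /moebius.
  have -> : 1 - (w - w0) / (w + conjc w0) = (w0 + conjc w0) / (w + conjc w0) by field.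
  by field; rewrite s0 d0.
have m3 y : disk y -> left_half 0 (moebius_inv y).
  move=> yd; have d0 := disk_den yd; rewrite /left_half /= oppr0 /moebius_inv Re_div //.
  rewrite pmulr_llt0 ?invr_gt0 ?exprn_gt0 ?normc_gt0 //.
  have : normc y ^+ 2 < 1 by rewrite expr_lt1 // normc_ge0.
  rewrite sqr_normcE !(ReImE, Re_conjc, Im_conjc) /= => y1.
  have -> : (Re w0 + (Re w0 * Re y - - Im w0 * Im y)) * (1 - Re y) -
     (Im w0 + (Re w0 * Im y + - Im w0 * Re y)) * - (0 - Im y) =
    Re w0 * (1 - (Re y ^+ 2 + Im y ^+ 2)) by ring.
  by rewrite nmulr_rlt0 // subr_gt0.
have m4 y : disk y -> moebius (moebius_inv y) = y.
  move=> yd; have d0 := disk_den yd; rewrite /moebius_inv /moebius.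
  have -> : (w0 + conjc w0 * y) / (1 - y) + conjc w0 = (w0 + conjc w0) / (1 - y) by field.
  by field; rewrite s0 d0.
have d1 w : left_half 0 w -> cderiv moebius w (moebius_deriv w).
  move=> /H0 h; have d0 := moebius_den h.
  have := cderivM (cderivD (cderiv_id w) (cderiv_cst w (- w0)))
    (cderivV (f := fun w => w + conjc w0) d0 (cderivD (cderiv_id w) (cderiv_cst w (conjc w0)))).
  by rewrite (_ : _ + _ = moebius_deriv w) // /moebius_deriv; field.
have d2 w : left_half 0 w -> exists a, cderiv moebius_deriv w a.
  move=> /H0 h; have d0 := moebius_den h; eexists; apply: (cderivM (cderiv_cst w _)).
  apply: (@cderivV _ (fun w => (w + conjc w0) ^+ 2)); first by rewrite expf_neq0.
  have k := cderivD (cderiv_id w) (cderiv_cst w (conjc w0)); exact: (cderivM k k).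
have d3 y : disk y -> cderiv moebius_inv y (moebius_inv_deriv y).
  move=> yd; have d0 := disk_den yd.
  have k := cderivD (cderiv_cst y 1) (cderivN (cderiv_id y)).
  have := cderivM (cderivD (cderiv_cst y w0) (cderivM (cderiv_cst y (conjc w0)) (cderiv_id y)))
    (cderivV (f := fun y => 1 - y) d0 k).
  by rewrite (_ : _ + _ = moebius_inv_deriv y) // /moebius_inv_deriv; field.
have d4 y : disk y -> exists a, cderiv moebius_inv_deriv y a.
  move=> yd; have d0 := disk_den yd; eexists; apply: (cderivM (cderiv_cst y _)).
  apply: (@cderivV _ (fun y => (1 - y) ^+ 2)); first by rewrite expf_neq0.
  have k := cderivD (cderiv_cst y 1) (cderivN (cderiv_id y)); exact: (cderivM k k).
have oH := @left_half_open 0; have oD := @open_unit_disk R.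
split; split => //.
- by move=> y yd; eexists; exact: d3.
- by move=> y yd; eexists; exact: d1.
Qed.

Lemma normc_addconj z : normc (z + conjc z) = 2 * `|Re z|.
Proof.
have -> : z + conjc z = (2 * Re z)%:C.
  by apply: complexP; case: z => a b /=; ring.
by rewrite normcR normrM ger0_norm.
Qed.

Lemma moebius_w0 : moebius w0 = 0.
Proof. by rewrite /moebius subrr mul0r. Qed.

Lemma moebius_inv0 : moebius_inv 0 = w0.
Proof. by rewrite /moebius_inv mulr0 addr0 subr0 divr1. Qed.

Lemma normc_moebius_deriv : normc (moebius_deriv w0) = (2 * - Re w0)^-1.
Proof.
have s0 : w0 + conjc w0 != 0 by exact: moebius_den.
rewrite /moebius_deriv expr2 invfM mulrA divff // mul1r normcV normc_addconj ltr0_norm //.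
Qed.

Lemma normc_moebius_inv_deriv : normc (moebius_inv_deriv 0) = 2 * - Re w0.
Proof. by rewrite /moebius_inv_deriv subr0 expr1n divr1 normc_addconj ltr0_norm. Qed.

End Moebius.

(* The only property shared by invariant metrics and the normalized Bergman kernel that is needed:
   monotonicity against conformal images of the unit disk. *)
Definition extremal D (FD : R[i] -> R) :=
  (forall W G F dG, conformal disk W G F dG -> W `<=` D -> FD (G 0) <= (normc (dG 0))^-1) /\
  (forall W H F dH z, conformal D W H F dH -> W `<=` disk -> D z -> H z = 0 ->
     normc (dH z) <= FD z).

Lemma metric_extremal D (F : metric_family R) : is_domain D -> invariant_metric F ->
  extremal D (planar_metric F D).
Proof.
move=> dD iF; have d0 := unit_disk0 R; split.
  move=> W G F' dG cG WD; apply: (metric_upper iF dD).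
  - by move=> w /(conf_deriv cG) h; eexists; exact: h.
  - by move=> w wd; apply: WD; exact: (conf_maps cG).
  - exact: (conf_deriv cG).
  - by have [] := conf_inv_deriv cG (conf_maps cG d0); rewrite (conf_K cG).
move=> W H F' dH z cH Wd Dz Hz; apply: (metric_lower iF dD _ _ Dz Hz (conf_deriv cH Dz)).
  by move=> w /(conf_deriv cH) h; eexists; exact: h.
by move=> w wd; apply: Wd; exact: (conf_maps cH).
Qed.

Lemma bergman_extremal D B : open D -> is_bergman_kernel D B -> extremal D (bergman_diag B).
Proof.
move=> oD hB; split => [W G F dG cG WD|W H F dH z cH WD Dz _].
  exact: (bergman_upper oD hB cG WD).
exact: bergman_lower cH WD Dz.
Qed.

(** Rotate the outer normal to the positive axis, invert, shift by [- m], apply [joukowski], then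
    the Moebius map centred at the image of [z]. The left side is the modulus of the product of the
    five derivatives. *)
Lemma lower_bound_map D FD (p u A c : R[i]) (m m' : R) : open D -> extremal D FD ->
  u != 0 -> normc u = 1 -> 0 < m' -> normc c <= m' ^+ 2 / 2 ->
  (forall z, D z -> [/\ conjc u * (z - p) != 0,
     Re ((conjc u * (z - p))^-1 - m%:C) < - m' &
     Re (joukowski A c ((conjc u * (z - p))^-1 - m%:C)) < 0]) ->
  forall z, D z -> let v := (conjc u * (z - p))^-1 - m%:C in
    normc (joukowski_deriv c v) / (2 * - Re (joukowski A c v) * normc (z - p) ^+ 2) <= FD z.
Proof.
move=> oD [_ ext] u0 nu m'0 cm H z Dz; cbv zeta; set v := (conjc u * (z - p))^-1 - m%:C.
have cu0 : conjc u != 0 by rewrite conjc_eq0.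
have c1 := conformal_affine (- (conjc u * p)) oD cu0.
have E1 x : conjc u * x + - (conjc u * p) = conjc u * (x - p) by rewrite mulrBr.
set W1 := [set y | _] in c1.
have W1P y : W1 y -> exists2 x, D x & y = conjc u * (x - p).
  by move=> Wy; exists ((conjc u)^-1 * (y - - (conjc u * p))) => //; rewrite -E1 mulVKf // subrK.
have W10 y : W1 y -> y != 0 by move=> /W1P[x /H[? _ _] ->].
have c2 := conformal_inv (conf_openW c1) W10; set W2 := [set y | _] in c2.
have W2P y : W2 y -> exists2 x, D x & y = (conjc u * (x - p))^-1.
  by move=> [_ /W1P[x Dx e]]; exists x => //; rewrite -e invrK.
have c3 := conformal_affine (- m%:C) (conf_openW c2) (oner_neq0 _); set W3 := [set y | _] in c3.
have W3P y : W3 y -> exists2 x, D x & y = (conjc u * (x - p))^-1 - m%:C.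
  move=> /W2P[x Dx e]; exists x => //; rewrite -e invr1 mul1r opprK addrK //.
have W3H : W3 `<=` left_half m' by move=> y /W3P[x /H[_ ? _] ->].
have c4 := conformal_joukowski A m'0 (conf_openW c3) W3H cm; set W4 := _ @` _ in c4.
have W4H : W4 `<=` left_half 0.
  by move=> _ [y /W3P[x /H[_ _ ?] ->] <-]; rewrite /left_half /= oppr0.
have [_ vH' vH] := H z Dz.
have [c5 _] := conformal_moebius vH.
have c5' := conformal_sub c5 (conf_openW c4) W4H.
have cc := conformal_comp c1 (conformal_comp c2 (conformal_comp c3 (conformal_comp c4 c5'))).
have := ext _ _ _ _ z cc (fun _ => @proj1 _ _) Dz.
rewrite !E1 mul1r -/v moebius_w0 => /(_ erefl).
rewrite 4!normcM normc_moebius_deriv // normc1 mulr1 normcN normcV normcXn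
  [normc (_ * (z - p))]normcM !normc_conj nu !mul1r mulr1.
move=> h; apply: le_trans h; rewrite le_eqVlt; apply/orP; left; apply/eqP.
by rewrite invfM mulrA; congr (_ * _); exact: mulrC.
Qed.

(** The analogous chain in the opposite direction: the disk goes to the half-plane [Re v < - m], its
    centre to [v], and then into [D]. The factor [- (Re v + m)] is the distance of [v] to the
    edge. *)
Lemma upper_bound_map D FD (p u A c : R[i]) (m : R) : extremal D FD ->
  u != 0 -> normc u = 1 -> 0 < m -> normc c <= m ^+ 2 / 2 ->
  (forall v, Re v < - m -> joukowski A c v != 0 /\ D (u * (joukowski A c v)^-1 + p)) ->
  forall v, Re v < - m ->
   FD (u * (joukowski A c v)^-1 + p) <=
     normc (joukowski A c v) ^+ 2 / (2 * - (Re v + m) * normc (joukowski_deriv c v)).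
Proof.
move=> [ext _] u0 nu m0 cm H v vH.
pose w0 := v + m%:C; have w0H : Re w0 < 0 by rewrite /w0 Re_add /=; lra.
have [_ c1] := conformal_moebius w0H.
have c2 := conformal_affine (- m%:C) (conf_openW c1) (oner_neq0 _); set W2 := [set y | _] in c2.
have W2H : W2 `<=` left_half m.
  by move=> y; rewrite /W2 /left_half /= invr1 mul1r opprK Re_add oppr0 /=; lra.
have c3 := conformal_joukowski A m0 (conf_openW c2) W2H cm; set W3 := _ @` _ in c3.
have W30 y : W3 y -> y != 0 by move=> [x /W2H /H[? _] <-].
have c4 := conformal_inv (conf_openW c3) W30; set W4 := [set y | _] in c4.
have c5 := conformal_affine p (conf_openW c4) u0; set W5 := [set y | _] in c5.
have cc := conformal_comp c1 (conformal_comp c2 (conformal_comp c3 (conformal_comp c4 c5))).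
have W5D : W5 `<=` D.
  move=> y [y0 [x /W2H /H[_ Dx] e]].
  by move: Dx; rewrite e invrK mulVKf // subrK.
have := ext _ _ _ _ cc W5D.
have E : 1 * moebius_inv w0 0 + - m%:C = v by rewrite moebius_inv0 mul1r /w0 addrK.
rewrite !E 4!normcM normc_moebius_inv_deriv // normc1 nu !mul1r normcN normcV normcXn.
move=> h; apply: le_trans h _; rewrite le_eqVlt; apply/orP; left; apply/eqP.
have -> : Re w0 = Re v + m by rewrite /w0 Re_add.
by rewrite mulr1 -mulrA invfM invrK; congr (_ * _); congr (_^-1); exact: mulrC.
Qed.

End ExplicitMaps.

(** * Taylor expansion of a class C^4 function *)

Section Taylor.
Variable R : realType.
Implicit Types (phi : R[i] -> R) (U : set R[i]) (z w v p : R[i]).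

Lemma mean_value_bound (f f' : R -> R) (c e a b : R) :
  (forall t, Num.min a b <= t <= Num.max a b -> is_derive t 1 f (f' t) /\ `|f' t - c| <= e) ->
  `|f b - f a - c * (b - a)| <= e * `|b - a|.
Proof.
wlog ab : a b / a <= b.
  move=> W; have [ab|ba] : a <= b \/ b <= a by exact/orP/le_total.
  exact: (W a b ab).
  move=> H; have := W b a ba; rewrite minC maxC => /(_ H).
  rewrite [`|b - a|]distrC; apply: le_trans; rewrite -normrN le_eqVlt; apply/orP; left.
  by apply/eqP; congr `|_|; ring.
rewrite (min_idPl ab) (max_idPr ab) => H.
have HD t : t \in `]a, b[%R -> is_derive t 1 f (f' t).
  by rewrite in_itv /= => /andP[h1 h2]; apply: (H t _).1; rewrite !ltW.
have HC : {within `[a, b], continuous f}.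
  apply: continuous_in_subspaceT => t; rewrite inE /= in_itv /= => /H[[df _] _].
  by apply: differentiable_continuous; apply/derivable1_diffP.
have [t tab ->] := MVT_segment ab HD HC.
rewrite in_itv /= in tab; have [_ h] := H _ tab.
rewrite -mulrBl normrM; exact: ler_wpM2r.
Qed.

Lemma line_shift phi z v (t c : R) : is_derive (0 : R) 1 (on_line phi (z + t%:C * v) v) c ->
  is_derive t 1 (on_line phi z v) c.
Proof.
move=> /real_deriveP H; apply/real_deriveP => e e0; have [d d0 dH] := H e e0.
exists d => // s hs; have := dH (s - t); rewrite subr0 => /(_ hs).
rewrite /on_line mul0r addr0.
have -> : z + t%:C * v + (s - t)%:C * v = z + s%:C * v.
  by rewrite rmorphB /= mulrBl addrA addrAC addrK.
by [].
Qed.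

(** [class_C] provides derivatives along the two axes only. The mean value theorem on the path [z],
    [z + i k], [z + i k + h] and the continuity of the partials give the full differential. *)
Lemma partials_differential U phi z : open U -> U z ->
  (forall w, U w -> derivable (on_line phi w 1) 0 1 /\ derivable (on_line phi w 'i%C) 0 1) ->
  {for z, continuous (dx phi)} -> {for z, continuous (dy phi)} ->
  forall e, 0 < e -> exists2 d, 0 < d & forall w, normc (w - z) < d ->
    `|phi w - phi z - (dx phi z * Re (w - z) + dy phi z * Im (w - z))| <= e * normc (w - z).
Proof.
move=> oU Uz dp cx cy e e0; have e2 : 0 < e / 2 by lra.
have [d0 d00 dU] := (open_normcP _).1 oU _ Uz.
have cxP : exists2 d, 0 < d & forall w, normc (w - z) < d -> `|dx phi w - dx phi z| < e / 2.
  have /cx : nbhs (dx phi z) [set y | `|y - dx phi z| < e / 2] by apply/real_nbhsP; exists (e / 2).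
  by move=> /nbhs_normcP.
have cyP : exists2 d, 0 < d & forall w, normc (w - z) < d -> `|dy phi w - dy phi z| < e / 2.
  have /cy : nbhs (dy phi z) [set y | `|y - dy phi z| < e / 2] by apply/real_nbhsP; exists (e / 2).
  by move=> /nbhs_normcP.
have [d1 d10 H1] := cxP; have [d2 d20 H2] := cyP.
pose d := Num.min d0 (Num.min d1 d2).
exists (d / 2) => [|w wd]; first by rewrite divr_gt0 // !lt_min d00 d10.
pose h := Re (w - z); pose k := Im (w - z).
have hn : `|h| <= normc (w - z) := Re_le_normc _.
have kn : `|k| <= normc (w - z) := Im_le_normc _.
have small w' : normc (w' - z) < d ->
    [/\ U w', `|dx phi w' - dx phi z| <= e / 2 & `|dy phi w' - dy phi z| <= e / 2].
  rewrite !lt_min => /andP[a1 /andP[a2 a3]]; split; [exact: dU|apply: ltW; exact: H1|apply: ltW; exact: H2].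
pose z1 := z + k%:C * 'i%C.
have wE : w = z1 + h%:C * 1.
  by apply: complexP; rewrite /z1 /h /k !ReImE /=; ring.
have S1 t : Num.min 0 h <= t <= Num.max 0 h -> normc (z1 + t%:C * 1 - z) < d.
  move=> ht; have ta : `|t| <= `|h|.
    have [h0|h0] := leP 0 h.
      by move: ht; rewrite (min_idPl h0) (max_idPr h0) => /andP[? ?]; rewrite !ger0_norm.
    move: ht; rewrite (min_idPr (ltW h0)) (max_idPl (ltW h0)) => /andP[? ?].
    by rewrite !ler0_norm ?lerN2 // ltW.
  apply: le_lt_trans (normc_le_ReIm _) _.
  have -> : Re (z1 + t%:C * 1 - z) = t by rewrite /z1 !ReImE /=; ring.
  have -> : Im (z1 + t%:C * 1 - z) = k by rewrite /z1 !ReImE /=; ring.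
  lra.
have S2 t : Num.min 0 k <= t <= Num.max 0 k -> normc (z + t%:C * 'i%C - z) < d.
  move=> ht; have ta : `|t| <= `|k|.
    have [h0|h0] := leP 0 k.
      by move: ht; rewrite (min_idPl h0) (max_idPr h0) => /andP[? ?]; rewrite !ger0_norm.
    move: ht; rewrite (min_idPr (ltW h0)) (max_idPl (ltW h0)) => /andP[? ?].
    by rewrite !ler0_norm ?lerN2 // ltW.
  apply: le_lt_trans (normc_le_ReIm _) _.
  have -> : Re (z + t%:C * 'i%C - z) = 0 by rewrite !ReImE /=; ring.
  have -> : Im (z + t%:C * 'i%C - z) = t by rewrite !ReImE /=; ring.
  rewrite normr0; have := normr_ge0 t; lra.
have M1 := @mean_value_bound (on_line phi z1 1) (fun t => dx phi (z1 + t%:C * 1)) (dx phi z) (e / 2) 0 h.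
have M2 := @mean_value_bound (on_line phi z 'i%C) (fun t => dy phi (z + t%:C * 'i%C)) (dy phi z) (e / 2) 0 k.
have {}M1 : `|phi w - phi z1 - dx phi z * h| <= e / 2 * `|h|.
  rewrite wE; move: M1; rewrite /on_line mul0r addr0 !subr0; apply => t /S1 /small[Ut tx _].
  split; last exact: tx.
  by apply: line_shift; have [h1 _] := dp _ Ut; rewrite /dx derive1E; exact: derivableP.
have {}M2 : `|phi z1 - phi z - dy phi z * k| <= e / 2 * `|k|.
  move: M2; rewrite /on_line mul0r addr0 !subr0; apply => t /S2 /small[Ut _ ty].
  split; last exact: ty.
  by apply: line_shift; have [_ h1] := dp _ Ut; rewrite /dy derive1E; exact: derivableP.
rewrite -/h -/k.
have -> : phi w - phi z - (dx phi z * h + dy phi z * k) =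
  (phi w - phi z1 - dx phi z * h) + (phi z1 - phi z - dy phi z * k) by ring.
apply: le_trans (ler_normD _ _) _; nra.
Qed.

Lemma line_derive U phi z v (t : R) : open U -> class_C 1 U phi -> U (z + t%:C * v) ->
  is_derive t 1 (fun s : R => phi (z + s%:C * v))
    (Re v * dx phi (z + t%:C * v) + Im v * dy phi (z + t%:C * v)).
Proof.
move=> oU [_ [dp [cx _] [cy _]]] Uz; set w := z + t%:C * v in Uz *.
apply/real_deriveP => e e0.
have n0 := normc_ge0 v; have e1 : 0 < e / (normc v + 1) by rewrite divr_gt0 //; lra.
have [d d0 dH] := partials_differential oU Uz dp (cx _ Uz) (cy _ Uz) e1.
exists (d / (normc v + 1)); first by rewrite divr_gt0 //; lra.
move=> s; rewrite ltr_pdivlMr; last by lra.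
move=> hs; have E : z + s%:C * v - w = (s - t)%:C * v.
  by rewrite /w opprD addrACA subrr add0r -mulrBl rmorphB.
have hd : normc (z + s%:C * v - w) < d.
  by rewrite E normcM normcR; have := normr_ge0 (s - t); nra.
have := dH _ hd; rewrite E normcM normcR.
have -> : Re ((s - t)%:C * v) = (s - t) * Re v by rewrite Re_mul /= mul0r subr0.
have -> : Im ((s - t)%:C * v) = (s - t) * Im v by rewrite Im_mul /= mul0r addr0.
have -> : phi (z + s%:C * v) - phi w - (dx phi w * ((s - t) * Re v) + dy phi w * ((s - t) * Im v)) =
  phi (z + s%:C * v) - phi w - (Re v * dx phi w + Im v * dy phi w) * (s - t) by ring.
move=> h; apply: le_trans h _.
rewrite [`|s - t| * _]mulrC mulrA; apply: ler_wpM2r => //.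
by rewrite mulrAC ler_pdivrMr; [nra|lra].
Qed.

(** The [k]-th derivative along [v]; the iterated partials keep their order as in [hessian], so that
    [Dv 2] is the Hessian form. *)
Fixpoint Dv k v phi : R[i] -> R :=
  if k is k'.+1 then fun z => Re v * Dv k' v (dx phi) z + Im v * Dv k' v (dy phi) z else phi.

Lemma class_C_le k U phi : class_C k.+1 U phi -> class_C k U phi.
Proof.
elim: k phi => [|k IH] phi; first by case.
by move=> [cp [dp cx cy]]; exact: (conj cp (And3 dp (IH _ cx) (IH _ cy))).
Qed.

Lemma is_derive_lincomb (f1 f2 : R -> R) (a b d1 d2 t : R) :
  is_derive t 1 f1 d1 -> is_derive t 1 f2 d2 ->
  is_derive t 1 (fun s => a * f1 s + b * f2 s) (a * d1 + b * d2).
Proof. by move=> h1 h2; apply: is_derive_eq; rewrite /GRing.scale /=; ring. Qed.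

Lemma Dv_derive k U phi z v (t : R) : open U -> class_C k.+1 U phi -> U (z + t%:C * v) ->
  is_derive t 1 (fun s : R => Dv k v phi (z + s%:C * v)) (Dv k.+1 v phi (z + t%:C * v)).
Proof.
elim: k phi => [|k IH] phi oU; first by move=> c Uz; exact: line_derive oU c Uz.
move=> [_ [_ cx cy]] Uz.
have hx := IH _ oU cx Uz; have hy := IH _ oU cy Uz.
exact: (is_derive_lincomb (Re v) (Im v) hx hy).
Qed.

Lemma Dv_bound k U phi p : open U -> U p -> class_C k U phi -> exists M d, [/\ 0 <= M, 0 < d &
  forall z v, normc (z - p) < d -> `|Dv k v phi z| <= M * normc v ^+ k].
Proof.
move=> oU Up; elim: k phi => [|k IH] phi.
  move=> [cp _].
  have /(cp _ Up) : nbhs (phi p) [set y | `|y - phi p| < 1] by apply/real_nbhsP; exists 1.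
  move=> /nbhs_normcP[d d0 dH]; exists (`|phi p| + 1), d; split; [by rewrite addr_ge0|exact: d0|].
  move=> z v /dH /= h; rewrite expr0 mulr1.
  have -> : phi z = (phi z - phi p) + phi p by rewrite subrK.
  by apply: le_trans (ler_normD _ _) _; lra.
move=> [_ [_ /IH[M1 [d1 [M10 d10 H1]]] /IH[M2 [d2 [M20 d20 H2]]]]].
exists (M1 + M2), (Num.min d1 d2); split; [exact: addr_ge0|by rewrite lt_min d10|].
move=> z v; rewrite lt_min => /andP[/H1 h1 /H2 h2] /=.
apply: le_trans (ler_normD _ _) _; rewrite !normrM.
have -> : (M1 + M2) * normc v ^+ k.+1 = normc v * (M1 * normc v ^+ k) + normc v * (M2 * normc v ^+ k).
  by rewrite exprS; ring.
by apply: lerD; apply: ler_pM => //; [exact: Re_le_normc|exact: Im_le_normc].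
Qed.

Lemma unit_interval_bound (f f' : R -> R) (K : R) :
  (forall t : R, 0 <= t <= 1 -> is_derive t 1 f (f' t)) -> f 0 = 0 ->
  (forall t : R, 0 <= t <= 1 -> `|f' t| <= K) -> forall t : R, 0 <= t <= 1 -> `|f t| <= K.
Proof.
move=> df f0 fK t /andP[t0 t1].
have := @mean_value_bound f f' 0 K 0 t.
rewrite (min_idPl t0) (max_idPr t0) f0 mul0r !subr0 (ger0_norm t0) => H.
have K0 : 0 <= K by apply: le_trans (normr_ge0 _) (fK 0 _); rewrite lexx ler01.
apply: le_trans (H _) _; last by rewrite ler_piMr.
move=> s /andP[s0 st]; have s1 : 0 <= s <= 1 by rewrite s0 (le_trans st).
by rewrite subr0; split; [exact: df|exact: fK].
Qed.

(** The remainder [f0] and its derivatives [f1], [f2], [f3] vanish at [0], so the bound [K] passes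
    down from [g4] to [f0] by four applications of the mean value theorem. *)
Lemma taylor4 (g0 g1 g2 g3 g4 : R -> R) (K : R) :
  (forall t : R, 0 <= t <= 1 -> [/\ is_derive t 1 g0 (g1 t), is_derive t 1 g1 (g2 t),
     is_derive t 1 g2 (g3 t), is_derive t 1 g3 (g4 t) & `|g4 t| <= K]) ->
  `|g0 1 - (g0 0 + g1 0 + g2 0 / 2 + g3 0 / 6)| <= K.
Proof.
move=> H.
have i1 : 0 <= (1 : R) <= 1 by rewrite ler01 lexx.
pose f3 t := g3 t - g3 0.
pose f2 t := g2 t - (g2 0 + g3 0 * t).
pose f1 t := g1 t - (g1 0 + g2 0 * t + g3 0 / 2 * (t * t)).
pose f0 t := g0 t - (g0 0 + g1 0 * t + g2 0 / 2 * (t * t) + g3 0 / 6 * (t * t * t)).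
have dt (t : R) : is_derive t (1 : R) (fun s : R => s) 1 by exact: is_derive_id.
have d3 (t : R) : 0 <= t <= 1 -> is_derive t 1 f3 (g4 t).
  move=> /H[_ _ _ h _]; rewrite /f3; apply: is_derive_eq; rewrite /GRing.scale /=; ring.
have d2 (t : R) : 0 <= t <= 1 -> is_derive t 1 f2 (f3 t).
  move=> /H[_ _ h _ _]; rewrite /f2; apply: is_derive_eq; rewrite /GRing.scale /= /f3; ring.
have d1 (t : R) : 0 <= t <= 1 -> is_derive t 1 f1 (f2 t).
  move=> /H[_ h _ _ _]; rewrite /f1; apply: is_derive_eq; rewrite /GRing.scale /= /f2; lra.
have d0 : forall t : R, 0 <= t <= 1 -> is_derive t 1 f0 (f1 t).
  move=> t /H[h _ _ _ _]; rewrite /f0; apply: is_derive_eq; rewrite /GRing.scale /= /f1; lra.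
have z3 : f3 0 = 0 by rewrite /f3; ring.
have z2 : f2 0 = 0 by rewrite /f2; ring.
have z1 : f1 0 = 0 by rewrite /f1; ring.
have z0 : f0 0 = 0 by rewrite /f0; ring.
have b4 (t : R) : 0 <= t <= 1 -> `|g4 t| <= K by move=> /H[].
have b3 := unit_interval_bound d3 z3 b4.
have b2 := unit_interval_bound d2 z2 b3.
have b1 := unit_interval_bound d1 z1 b2.
have b0 := unit_interval_bound d0 z0 b1.
have -> : g0 1 - (g0 0 + g1 0 + g2 0 / 2 + g3 0 / 6) = f0 1 by rewrite /f0; ring.
exact: b0.
Qed.

Lemma taylor_class_C4 U phi p : open U -> U p -> class_C 4 U phi ->
  exists K d, [/\ 0 <= K, 0 < d & forall v, normc v < d ->
   U (p + v) /\
   `|phi (p + v) - (phi p + Dv 1 v phi p + Dv 2 v phi p / 2 + Dv 3 v phi p / 6)| <= K * normc v ^+ 4].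
Proof.
move=> oU Up c4; have [K [d [K0 d0 H]]] := Dv_bound oU Up c4.
have [d1 d10 dU] := (open_normcP _).1 oU _ Up.
exists K, (Num.min d d1); split => // [|v]; first by rewrite lt_min d0.
rewrite lt_min => /andP[vd vd1].
have nt (t : R) : 0 <= t <= 1 -> normc (p + t%:C * v - p) <= normc v.
  move=> /andP[t0 t1]; rewrite addrAC subrr add0r normcM normcR ger0_norm //.
  by rewrite ler_piMl ?normc_ge0.
have Ut (t : R) : 0 <= t <= 1 -> U (p + t%:C * v) by move=> /nt h; apply: dU; exact: le_lt_trans h vd1.
split; first by have := Ut 1; rewrite mul1r; apply; rewrite ler01 lexx.
have := @taylor4 (fun t => Dv 0 v phi (p + t%:C * v)) (fun t => Dv 1 v phi (p + t%:C * v))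
  (fun t => Dv 2 v phi (p + t%:C * v)) (fun t => Dv 3 v phi (p + t%:C * v))
  (fun t => Dv 4 v phi (p + t%:C * v)) (K * normc v ^+ 4).
rewrite mul1r mul0r addr0; apply => t ht; have Utt := Ut _ ht.
have c3 := class_C_le c4; have c2 := class_C_le c3; have c1 := class_C_le c2.
split.
- exact: (Dv_derive oU c1 Utt).
- exact: (Dv_derive oU c2 Utt).
- exact: (Dv_derive oU c3 Utt).
- exact: (Dv_derive oU c4 Utt).
- by apply: H; exact: le_lt_trans (nt _ ht) vd.
Qed.

End Taylor.

(** * Shape of the domain at the boundary point *)

Section RealShape.
Variable R : realType.
Implicit Types x y r : R.

Lemma ler_normM_le (a b c d : R) : `|a| <= c -> `|b| <= d -> `|a * b| <= c * d.
Proof. by move=> ? ?; rewrite normrM ler_pM. Qed.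

Lemma ler_normD_le (a b c d : R) : `|a| <= c -> `|b| <= d -> `|a + b| <= c + d.
Proof. by move=> ac bd; apply: le_trans (ler_normD _ _) (lerD ac bd). Qed.

(* With [y^2 = N - x^2] and [x = N (e - k/2 + b y)], the third-order Taylor polynomial is
   [N (e W + R0)] with [W] close to [g]; the coefficient [b] is chosen to cancel the linear term
   in [y]. *)
Lemma taylor_shape (g A B k c30 c21 c12 c03 K : R) : 0 < g -> 0 <= K ->
  exists b C d, [/\ 0 <= C, 0 < d & forall x y r f, 0 < r -> r < d -> x ^+ 2 + y ^+ 2 = r ^+ 2 ->
    `|f - (g * x + (A * x ^+ 2 + B * (x * y) + k * g * y ^+ 2) / 2
       + (c30 * x ^+ 3 + c21 * (x ^+ 2 * y) + c12 * (x * y ^+ 2) + c03 * y ^+ 3) / 6)| <= K * r ^+ 4 ->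
    (f < 0 -> x / r ^+ 2 < - k / 2 + b * y + C * r ^+ 2) /\
    (x / r ^+ 2 < - k / 2 + b * y - C * r ^+ 2 -> f < 0)].
Proof.
move=> g0 K0.
pose E := A - k * g; pose F := c21 - c03; pose b := (k * B / 4 - c03 / 6) / g.
pose beta := `|k| / 2 + `|b|.
pose Q := `|c30| + `|F| + `|c12|.
pose C0 := `|k * E| / 4 * beta + `|b| * (`|E| / 2 + `|B| / 2) + beta * (Q / 6).
pose S := `|E| / 2 + `|B| / 2 + Q / 6 + `|k * E| / 4.
have beta0 : 0 <= beta by rewrite addr_ge0 ?divr_ge0.
have Q0 : 0 <= Q by rewrite !addr_ge0.
have C00 : 0 <= C0 by rewrite !addr_ge0 // ?mulr_ge0 ?divr_ge0 ?addr_ge0 ?divr_ge0.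
have S0 : 0 <= S by rewrite !addr_ge0 // ?divr_ge0.
have CK0 : 0 <= C0 + K by rewrite addr_ge0.
(* For [r < d] the factor [W] is at least [g / 2], so [|e| >= C r^2] forces
   [|e W| >= (C0 + K + 1) r^2], which outweighs [R0] and the Taylor error and fixes the sign of
   [f]. *)
pose C := 2 * (C0 + K + 1) / g.
pose d := Num.min 1 (g / (2 * (S + 1))).
have C_0 : 0 < C by rewrite divr_gt0 // mulr_gt0 //; lra.
exists b, C, d; split; first exact: ltW.
  by rewrite lt_min ltr01 divr_gt0 //; lra.
move=> x y r f r0; rewrite lt_min => /andP[r1 rd] xy H.
have r2 : 0 < r ^+ 2 by rewrite exprn_gt0.
have xr : `|x| <= r.
  by rewrite -(ler_pXn2r (n := 2)) ?nnegrE ?normr_ge0 ?(ltW r0) // real_normK ?num_real // -xy lerDl sqr_ge0.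
have yr : `|y| <= r.
  by rewrite -(ler_pXn2r (n := 2)) ?nnegrE ?normr_ge0 ?(ltW r0) // real_normK ?num_real // -xy lerDr sqr_ge0.
have rS : r * S <= g / 2.
  have h : 0 < 2 * (S + 1) by clear - S0; lra.
  by move: rd; rewrite ltr_pdivlMr //; clear - r0 S0 => rd; nra.
have r1' : r <= 1 by exact: ltW.
have r21 : r ^+ 2 <= r by rewrite expr2 ler_piMl // ltW.
have x1 : `|x| <= 1 by exact: le_trans xr r1'.
have y1 : `|y| <= 1 by exact: le_trans yr r1'.
pose q := x / r ^+ 2; pose e := q + k / 2 - b * y.
have xe : x = r ^+ 2 * q by rewrite /q mulrCA divff ?mulr1 // gt_eqF.
pose P := c30 * (x * x) + F * (x * y) + c12 * (y * y).
pose W := g + (E * x / 2 + B * y / 2 + P / 6 - k * E / 4 * r ^+ 2).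
pose l := - (k / 2) + b * y.
pose R0 := - (k * E / 4 * l * r ^+ 2) + b * y * (E * x / 2 + B * y / 2) + l * (P / 6).
have lb : `|l| <= beta.
  apply: ler_normD_le; first by rewrite normrN normrM (ger0_norm (_ : 0 <= 2^-1)) // invr_ge0.
  by rewrite normrM ler_piMr.
have Pb : `|P| <= Q * r ^+ 2.
  rewrite /Q !mulrDl expr2; (apply: ler_normD_le; first apply: ler_normD_le);
    rewrite -?mulrA; (apply: ler_normM_le; [by []|exact: ler_normM_le]).
have half n (a : R) : `|a / n.+1%:R| = `|a| / n.+1%:R.
  by rewrite normrM (ger0_norm (_ : 0 <= n.+1%:R^-1)) // invr_ge0.
have Eb : `|E * x / 2 + B * y / 2| <= (`|E| / 2 + `|B| / 2) * r.
  by rewrite [leRHS]mulrDl; apply: ler_normD_le; rewrite half normrM mulrAC ler_wpM2l ?divr_ge0.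
have Rb : `|R0| <= C0 * r ^+ 2.
  rewrite /C0 2!mulrDl; apply: ler_normD_le; first apply: ler_normD_le.
  - rewrite normrN normrM (ger0_norm (ltW r2)) ler_wpM2r ?(ltW r2) //.
    by apply: ler_normM_le; rewrite // half.
  - rewrite (_ : _ * _ * r ^+ 2 = `|b| * r * ((`|E| / 2 + `|B| / 2) * r)); last by ring.
    by apply: ler_normM_le => //; apply: ler_normM_le.
  - by rewrite -mulrA; apply: ler_normM_le => //; rewrite half mulrAC ler_wpM2r // invr_ge0.
have Wb : `|W - g| <= S * r.
  rewrite (_ : S * r = (`|E| / 2 + `|B| / 2) * r + Q / 6 * r + `|k * E| / 4 * r); last by rewrite /S; ring.
  rewrite (_ : W - g = E * x / 2 + B * y / 2 + P / 6 - k * E / 4 * r ^+ 2); last by rewrite /W; ring.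
  apply: ler_normD_le; first apply: ler_normD_le => //.
    by rewrite half [leRHS]mulrAC ler_wpM2r ?invr_ge0 // (le_trans Pb) // ler_wpM2l.
  by rewrite normrN normrM half (ger0_norm (ltW r2)) ler_wpM2l ?divr_ge0.
have Wg : g / 2 <= W by clear - Wb rS; move: Wb; rewrite ler_norml => /andP[]; lra.
have main : g * x + (A * x ^+ 2 + B * (x * y) + k * g * y ^+ 2) / 2
       + (c30 * x ^+ 3 + c21 * (x ^+ 2 * y) + c12 * (x * y ^+ 2) + c03 * y ^+ 3) / 6
   = r ^+ 2 * (e * W + R0).
  have bg : b * g = k * B / 4 - c03 / 6 by rewrite /b divfK // gt_eqF.
  have y2 : y ^+ 2 = r ^+ 2 - x ^+ 2 by rewrite -xy; ring.
  have id1 : g * x + (A * x ^+ 2 + B * (x * y) + k * g * y ^+ 2) / 2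
       + (c30 * x ^+ 3 + c21 * (x ^+ 2 * y) + c12 * (x * y ^+ 2) + c03 * y ^+ 3) / 6
    = x * (g + (E * x / 2 + B * y / 2 + P / 6)) + r ^+ 2 * (k * g / 2 + c03 * y / 6).
    rewrite (_ : y ^+ 3 = y * y ^+ 2); last by ring.
    by rewrite /P (_ : y * y = r ^+ 2 - x ^+ 2) -?expr2 // y2 /E /F; field.
  rewrite id1 {1}xe -mulrA -mulrDr; congr (_ * _).
  have qe : q = e + l by rewrite /e /l; ring.
  have id2 : q * (g + (E * x / 2 + B * y / 2 + P / 6)) + (k * g / 2 + c03 * y / 6)
   = e * (g + (E * x / 2 + B * y / 2 + P / 6)) + (b * g - k * B / 4 + c03 / 6) * y
     - k * E / 4 * x + b * y * (E * x / 2 + B * y / 2) + l * (P / 6).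
    by rewrite qe /l; field.
  rewrite id2 bg.
  rewrite (_ : k * E / 4 * x = k * E / 4 * (r ^+ 2 * (e + l))); last by rewrite {1}xe qe.
  by rewrite /W /R0; field.
move: H; rewrite main (_ : r ^+ 4 = r ^+ 2 * r ^+ 2); last by ring.
have CN : 0 <= C * r ^+ 2 by exact: mulr_ge0 (ltW C_0) (ltW r2).
have g2 : 0 <= g / 2 by exact: divr_ge0 (ltW g0) _.
have Cg : C * (g / 2) = C0 + K + 1 by rewrite /C; field; rewrite gt_eqF.
have -> : x / r ^+ 2 = q by [].
have -> : q = e - k / 2 + b * y by rewrite /e; ring.
move: Rb r2 CN; set N := r ^+ 2 => Rb r2 CN; rewrite !ler_norml => /andP[H1 H2].
move: Rb; rewrite ler_norml => /andP[Rb1 Rb2].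
split => [f0|he].
- suff : e < C * N by clear; lra.
  rewrite ltNge; apply/negP => eC.
  have : C * N * (g / 2) <= e * W by apply: ler_pM.
  rewrite mulrAC Cg => h.
  have h' : (K + 1) * N <= e * W + R0 by clear - h Rb1; lra.
  have h2 := ler_wpM2l (ltW r2) h'; have N2 := mulr_gt0 r2 r2.
  by clear - h2 N2 H1 f0; lra.
- have eC : C * N <= - e by clear - he; lra.
  have : C * N * (g / 2) <= - e * W by apply: ler_pM.
  rewrite mulrAC Cg => h.
  have h' : e * W + R0 <= - ((K + 1) * N) by clear - h Rb2; lra.
  have h2 := ler_wpM2l (ltW r2) h'; have N2 := mulr_gt0 r2 r2.
  by clear - h2 N2 H2; lra.
Qed.

End RealShape.

Section LocalShape.
Variable R : realType.
Implicit Types (phi : R[i] -> R) (D U : set R[i]) (z w v p : R[i]).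

Lemma boundary_defining_eq0 k D p phi : open D -> boundary D p -> local_defining k D p phi ->
  phi p = 0.
Proof.
move=> oD [clD nD] [U [oU Up cU DU _]].
have nDp : ~ D p by move=> Dp; apply: nD; exact: (open_nbhs_nbhs (conj oD Dp)).
have ge0 : 0 <= phi p by rewrite leNgt; apply/negP => /(DU _ Up).
apply/eqP; rewrite eq_le ge0 andbT leNgt; apply/negP => gt0.
have cphi : {for p, continuous phi} by case: k cU => [|k] [h _]; exact: h.
have nU : nbhs p U by exact: open_nbhs_nbhs.
have nphi : nbhs p [set z | 0 < phi z]
  by apply: (cphi [set y | 0 < y]); apply: open_nbhs_nbhs; split; [exact: open_gt|].
have [z [Dz [Uz /= pz]]] := clD _ (filterI nU nphi).
by move/(DU _ Uz): Dz; rewrite ltNge ltW.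
Qed.

(** Coordinates with the first axis along [u1 + i u2]. The coefficient of [y^2], the second
    derivative along the tangent, stays explicit because it carries the curvature. *)
Lemma rotated_quadratic (a b c e u1 u2 : R) : exists A B, forall x y,
  let X := u1 * x - u2 * y in let Y := u1 * y + u2 * x in
  X * (X * a + Y * b) + Y * (X * c + Y * e) =
  A * x ^+ 2 + B * (x * y) + (- u2 * (- u2 * a + u1 * b) + u1 * (- u2 * c + u1 * e)) * y ^+ 2.
Proof.
exists (u1 * (u1 * a + u2 * b) + u2 * (u1 * c + u2 * e)).
exists (u1 * (- u2 * a + u1 * b) - u2 * (u1 * a + u2 * b) + u2 * (- u2 * c + u1 * e) + u1 * (u1 * c + u2 * e)).
move=> x y /=; ring.
Qed.

Lemma rotated_cubic (a b c e a' b' c' e' u1 u2 : R) : exists c30 c21 c12 c03, forall x y,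
  let X := u1 * x - u2 * y in let Y := u1 * y + u2 * x in
  X * (X * (X * a + Y * b) + Y * (X * c + Y * e)) + Y * (X * (X * a' + Y * b') + Y * (X * c' + Y * e')) =
  c30 * x ^+ 3 + c21 * (x ^+ 2 * y) + c12 * (x * y ^+ 2) + c03 * y ^+ 3.
Proof.
have [A [B H]] := rotated_quadratic a b c e u1 u2.
have [A' [B' H']] := rotated_quadratic a' b' c' e' u1 u2.
set G := (_ + _) in H; set G' := (_ + _) in H'.
exists (u1 * A + u2 * A'), (u1 * B - u2 * A + (u2 * B' + u1 * A')).
exists (u1 * G - u2 * B + (u2 * G' + u1 * B')), (u1 * G' - u2 * G).
by move=> x y /=; rewrite H H'; ring.
Qed.

Local Notation u phi p := (outward_normal phi p).

Lemma local_shape D p phi : open D -> boundary D p -> local_defining 4 D p phi ->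
  [/\ u phi p != 0, normc (u phi p) = 1 &
  exists b C d, [/\ 0 <= C, 0 < d & forall w, w != 0 -> normc w < d ->
    (D (u phi p * w + p) -> Re w^-1 < - curvature phi p / 2 + b * Im w + C * normc w ^+ 2) /\
    (Re w^-1 < - curvature phi p / 2 + b * Im w - C * normc w ^+ 2 -> D (u phi p * w + p))]].
Proof.
move=> oD bD def; have phi0 := boundary_defining_eq0 oD bD def.
have [U [oU Up c4 DU gr]] := def; have grp := gr _ Up bD.
pose g := normc (gradient phi p); have g0 : 0 < g by rewrite normc_gt0.
set k := curvature phi p.
have ig : (g%:C)^-1 = (g^-1)%:C by rewrite fmorphV.
have u1 : normc (u phi p) = 1.
  rewrite normcM ig normcR ger0_norm ?invr_ge0 ?normc_ge0 //.
  by rewrite divff // gt_eqF.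
split => //; first by rewrite -normc_gt0 u1.
have [K [d1 [K0 d10 T]]] := taylor_class_C4 oU Up c4.
set u1' := Re (u phi p); set u2' := Im (u phi p).
set a1 := dx phi p; set a2 := dy phi p.
have graE : gradient phi p = a1 +i* a2 by [].
have uE : u phi p = (a1 / g) +i* (a2 / g).
  rewrite /outward_normal -/g graE ig.
  by apply: complexP; rewrite ReImE /=; ring.
have [e1 e2] : u1' = a1 / g /\ u2' = a2 / g by rewrite /u1' /u2' uE.
have a1E : a1 = g * u1' by rewrite e1 mulrCA divff ?mulr1 // gt_eqF.
have a2E : a2 = g * u2' by rewrite e2 mulrCA divff ?mulr1 // gt_eqF.
have n1 : u1' ^+ 2 + u2' ^+ 2 = 1 by rewrite -sqr_normcE u1 expr1n.
have [A [B HQ]] := rotated_quadratic (dx (dx phi) p) (dy (dx phi) p)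
  (dx (dy phi) p) (dy (dy phi) p) u1' u2'.
have [c30 [c21 [c12 [c03 HC]]]] := rotated_cubic
  (dx (dx (dx phi)) p) (dy (dx (dx phi)) p) (dx (dy (dx phi)) p) (dy (dy (dx phi)) p)
  (dx (dx (dy phi)) p) (dy (dx (dy phi)) p) (dx (dy (dy phi)) p) (dy (dy (dy phi)) p) u1' u2'.
(* The gradient is [g] times the unit normal, so [g] times the curvature is the Hessian on the unit
   tangent [i u]. *)
have kg : k * g = - u2' * (- u2' * dx (dx phi) p + u1' * dy (dx phi) p)
    + u1' * (- u2' * dx (dy phi) p + u1' * dy (dy phi) p).
  rewrite /k /curvature /hessian -/g graE !ReImE /= a1E a2E.
  move: (dx (dx phi) p) (dy (dx phi) p) (dx (dy phi) p) (dy (dy phi) p) => h1 h2 h3 h4.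
  by field; rewrite gt_eqF.
have [b [C [d [C0 d0 H]]]] := taylor_shape A B k c30 c21 c12 c03 g0 K0.
exists b, C, (Num.min d d1); split => // [|w w0]; first by rewrite lt_min d0.
rewrite lt_min => /andP[wd wd1].
have nw : normc (u phi p * w) = normc w by rewrite normcM u1 mul1r.
have [|Uw Tw] := T (u phi p * w); first by rewrite nw.
have := H (Re w) (Im w) (normc w) (phi (p + u phi p * w)).
rewrite normc_gt0 w0 wd -sqr_normcE => /(_ isT isT erefl).
have X : Re (u phi p * w) = u1' * Re w - u2' * Im w by rewrite Re_mul.
have Y : Im (u phi p * w) = u1' * Im w + u2' * Re w by rewrite Im_mul.
have D1 : Dv 1 (u phi p * w) phi p = g * Re w.
  transitivity (Re (u phi p * w) * a1 + Im (u phi p * w) * a2); first by [].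
  rewrite X Y a1E a2E -[RHS]mulr1 -n1; ring.
have D2 : Dv 2 (u phi p * w) phi p = A * Re w ^+ 2 + B * (Re w * Im w) + k * g * Im w ^+ 2.
  by rewrite kg -HQ -X -Y.
have D3 : Dv 3 (u phi p * w) phi p = c30 * Re w ^+ 3 + c21 * (Re w ^+ 2 * Im w)
    + c12 * (Re w * Im w ^+ 2) + c03 * Im w ^+ 3.
  by rewrite -HC -X -Y.
move: Tw; rewrite D1 D2 D3 phi0 add0r nw => Tw /(_ Tw).
rewrite (_ : Re w^-1 = Re w / normc w ^+ 2); last first.
  by rewrite invc_eq Re_mul /= mul0r subr0 mulrC; case: (w).
rewrite [u phi p * w + p]addrC => -[h1 h2].
by split => [Dw|/h2 h]; [apply: h1; exact: (DU _ Uw).1|exact: (DU _ Uw).2].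
Qed.

End LocalShape.

(** * Half-plane comparison *)

Section Constants.
Variable R : realType.
Implicit Types (z w v : R[i]).

Lemma Re_inv v : Re v^-1 = Re v * (normc v)^-1 ^+ 2.
Proof. by rewrite invc_eq Re_mul /= mul0r subr0 mulrC exprVn; case: (v). Qed.

Lemma normc_subV v w : v != 0 -> w != 0 ->
  normc (v^-1 - w^-1) = normc (w - v) * (normc v)^-1 * (normc w)^-1.
Proof.
move=> v0 w0; rewrite -!normcV -!normcM; congr normc; field.
by rewrite v0 w0.
Qed.

Lemma Re_joukowski (A x y : R) v :
  Re (joukowski A%:C (x +i* y) v) = Re v + A + (x * Re v^-1 - y * Im v^-1).
Proof. by rewrite /joukowski !Re_add Re_mul. Qed.

Implicit Types k b C d L m : R.

Lemma constants_ge k b C d L : 0 <= C -> 0 < d ->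
  16 * (2 + d^-1 + `|k| + 2 * `|b| + 2 * C) <= L ->
  [/\ 32 <= L, 16 * d^-1 <= L, `|k| <= L / 16 & `|b| <= L / 32].
Proof.
move=> hC d0 h; have hd : 0 < d^-1 by rewrite invr_gt0.
by have nk := normr_ge0 k; have nb := normr_ge0 b; split; lra.
Qed.

Lemma joukowski_parameter_small k b C d L m : 0 <= C -> 0 < d ->
  16 * (2 + d^-1 + `|k| + 2 * `|b| + 2 * C) <= L -> m = 64 * L ->
  normc ((L * m) +i* b) <= (m / 4) ^+ 2 / 2.
Proof.
move=> C0 d0 hL mL; have [h1 h2 h3 h4] := constants_ge C0 d0 hL.
apply: le_trans (normc_le_ReIm _) _.
rewrite [Re _]/= [Im _]/= ger0_norm ?mL; last by nra.
nra.
Qed.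

(* The term [Re (L m / v) <= - L m^2 / (2 |v|^2)] absorbs the [O(|zeta|^-2)] remainder, and
   [Re (i b / v)] cancels [b Im w] up to the same order. *)
Lemma outer_half_plane k b C d L m w : 0 <= C -> 0 < d ->
  16 * (2 + d^-1 + `|k| + 2 * `|b| + 2 * C) <= L -> m = 64 * L -> w != 0 ->
  (normc w < d -> Re w^-1 < - k / 2 + b * Im w + C * normc w ^+ 2) ->
  Re (w^-1 - m%:C) < - (m / 4) /\
  Re (joukowski (m + k / 2)%:C ((L * m) +i* b) (w^-1 - m%:C)) < 0.
Proof.
move=> hC d0 hL hm w0 H; have [L1 L2 L3 L4] := constants_ge hC d0 hL.
have d10 : 0 < d^-1 by rewrite invr_gt0.
have nk := normr_ge0 k; have nb := normr_ge0 b.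
have kk := ler_norm k; have bb := ler_norm b.
have kk' : - `|k| <= k by rewrite lerNl -normrN ler_norm.
have m0 : 0 < m by lra.
have L0 : 0 <= L by lra.
set z := w^-1; set v := z - m%:C.
have z0 : z != 0 by rewrite invr_eq0.
have wz : w = z^-1 by rewrite invrK.
set X := normc w; have X0 : 0 < X by rewrite normc_gt0.
have XV : X = (normc z)^-1 by rewrite /X wz normcV.
have Rv : Re v = Re z - m by rewrite !ReImE.
have bIm (a : R[i]) : b * Im a <= `|b| * normc a.
  by apply: le_trans (ler_norm _) _; rewrite normrM ler_wpM2l // Im_le_normc.
(* Away from [p] the shape of [D] is unknown but [z = 1 / w] is bounded; otherwise [|w|] is below
   both [1] and [d], and the local description applies. *)
have cases : (normc z <= 1 + d^-1) \/ (X < 1 /\ Re z < - k / 2 + b * Im w + C * X ^+ 2).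
  have [h|h] := lerP (normc z) (1 + d^-1); [by left|right].
  have z1 : 0 < normc z by rewrite normc_gt0.
  have Xz : X * normc z = 1 by rewrite XV mulVf // gt_eqF.
  have X1 : X < 1 by clear - h X0 Xz d10; nra.
  split=> //; apply: H; rewrite -/X -[ltRHS]invrK -[X in X < _]invrK ltf_pV2 ?posrE ?invr_gt0 //.
  by rewrite XV invrK; clear - h; lra.
have Rz : Re z <= m / 4.
  case: cases => [h|[X1 h]].
    by clear - h L1 L2 hm d10; have := Re_le_normc z; rewrite ler_norml => /andP[_]; lra.
  have := bIm w; rewrite -/X => h'.
  have h1 : `|b| * X <= `|b| by rewrite ler_piMr // ltW.
  have h2 : C * X ^+ 2 <= C by rewrite ler_piMr // expr_le1 // ltW.
  by clear - h h' h1 h2 kk' nk nb hL hC d10 hm; lra.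
have Rvm : Re v <= - (3 * m / 4) by clear - Rv Rz m0; lra.
have v0 : v != 0.
  by apply/eqP => v0; move: Rvm; rewrite v0 /= => h; clear - h m0; lra.
split; first by rewrite -/v; clear - Rvm m0; lra.
set N := (normc v)^-1; have nv0 : 0 < normc v by rewrite normc_gt0.
have N0 : 0 < N by rewrite invr_gt0.
have Nv : N * normc v = 1 by rewrite /N mulVf // gt_eqF.
have -> : Re (joukowski (m + k / 2)%:C ((L * m) +i* b) v) =
   Re z + k / 2 + L * m * (Re v * N ^+ 2) - b * Im v^-1.
  by rewrite Re_joukowski Re_inv -/N Rv; ring.
have nv_ge : 3 * m / 4 <= normc v.
  by clear - Rvm; have := Re_le_normc v; rewrite ler_norml => /andP[]; lra.
have nVN : normc v^-1 = N by rewrite normcV.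
have mN0 : 0 < m * N by rewrite mulr_gt0.
have key : L * m * (Re v * N ^+ 2) <= - (L / 2 * (m * N) ^+ 2).
  have -> : L * m * (Re v * N ^+ 2) = (L * m * N ^+ 2) * Re v by ring.
  have -> : - (L / 2 * (m * N) ^+ 2) = (L * m * N ^+ 2) * (- (m / 2)) by field.
  apply: ler_wpM2l; first by rewrite !mulr_ge0 // ?exprn_ge0 // ltW.
  by clear - Rvm m0; lra.
have nvle : normc v <= normc z + m.
  by apply: le_trans (le_normcD _ _) _; rewrite normcN normcR gtr0_norm.
case: cases => [h|[X1 h]].
(* Away from [p]: here [|v| <= 2 m], so the absorbing term is at least [L / 8], which exceeds all
   the others by the choice of [L]. *)
- have Rz' : Re z <= 1 + d^-1.
    by clear - h; have := Re_le_normc z; rewrite ler_norml => /andP[_]; lra.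
  have mN : 1 <= 2 * (m * N).
    by rewrite /N mulrA ler_pdivlMr // mul1r; clear - nvle h L1 L2 hm d10; lra.
  have sq : 1 / 4 <= (m * N) ^+ 2 by clear - mN; nra.
  have N1 : N <= 1 by rewrite /N invf_le1 //; clear - nv_ge L1 hm; lra.
  have := bIm (- v^-1); rewrite Im_opp normcN nVN => h2.
  have h3 : `|b| * N <= `|b| by rewrite ler_piMr.
  have h4 : L / 2 * (1 / 4) <= L / 2 * (m * N) ^+ 2 by apply: ler_wpM2l => //; exact: divr_ge0.
  by clear - Rz' kk key h2 h3 h4 hL hC nk nb d10; lra.
(* Near [p]: [|w| <= 2 m / |v|] turns both [C |w|^2] and the discrepancy [b Im (w - 1 / v)] into
   multiples of [(m / |v|)^2]. *)
- have Xz : X * normc z = 1 by rewrite XV mulVf // gt_eqF // normc_gt0.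
  have z1 : 1 < normc z by clear - Xz X1 X0; nra.
  have XN : X <= 2 * (m * N).
    rewrite XV /N -[_^-1]mul1r ler_pdivrMr ?normc_gt0 // mulrA -[2 * m * _ * _]mulrAC ler_pdivlMr //.
    by clear - nvle z1 L1 hm; nra.
  have := bIm (w - v^-1).
  rewrite {2}wz normc_subV // -XV -/N Im_add Im_opp /v addrAC subrr add0r normcN normcR (gtr0_norm m0).
  rewrite -/v => h2.
  have h3 : `|b| * (m * X * N) <= `|b| * (2 * (m * N) ^+ 2).
    by apply: ler_wpM2l => //; clear - XN mN0; nra.
  have h4 : C * X ^+ 2 <= C * (4 * (m * N) ^+ 2).
    by apply: ler_wpM2l => //; clear - XN X0; nra.
  have h5 : 0 <= (L / 2 - 2 * `|b| - 4 * C) * (m * N) ^+ 2.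
    by rewrite mulr_ge0 ?sqr_ge0 //; clear - hL hC nk nb d10; lra.
  by clear - h h2 h3 h4 h5 key; lra.
Qed.

(** The imaginary part of [c] is now [- b], since its contribution [b Im v^-1] to [Re z] has to
    reproduce [b Im z^-1] instead of cancelling it. The two differ by a multiple of [(m / |v|)^2],
    and [- L (m / |v|)^2] absorbs this together with [C / |z|^2]. *)
Lemma inner_half_plane k b C d L m v : 0 <= C -> 0 < d ->
  16 * (2 + d^-1 + `|k| + 2 * `|b| + 2 * C) <= L -> m = 64 * L -> Re v < - m ->
  let z := joukowski (m - k / 2)%:C ((L * m) +i* - b) v in
  [/\ z != 0, normc z^-1 < d & Re z < - k / 2 + b * Im z^-1 - C * normc z^-1 ^+ 2].
Proof.
move=> hC d0 hL hm vm z; have [L1 L2 L3 L4] := constants_ge hC d0 hL.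
have d10 : 0 < d^-1 by rewrite invr_gt0.
have nk := normr_ge0 k; have nb := normr_ge0 b.
have kk := ler_norm k; have bb := ler_norm b.
have kk' : - `|k| <= k by rewrite lerNl -normrN ler_norm.
have m0 : 0 < m by lra.
have L0 : 0 <= L by lra.
have bIm (a : R[i]) : b * Im a <= `|b| * normc a.
  by apply: le_trans (ler_norm _) _; rewrite normrM ler_wpM2l // Im_le_normc.
have v0 : v != 0 by apply/eqP => v0; move: vm; rewrite v0 /= => h; clear - h m0; lra.
have nvm : m < normc v.
  by clear - vm; have := Re_le_normc v; rewrite ler_norml => /andP[]; lra.
have nv0 : 0 < normc v by exact: lt_trans nvm.
set N := (normc v)^-1.
have N0 : 0 < N by rewrite invr_gt0.
have Nv : N * normc v = 1 by rewrite /N mulVf // gt_eqF.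
have nVN : normc v^-1 = N by rewrite normcV.
have N1 : N <= 1 by rewrite /N invf_le1 //; clear - nvm L1 hm; lra.
have mN1 : m * N <= 1 by rewrite /N ler_pdivrMr // mul1r ltW.
have mN0 : 0 < m * N by rewrite mulr_gt0.
have key : L * m * (Re v * N ^+ 2) <= - (L * (m * N) ^+ 2).
  have -> : L * m * (Re v * N ^+ 2) = (L * m * N ^+ 2) * Re v by ring.
  have -> : - (L * (m * N) ^+ 2) = (L * m * N ^+ 2) * (- m) by ring.
  by apply: ler_wpM2l; [rewrite !mulr_ge0 // ?exprn_ge0 // ltW|exact: ltW].
have Rz : Re z = Re v + (m - k / 2) + (L * m * (Re v * N ^+ 2) + b * Im v^-1).
  by rewrite /z Re_joukowski Re_inv -/N mulNr opprK.
have bV := bIm v^-1; rewrite nVN in bV.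
have bN : `|b| * N <= `|b| by rewrite ler_piMr.
have zv : normc (z - v) <= 2 * m.
  have -> : z - v = (m - k / 2)%:C + ((L * m) +i* - b) * v^-1 by rewrite /z /joukowski; ring.
  apply: le_trans (le_normcD _ _) _; rewrite normcR normcM nVN.
  have h1 : normc ((L * m) +i* - b) <= L * m + `|b|.
    apply: le_trans (normc_le_ReIm _) _.
    by rewrite [Re _]/= [Im _]/= normrN ger0_norm // mulr_ge0 // ltW.
  have h2 := ler_wpM2r (ltW N0) h1.
  have h3 : `|m - k / 2| <= m + `|k| by clear - kk kk' nk m0; rewrite ler_norml; lra.
  have h4 : L * (m * N) <= L by rewrite ler_piMr.
  by clear - h2 h3 h4 bN L1 L3 L4 hm; lra.
(* If [|v| <= 4 m], the absorbing term is at least [L / 16] and pushes [Re z] below [- (1 + 1 / d)];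
   this accounts for the factor 16 in the bound on [L]. If [|v| > 4 m], then [|z - v| <= 2 m] gives
   [|z| > |v| / 2]. *)
have [zd zN] : 1 + d^-1 < normc z /\ 1 <= 4 * (m * N) * normc z.
  have [h|h] := lerP (normc v) (4 * m).
  - have mN : 1 / 4 <= m * N by rewrite /N ler_pdivlMr //; clear - h; lra.
    have sq : 1 / 16 <= (m * N) ^+ 2 by clear - mN; nra.
    have Lsq : L * (1 / 16) <= L * (m * N) ^+ 2 by exact: ler_wpM2l.
    have zd : 1 + d^-1 < normc z.
      clear - Rz Lsq key bV bN vm hL hC nk nb kk' d10.
      by have := Re_le_normc z; rewrite ler_norml => /andP[]; lra.
    by split => //; apply: mulr_ege1; [clear - mN|clear - zd d10]; lra.
  - have := ler_normcB v (v - z); rewrite subKr normcB => h'.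
    have vz : normc v / 2 < normc z by clear - zv h' h; lra.
    split; first by clear - vz h hm L1 L2; lra.
    have h2 := ler_wpM2l (ltW mN0) (ltW vz).
    have h3 : m * N * (normc v / 2) = m / 2 by rewrite -mulrA [N * _]mulrA Nv mul1r.
    by clear - h2 h3 L1 hm; lra.
have nz0 : 0 < normc z by clear - zd d10; lra.
have z0 : z != 0 by rewrite -normc_gt0.
set X := normc z^-1.
have XV : X = (normc z)^-1 by rewrite /X normcV.
have X0 : 0 < X by rewrite XV invr_gt0.
have Xz : X * normc z = 1 by rewrite XV mulVf // gt_eqF.
have XN : X <= 4 * (m * N) by rewrite XV -[_^-1]mul1r ler_pdivrMr.
split => //.
  by rewrite XV -[ltRHS]invrK ltf_pV2 ?posrE //; clear - zd; lra.
have := bIm (v^-1 - z^-1); rewrite Im_add Im_opp normc_subV // -/N -XV => h1.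
have h2 : normc (z - v) * N * X <= 8 * (m * N) ^+ 2.
  have -> : 8 * (m * N) ^+ 2 = 2 * m * N * (4 * (m * N)) by ring.
  by apply: ler_pM; [rewrite mulr_ge0 ?normc_ge0 // ltW|exact: ltW|exact: (ler_wpM2r (ltW N0) zv)|].
have h3 := ler_wpM2l nb h2.
have h4 : X ^+ 2 <= (4 * (m * N)) ^+ 2.
  by rewrite ler_pXn2r // nnegrE ?mulr_ge0 // ltW.
have h5 := ler_wpM2l hC h4.
have h6 : 0 <= (L - 8 * `|b| - 16 * C) * (m * N) ^+ 2.
  by rewrite mulr_ge0 ?sqr_ge0 //; clear - hL hC nk nb d10; lra.
by rewrite Rz; clear - vm key h1 h3 h5 h6; lra.
Qed.

End Constants.

(** * Asymptotics on the pinched cone *)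

Section Asymptotics.
Variable R : realType.
Implicit Types (z w v p u : R[i]) (D : set R[i]).

(** The model is [1 / (2 r (1 - k r / 2)) = 1 / (2 r) + k / 4 + O(r)]; errors of order [r^2] in [N]
    and [X] become [O(r)] after the division by [2 r]. *)
Lemma quotient_asymptotics (r k C N X : R) : 0 < r -> `|k| * r <= 1 / 2 -> C * r ^+ 2 <= 1 / 4 ->
  `|N - 1| <= C * r ^+ 2 -> `|X - (1 - k * r / 2)| <= C * r ^+ 2 ->
  `|N / (2 * r * X) - (1 / (2 * r) + k / 4)| <= (3 * C + k ^+ 2 / 4) * r.
Proof.
move=> r0 kr Cr hN hX; set e := X - (1 - k * r / 2) in hX.
have kr' : `|k * r| <= 1 / 2 by rewrite normrM (gtr0_norm r0).
move: kr'; rewrite ler_norml => /andP[k1 k2].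
have /andP[e1 e2] : - (1 / 4) <= e <= 1 / 4 by rewrite -ler_norml (le_trans hX).
have X2 : 1 / 2 <= X by rewrite /e in e1; lra.
have X0 : 0 < X by lra.
have -> : N / (2 * r * X) - (1 / (2 * r) + k / 4) =
  (N - 1 + (k * r) ^+ 2 / 4 - e * (1 + k * r / 2)) / (2 * r * X).
  by rewrite /e; field; rewrite !gt_eqF.
have den : r <= 2 * r * X by nra.
have den0 : 0 < 2 * r * X by exact: lt_le_trans den.
rewrite normrM normfV (gtr0_norm den0) ler_pdivrMr //.
have Ck : 0 <= 3 * C + k ^+ 2 / 4.
  have : 0 <= C * r ^+ 2 by exact: le_trans hN.
  by rewrite pmulr_lge0 ?exprn_gt0 // => C0; have := sqr_ge0 k; lra.
apply: (@le_trans _ _ ((3 * C + k ^+ 2 / 4) * r * r)); last first.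
  by rewrite ler_wpM2l // mulr_ge0 // ltW.
have he : `|e * (1 + k * r / 2)| <= C * r ^+ 2 * 2.
  by rewrite normrM; apply: ler_pM => //; rewrite ler_norml; apply/andP; split; lra.
move: he hN; rewrite !ler_norml => /andP[h1 h2] /andP[h3 h4].
have h5 := sqr_ge0 (k * r).
have -> : (3 * C + k ^+ 2 / 4) * r * r = 3 * (C * r ^+ 2) + (k * r) ^+ 2 / 4 by ring.
lra.
Qed.

Lemma inv_near1 (N e : R) : e <= 1 / 2 -> `|N - 1| <= e -> `|N^-1 - 1| <= 2 * e.
Proof.
move=> e1; rewrite ler_norml => /andP[h1 h2].
have N0 : 0 < N by lra.
have Ni : N^-1 <= 2 by rewrite -[_^-1]mul1r ler_pdivrMr //; lra.
have Ni0 : 0 < N^-1 by rewrite invr_gt0.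
have -> : N^-1 - 1 = N^-1 * (1 - N) by rewrite mulrBr mulVf ?gt_eqF // mulr1.
rewrite normrM (gtr0_norm Ni0); apply: ler_pM => //; first exact: ltW.
by rewrite ler_norml; lra.
Qed.

Lemma joukowski_deriv_near1 c v r : 0 < r -> 1 <= 4 * r * normc v ->
  `|normc (joukowski_deriv c v) - 1| <= 16 * normc c * r ^+ 2 /\ `|Re (c / v)| <= 4 * normc c * r.
Proof.
move=> r0 rv.
have v0 : 0 < normc v.
  by rewrite ltNge; apply/negP => h; have := mulr_ge0_le0 (ltW (mulr_gt0 (ltr0n _ 4) r0)) h; lra.
have iv : (normc v)^-1 <= 4 * r by rewrite -[_^-1]mul1r ler_pdivrMr.
have iv0 : 0 <= (normc v)^-1 by rewrite invr_ge0 ltW.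
have nc := normc_ge0 c.
split; last first.
  apply: le_trans (Re_le_normc _) _; rewrite normcM normcV.
  by rewrite (_ : 4 * _ * r = normc c * (4 * r)) ?ler_wpM2l //; ring.
have h : normc (c / v ^+ 2) <= 16 * normc c * r ^+ 2.
  rewrite normcM normcV normcXn -exprVn.
  have -> : 16 * normc c * r ^+ 2 = normc c * (4 * r) ^+ 2 by ring.
  by rewrite ler_wpM2l // ler_pXn2r // nnegrE // mulr_ge0 // ltW.
have n1 : normc (1 : R[i]) = 1 by rewrite normc1.
have := le_normcD 1 (- (c / v ^+ 2)).
have := ler_normcB (1 : R[i]) (c / v ^+ 2).
rewrite normcN n1 /joukowski_deriv => h1 h2; rewrite ler_norml; lra.
Qed.

(** [- Re w / |w|] is the cosine of the angle to the inner normal, and it differs from [1] by at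
    most [(Im w / |w|)^2]. The quadratic pinching makes this [O(|w|^2)], the precision at which the
    curvature term becomes visible. *)
Lemma pinched_cone_polar w (eta nu r0 : R) : 0 < eta -> nu <= r0 / 2 -> nu * eta <= 1 ->
  `|Im w| < eta * Re w ^+ 2 -> - nu < Re w < 0 ->
  [/\ w != 0, normc w < r0, Re w <= - (normc w / 2) &
      `|- Re w / normc w - 1| <= eta ^+ 2 * normc w ^+ 2].
Proof.
move=> eta0 nur nue hI /andP[hR1 hR2].
have w0 : w != 0 by apply/eqP => e; move: hR2; rewrite e ltxx.
have r0' : 0 < normc w by rewrite normc_gt0.
set D := - Re w; have D0 : 0 < D by rewrite /D; lra.
have ReD : Re w = - D by rewrite /D opprK.
have IR : `|Im w| <= D.
  apply: (le_trans (ltW hI)); rewrite ReD sqrrN expr2 mulrA ler_piMl ?(ltW D0) //.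
  by apply: le_trans nue; rewrite mulrC ler_wpM2r ?ltW //; lra.
have nw := normc_le_ReIm w; rewrite ReD normrN (gtr0_norm D0) in nw.
have Dr : D <= normc w by have := Re_le_normc w; rewrite ReD normrN (gtr0_norm D0).
have sq := sqr_normcE w; rewrite ReD sqrrN in sq.
split=> //; [by lra|by lra|].
have hI2 : Im w ^+ 2 <= eta ^+ 2 * D ^+ 4.
  rewrite -[X in X <= _]real_normK ?num_real // (_ : eta ^+ 2 * D ^+ 4 = (eta * D ^+ 2) ^+ 2); last by ring.
  by rewrite ler_pXn2r // ?nnegrE ?mulr_ge0 ?sqr_ge0 // ltW //; move: hI; rewrite ReD sqrrN.
rewrite distrC ger0_norm; last by rewrite subr_ge0 ler_pdivrMr // mul1r.
rewrite -(ler_pM2r (exprn_gt0 2 r0')).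
have -> : (1 - D / normc w) * normc w ^+ 2 = normc w * (normc w - D) by field; rewrite gt_eqF.
apply: (@le_trans _ _ ((normc w + D) * (normc w - D))).
  by rewrite ler_wpM2r ?subr_ge0 // lerDl ltW.
rewrite mulrC -subr_sqr sq addrAC subrr add0r -sq (le_trans hI2) //.
rewrite (_ : eta ^+ 2 * normc w ^+ 2 * _ = eta ^+ 2 * normc w ^+ 4); last by ring.
by rewrite ler_wpM2l ?sqr_ge0 // ler_pXn2r // nnegrE ltW.
Qed.

Section NearBoundary.
Variables (m k a : R) (c w : R[i]).
Hypotheses (m1 : 1 <= m) (w0 : w != 0) (cm : 32 * normc c <= m ^+ 2).
Local Notation r := (normc w).
Hypothesis w_small : 8 * (1 + m + `|k| + m ^+ 2 + a) * r <= 1.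
Hypothesis w_dir : `|- Re w / r - 1| <= a * r ^+ 2.
Local Notation main := (1 / (2 * r) + k / 4).
Local Notation bound := ((3 * (m ^+ 2 + a) + k ^+ 2 / 4) * r).

Lemma radius_bounds : [/\ 0 < r, 0 <= a, 0 <= m, m * r <= 1 / 8 & r <= 1 / 8] /\
  [/\ `|k| * r <= 1 / 8, (m ^+ 2 + a) * r ^+ 2 <= 1 / 8 & normc c * r <= 1 / 8].
Proof.
have rr : 0 < r by rewrite normc_gt0.
have a0 : 0 <= a.
  by have := le_trans (normr_ge0 _) w_dir; rewrite pmulr_lge0 // exprn_gt0.
have hm := m1; have m2 := sqr_ge0 m; have nk := normr_ge0 k; have hc := cm.
have kr : 0 <= `|k| * r by rewrite mulr_ge0 // ltW.
have mr : 0 <= m * r by rewrite mulr_ge0; lra.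
have m2r : 0 <= m ^+ 2 * r by rewrite mulr_ge0 // ltW.
have ar : 0 <= a * r by rewrite mulr_ge0 // ltW.
have h : r + m * r + `|k| * r + m ^+ 2 * r + a * r <= 1 / 8 by have := w_small; lra.
have hcr := ler_wpM2r (ltW rr) cm.
have nc : 0 <= normc c * r by rewrite mulr_ge0 ?normc_ge0 // ltW.
split; split => //; try lra.

have r1 : r <= 1 by lra.
apply: (@le_trans _ _ ((m ^+ 2 + a) * r)); last by lra.
by rewrite ler_wpM2l ?addr_ge0 // expr2 ler_piMl // ltW.
Qed.

(** The shift cancels between [v] and [m + k / 2], so the real part of the image is
    [Re w / r^2 + k / 2 + Re (c / v)] with [Re (c / v) = O(r)]: neither [m] nor [c] enters the two
    leading terms. *)
Lemma lower_value : let v := w^-1 - m%:C in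
  `|normc (joukowski_deriv c v) / (2 * - Re (joukowski (m + k / 2)%:C c v) * r ^+ 2) - main| <= bound.
Proof.
cbv zeta; set v := w^-1 - m%:C; have [[rr a0 m0 mr r1] [kr ar cr]] := radius_bounds.
have nv : 1 <= 4 * r * normc v.
  have := ler_normcB w^-1 m%:C; rewrite normcV normcR (ger0_norm m0) -/v => h.
  have := ler_wpM2l (ltW rr) h; rewrite mulrBr divff ?gt_eqF //; lra.
have [hd hR] := joukowski_deriv_near1 c rr nv.
have -> : 2 * - Re (joukowski (m + k / 2)%:C c v) * r ^+ 2 =
    2 * r * (- Re w / r - k * r / 2 - r * Re (c / v)).
  have -> : Re (joukowski (m + k / 2)%:C c v) = Re w / r ^+ 2 + k / 2 + Re (c / v).
    by rewrite /joukowski !Re_add Re_opp Re_inv exprVn /=; ring.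
  by field; rewrite gt_eqF.
have hc := cm; have nc := normc_ge0 c; have hk := kr.
have r2 : 0 <= r ^+ 2 by rewrite sqr_ge0.
have cr2 := ler_wpM2r r2 cm.
have cr0 : 0 <= normc c * r ^+ 2 by rewrite mulr_ge0.
apply: quotient_asymptotics => //; try lra.
- by apply: le_trans hd _; have := mulr_ge0 a0 r2; lra.
- have -> : - Re w / r - k * r / 2 - r * Re (c / v) - (1 - k * r / 2) =
    (- Re w / r - 1) - r * Re (c / v) by ring.
  apply: (le_trans (ler_normB _ _)); rewrite normrM (gtr0_norm rr).
  have := ler_wpM2l (ltW rr) hR; have := w_dir.
  have -> : r * (4 * normc c * r) = 4 * (normc c * r ^+ 2) by ring.
  by have := mulr_ge0 a0 r2; lra.
Qed.

(** The point has to be the image of some [v] in the half-plane. Of the two roots the one of larger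
    modulus is taken: it has modulus at least [|1 / w - A| / 2], of order [1 / r], so [c / v] is
    [O(r)] and [Re v] follows [Re (1 / w)] to [- oo]. *)
Lemma upper_value : Re w <= - (r / 2) -> exists v,
  [/\ Re v < - m, joukowski (m - k / 2)%:C c v = w^-1 &
   `|normc w^-1 ^+ 2 / (2 * - (Re v + m) * normc (joukowski_deriv c v)) - main| <= bound].
Proof.
move=> hw; have [[rr a0 m0 mr r1] [kr ar cr]] := radius_bounds.
set A := (m - k / 2)%:C.
have [v [v' [sm pr rt nvv]]] : exists v v', [/\ v + v' = w^-1 - A, v * v' = c,
    v ^+ 2 - (w^-1 - A) * v + c = 0 & normc v' <= normc v].
  have [v1 [v2 [h1 h2 h3 h4]]] := quadratic_roots A c w^-1.
  have [h|h] : normc v1 <= normc v2 \/ normc v2 <= normc v1 by exact/orP/le_total.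
    by exists v2, v1; rewrite addrC mulrC.
  by exists v1, v2.
have Ar : `|m - k / 2| * r <= 1 / 4.
  apply: (@le_trans _ _ ((m + `|k|) * r)); last by lra.
  apply: ler_wpM2r; first exact: ltW.
  by have := ler_norm k; have := ler_norm (- k); rewrite normrN ler_norml; have := normr_ge0 k; lra.
have nv : 1 <= 4 * r * normc v.
  have h : (r^-1 - `|m - k / 2|) <= 2 * normc v.
    have := ler_normcB w^-1 A; rewrite normcV normcR -sm; have := le_normcD v v'; lra.
  have := ler_wpM2l (ltW rr) h; rewrite mulrBr divff ?gt_eqF //; lra.
have v0 : v != 0.
  apply/eqP => v0; move: nv; rewrite v0 normc0 mulr0; lra.
have E : joukowski A c v = w^-1 by apply: joukowski_root.
have [hd hR] := joukowski_deriv_near1 c rr nv.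
have Rv : Re v = Re w / r ^+ 2 - (m - k / 2) - Re (c / v).
  have : Re (joukowski A c v) = Re w / r ^+ 2 by rewrite E Re_inv exprVn.
  by rewrite /joukowski !Re_add /=; lra.
have hc := cm; have nc := normc_ge0 c.
have r2 : 0 <= r ^+ 2 by rewrite sqr_ge0.
have cr2 := ler_wpM2r r2 cm.
have cr0 : 0 <= normc c * r ^+ 2 by rewrite mulr_ge0.
exists v; split => //.
- rewrite Rv.
  have h1 : Re w / r ^+ 2 <= - (r^-1 / 2).
    rewrite ler_pdivrMr ?exprn_gt0 // (le_trans hw) // le_eqVlt.
    by apply/orP; left; apply/eqP; field; rewrite gt_eqF.
  have h2 : 8 <= r^-1 by rewrite -[8]invrK lef_pV2 ?posrE //; lra.
  have h3 : `|k| <= r^-1 / 8 by rewrite -(ler_pM2r rr) mulrAC mulVf ?gt_eqF //; lra.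
  move: hR; rewrite ler_norml => /andP[hR1 hR2].
  have := ler_norm k; lra.
- set N := normc (joukowski_deriv c v) in hd *.
  have N1 : `|N - 1| <= 16 * normc c * r ^+ 2 by [].
  have hN : `|N^-1 - 1| <= 2 * (16 * normc c * r ^+ 2) by apply: inv_near1 => //; have := mulr_ge0 a0 r2; lra.
  have N0 : N != 0 by apply/eqP => N0; move: N1; rewrite N0 sub0r normrN1 => N1; have := mulr_ge0 a0 r2; lra.
  have -> : normc w^-1 ^+ 2 / (2 * - (Re v + m) * N) =
    N^-1 / (2 * r * (- Re w / r - k * r / 2 + r * Re (c / v))).
    rewrite Rv normcV.
    have -> : 2 * r * (- Re w / r - k * r / 2 + r * Re (c / v)) =
      r ^+ 2 * (2 * - (Re w / r ^+ 2 - (m - k / 2) - Re (c / v) + m)).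
      by field; rewrite gt_eqF.
    by rewrite exprVn !invfM; ring.
  apply: quotient_asymptotics => //; try lra.
  + by apply: le_trans hN _; have := mulr_ge0 a0 r2; lra.
  + have -> : - Re w / r - k * r / 2 + r * Re (c / v) - (1 - k * r / 2) =
      (- Re w / r - 1) + r * Re (c / v) by ring.
    apply: (le_trans (ler_normD _ _)); rewrite normrM (gtr0_norm rr).
    have := ler_wpM2l (ltW rr) hR; have := w_dir.
    have -> : r * (4 * normc c * r) = 4 * (normc c * r ^+ 2) by ring.
    by have := mulr_ge0 a0 r2; lra.
Qed.

End NearBoundary.

End Asymptotics.

Theorem theorem3p2 (R : realType) (D : set R[i]) (p : R[i])
    (phi : R[i] -> R) (FD : R[i] -> R) (eta : R) :
  domain_of_class 4 D ->
  boundary D p ->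
  local_defining 4 D p phi ->
  (exists F : metric_family R,
     invariant_metric F /\ FD = planar_metric F D) \/
  (exists B : R[i] -> R[i] -> R[i],
     is_bergman_kernel D B /\ FD = bergman_diag B) ->
  0 < eta ->
  \forall nu \near 0^'+,
    pinched_cone (outward_normal phi p) p eta nu `<=` D /\
    exists M : R, forall z : R[i],
      pinched_cone (outward_normal phi p) p eta nu z ->
      `|FD z - (1 / (2 * normc (z - p)) + curvature phi p / 4)|
        <= M * normc (z - p).
Proof.
move=> [domD _] bD def hF eta0; have [_ oD _] := domD.
have ext : extremal D FD.
  case: hF => [[F [iF ->]]|[B [hB ->]]]; first exact: metric_extremal.
  exact: bergman_extremal.
have [u0 u1 [b [C [d [C0 d0 shape]]]]] := local_shape oD bD def.
set u := outward_normal phi p in u0 u1 shape *; set k := curvature phi p in shape *.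
pose L := 16 * (2 + d^-1 + `|k| + 2 * `|b| + 2 * C); pose m := 64 * L.
have L1 : 16 * (2 + d^-1 + `|k| + 2 * `|b| + 2 * C) <= L by [].
have L2 : 16 * (2 + d^-1 + `|k| + 2 * `|- b| + 2 * C) <= L by rewrite normrN.
have mL : m = 64 * L by [].
have L32 : 32 <= L by have [] := constants_ge C0 d0 L1.
have m1 : 1 <= m by lra.
have m2 := sqr_ge0 m.
have small (x : R) : (x = b \/ x = - b) -> normc ((L * m) +i* x) <= (m / 4) ^+ 2 / 2.
  case=> ->; first exact: (joukowski_parameter_small C0 d0 L1 mL).
  exact: (joukowski_parameter_small C0 d0 L2 mL).
have Ku w : u * (conjc u * w) = w by rewrite mulrA mulc_conj u1 expr1n mul1r.
have Dp : ~ D p by move=> Dp; apply: bD.2; exact: (open_nbhs_nbhs (conj oD Dp)).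
have outer z : D z -> [/\ conjc u * (z - p) != 0, Re ((conjc u * (z - p))^-1 - m%:C) < - (m / 4) &
    Re (joukowski (m + k / 2)%:C ((L * m) +i* b) ((conjc u * (z - p))^-1 - m%:C)) < 0].
  move=> Dz; set w := conjc u * (z - p).
  have wz : u * w + p = z by rewrite /w Ku subrK.
  have w0 : w != 0 by apply/eqP => w0; apply: Dp; rewrite (_ : p = z) // -wz w0 mulr0 add0r.
  have [|h1 h2] := outer_half_plane C0 d0 L1 mL w0; last by split.
  by move=> wd; apply: (shape w w0 wd).1; rewrite wz.
have inner v : Re v < - m -> joukowski (m - k / 2)%:C ((L * m) +i* - b) v != 0 /\
    D (u * (joukowski (m - k / 2)%:C ((L * m) +i* - b) v)^-1 + p).
  move=> vm; have [z0 zd Rz] := inner_half_plane C0 d0 L1 mL vm; split => //.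
  apply: (shape _ _ zd).2; first by rewrite invr_eq0.
  by rewrite invrK.
have m4 : 0 < m / 4 by lra.
have LB := lower_bound_map oD ext u0 u1 m4 (small _ (or_introl erefl)) outer.
have m0 : 0 < m by lra.
have sm2 : normc ((L * m) +i* - b) <= m ^+ 2 / 2.
  by apply: le_trans (small _ (or_intror erefl)) _; rewrite exprMn exprVn; lra.
have UB := upper_bound_map ext u0 u1 m0 sm2 inner.
(* The factor of [w_small] at [a = eta^2]. On the cone, [nu < K^-1 / 2] gives [|w| < K^-1], and
   [nu < eta^-1] gives [|Im w| <= |Re w|]. *)
pose K := 8 * (1 + m + `|k| + m ^+ 2 + eta ^+ 2).
have K0 : 0 < K by have := sqr_ge0 eta; have := normr_ge0 k; rewrite /K; lra.
have nu00 : 0 < Num.min (K^-1 / 2) eta^-1 by rewrite lt_min divr_gt0 ?invr_gt0.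
have cone nu : nu < Num.min (K^-1 / 2) eta^-1 -> forall z, pinched_cone u p eta nu z ->
    D z /\ `|FD z - (1 / (2 * normc (z - p)) + k / 4)| <=
      (3 * (m ^+ 2 + eta ^+ 2) + k ^+ 2 / 4) * normc (z - p).
  rewrite lt_min => /andP[nu1 nu2] z [hI hR].
  have ne : nu * eta <= 1 by rewrite -ler_pdivlMr // mul1r ltW.
  set w := conjc u * (z - p) in hI hR.
  have wz : u * w + p = z by rewrite /w Ku subrK.
  have rE : normc (z - p) = normc w by rewrite /w normcM normc_conj u1 mul1r.
  have [w0 wK wR wdir] := pinched_cone_polar eta0 (ltW nu1) ne hI hR.
  have wsm : K * normc w <= 1 by rewrite -ler_pdivlMl // mulr1 ltW.
  have c32 x : (x = b \/ x = - b) -> 32 * normc ((L * m) +i* x) <= m ^+ 2.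
    by move=> /small; rewrite exprMn exprVn; lra.
  have [v [vm vE vB]] := upper_value m1 w0 (c32 _ (or_intror erefl)) wsm wdir wR.
  (* That the cone lies in [D] comes from the inner map: [z] is the image of a point of the
     half-plane. *)
  have Dz : D z by have [_] := inner v vm; rewrite vE invrK wz.
  split => //.
  have := UB v vm; rewrite vE invrK wz => ub.
  have lb := LB z Dz; cbv zeta in lb; rewrite -/w rE in lb.
  have lv := lower_value m1 w0 (c32 _ (or_introl erefl)) wsm wdir; cbv zeta in lv.
  rewrite rE; move: lv vB; rewrite !ler_norml => /andP[l1 _] /andP[_ l2].
  by clear - l1 l2 lb ub; apply/andP; split; lra.
apply: filterS (nbhs_right_lt nu00) => nu /cone h; split => [z /h[]//|].
by exists (3 * (m ^+ 2 + eta ^+ 2) + k ^+ 2 / 4) => z /h[].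
Qed.
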